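(* Let $X$ be a nonempty set, let $s$ be a normalized complete Pick kernel on $X$, and let $\ell=g s$ where $g$ is a positive semi-definite kernel on $X$ (assume $\ell_z\neq 0$ for all $z\in X$). Then a sequence $\{\lambda_i\}\subset X$ is interpolating for $\mathrm{Mult}(\mathcal{H}_s,\mathcal{H}_\ell)$ if and only if it satisfies the Carleson measure condition for $\mathcal{H}_s$ and is $n$-weakly separated by $\ell$ for every $n\ge 2$.
   Context: A kernel on a nonempty set $X$ is a positive semi-definite function $k:X\times X\to\mathbb{C}$; $\mathcal{H}_k$ is its reproducing kernel Hilbert space, $k_w=k(\cdot,w)$ (so $\langle k_w,k_z\rangle=k(z,w)$ and $\|k_w\|^2=k(w,w)$), and $\hat k_w=k_w/\|k_w\|$ when $k_w\ne 0$. A normalized complete Pick kernel is a kernel of the form $s(z,w)=\frac{1}{1-\langle b(z),b(w)\rangle_{\mathcal K}}$, where $b$ maps $X$ into the open unit ball of an auxiliary Hilbert space $\mathcal K$ and $b(w_0)=0$ for some $w_0\in X$. For kernels $k,\ell$ on $X$, $\mathrm{Mult}(\mathcal{H}_k,\mathcal{H}_\ell)$ is the set of functions $\phi:X\to\mathbb{C}$ such that $f\mapsto\phi f$ is a bounded operator $\mathcal{H}_k\to\mathcal{H}_\ell$, normed by the operator norm. A sequence $\{\lambda_i\}\subset X$ is interpolating for $\mathrm{Mult}(\mathcal{H}_k,\mathcal{H}_\ell)$ if for every bounded sequence $\{w_i\}$ of complex numbers there is $\phi\in\mathrm{Mult}(\mathcal{H}_k,\mathcal{H}_\ell)$ with $\phi(\lambda_i)=w_i\frac{\|\ell_{\lambda_i}\|}{\|k_{\lambda_i}\|}$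 for all $i$. A sequence $\{\lambda_i\}$ satisfies the Carleson measure condition for $\mathcal{H}_k$ if there is $C>0$ with $\sum_i \frac{|f(\lambda_i)|^2}{\|k_{\lambda_i}\|^2}\le C\|f\|^2_{\mathcal{H}_k}$ for all $f\in\mathcal{H}_k$. For $n\ge 2$, a sequence $\{\lambda_i\}$ (of distinct points) is $n$-weakly separated by $k$ if there is $\epsilon>0$ such that for every $n$-point subset $\{\mu_1,\dots,\mu_n\}$ of $\{\lambda_i\}$, $\mathrm{dist}\big(\hat k_{\mu_1},\mathrm{span}\{\hat k_{\mu_2},\dots,\hat k_{\mu_n}\}\big)\ge\epsilon$ (distance in $\mathcal{H}_k$). *)

(* Defs.v *)
(* R : realType (any model of the real numbers),
   complex numbers C := R[i] from mathcomp-real-closed. *)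
From HB Require Import structures.
From mathcomp Require Import all_boot all_order all_algebra.
From mathcomp Require Import complex.
From mathcomp Require Import classical_sets reals.
Set Implicit Arguments. Unset Strict Implicit. Unset Printing Implicit Defensive.
Import Order.TTheory GRing.Theory Num.Theory.
Local Open Scope ring_scope.

Section RKHS.
Variable R : realType.
Local Notation C := R[i].

(* modulus of a complex number, as a real number *)
Definition cabs (z : C) : R := complex.Re `|z|.

(* For a finite family x_0..x_{n-1} in X and coefficients c, the quantity
   || sum_i c_i k_{x_i} ||^2 = sum_{i,j} conj(c_i) c_j k(x_i, x_j),
   using the convention <k_w, k_z> = k(z, w). *)
Definition kform (X : Type) (k : X -> X -> C) (n : nat) (x : 'I_n -> X)
    (c : 'I_n -> C) : C :=
  \sum_(i < n) \sum_(j < n) (c i)^* * c j * k (x i) (x j).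

(* k is a kernel: positive semi-definite *)
Definition is_kernel (X : Type) (k : X -> X -> C) : Prop :=
  forall (n : nat) (x : 'I_n -> X) (c : 'I_n -> C), 0 <= kform k x c.

(* Reproducing kernel Hilbert space H_k, as a space of functions X -> C
   (Aronszajn): f in H_k with ||f|| <= M iff for every finite combination
   g = sum_i c_i k_{x_i},  |<f, g>| = |sum_i conj(c_i) f(x_i)| <= M ||g||. *)
Definition rkhs_bound (X : Type) (k : X -> X -> C) (f : X -> C) (M : R) : Prop :=
  forall (n : nat) (x : 'I_n -> X) (c : 'I_n -> C),
    `| \sum_(i < n) (c i)^* * f (x i) | ^+ 2 <= ((M ^+ 2)%:C)%C * kform k x c.

Definition in_rkhs (X : Type) (k : X -> X -> C) (f : X -> C) : Prop :=
  exists M : R, rkhs_bound k f M.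

(* the norm of f in H_k *)
Definition rkhs_norm (X : Type) (k : X -> X -> C) (f : X -> C) : R :=
  inf [set M : R | 0 <= M /\ rkhs_bound k f M].

(* ||k_w|| *)
Definition knorm (X : Type) (k : X -> X -> C) (w : X) : R :=
  rkhs_norm k (fun z => k z w).

(* normalized kernel function \hat k_w = k_w / ||k_w|| *)
Definition khat (X : Type) (k : X -> X -> C) (w : X) : X -> C :=
  fun z => k z w / ((knorm k w)%:C)%C.

(* phi in Mult(H_k, H_l): f |-> phi f is a bounded operator H_k -> H_l *)
Definition is_multiplier (X : Type) (k l : X -> X -> C) (phi : X -> C) : Prop :=
  exists Cst : R, forall f : X -> C, in_rkhs k f ->
    in_rkhs l (fun z => phi z * f z) /\
    rkhs_norm l (fun z => phi z * f z) <= Cst * rkhs_norm k f.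

(* {lam_i} is interpolating for Mult(H_k, H_l) *)
Definition interpolating (X : Type) (k l : X -> X -> C) (lam : nat -> X) : Prop :=
  forall w : nat -> C, (exists B : R, forall i, cabs (w i) <= B) ->
    exists phi : X -> C, is_multiplier k l phi /\
      forall i, phi (lam i) = w i * ((knorm l (lam i) / knorm k (lam i))%:C)%C.

(* Carleson measure condition for H_k (the series of nonnegative terms is
   bounded by C ||f||^2 iff all its partial sums are) *)
Definition carleson (X : Type) (k : X -> X -> C) (lam : nat -> X) : Prop :=
  exists Cst : R, 0 < Cst /\ forall f : X -> C, in_rkhs k f ->
    forall N : nat,
      \sum_(i < N) cabs (f (lam i)) ^+ 2 / knorm k (lam i) ^+ 2
        <= Cst * rkhs_norm k f ^+ 2.

(* distance in H_k from f to span{ g j | P j } *)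
Definition rkhs_dist (X : Type) (k : X -> X -> C) (f : X -> C) (m : nat)
    (g : 'I_m -> X -> C) (P : pred 'I_m) : R :=
  inf [set d : R | exists c : 'I_m -> C,
         d = rkhs_norm k (fun z => f z - \sum_(j < m | P j) c j * g j z)].

(* {lam_i} is n-weakly separated by k: for every n-point subset
   {mu_1, ..., mu_n} of {lam_i} (mu_{i0} playing the role of mu_1),
   dist(\hat k_{mu_{i0}}, span{\hat k_{mu_j} : j <> i0}) >= eps. *)
Definition weakly_separated (X : Type) (k : X -> X -> C) (lam : nat -> X)
    (n : nat) : Prop :=
  exists eps : R, 0 < eps /\
    forall mu : 'I_n -> X, injective mu -> (forall i, exists m, mu i = lam m) ->
      forall i0 : 'I_n,
        eps <= rkhs_dist k (khat k (mu i0)) (fun j => khat k (mu j))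
                 (fun j => j != i0).

(* ip is an inner product on the complex vector space V
   (linear in the first argument) *)
Definition is_inner_product (V : lmodType C) (ip : V -> V -> C) : Prop :=
  [/\ (forall (a : C) (x y z : V), ip (a *: x + y) z = a * ip x z + ip y z),
      (forall x y : V, ip y x = (ip x y)^*),
      (forall x : V, 0 <= ip x x) &
      (forall x : V, ip x x = 0 -> x = 0)].

(* completeness for the norm ||x|| = sqrt(ip x x) *)
Definition ip_complete (V : lmodType C) (ip : V -> V -> C) : Prop :=
  forall u : nat -> V,
    (forall e : R, 0 < e -> exists N, forall m n, (N <= m)%N -> (N <= n)%N ->
       cabs (ip (u m - u n) (u m - u n)) < e) ->
    exists x : V, forall e : R, 0 < e -> exists N, forall n, (N <= n)%N ->
       cabs (ip (u n - x) (u n - x)) < e.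

(* s is a normalized complete Pick kernel:
   s(z,w) = 1 / (1 - <b(z), b(w)>_K) with b : X -> open unit ball of a
   Hilbert space K and b(w0) = 0 for some w0. *)
Definition normalized_complete_pick (X : Type) (s : X -> X -> C) : Prop :=
  exists (K : lmodType C) (ip : K -> K -> C) (b : X -> K),
    [/\ is_inner_product ip, ip_complete ip,
        (forall z, ip (b z) (b z) < 1),
        (exists w0, b w0 = 0) &
        (forall z w, s z w = (1 - ip (b z) (b w))^-1)].

End RKHS.

(* Main.v *)
(* If the sequence is interpolating then, by a gliding hump argument, the norms of
   the interpolating multipliers are uniformly controlled on the span of the
   kernel functions at the points of the sequence. Averaging over all targets with
   values +1 and -1 turns this control into an upper Riesz bound for the normalized
   kernel functions of [s], which is the Carleson condition, and into a lower Riesz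
   bound for those of [l], which gives weak separation.
   Conversely, the Carleson condition leaves only boundedly many points near a given
   one. Among them weak separation applies, and the others are killed by a product
   of contractive multipliers; hence each normalized kernel function of [l] stays at a
   uniform distance from the span of all the others. This says that a diagonal column
   of functions is a contractive multiplier on the sequence. The column-row inequality,
   proved on the full Fock space, transposes the column to a row and gives the lower
   Riesz bound for [l]; together with the Carleson condition it solves the
   interpolation problem on the sequence. The solution extends to [X] point by point,
   by the Hahn-Banach theorem and Zorn's lemma. *)
Require Import Defs.
From mathcomp Require Import all_boot all_order all_algebra.
From mathcomp Require Import complex ring lra zify.
From mathcomp Require Import spectral sesquilinear.
From mathcomp Require Import boolp classical_sets reals.
From mathcomp Require sequences exp normed_module.
Set Implicit Arguments. Unset Strict Implicit. Unset Printing Implicit Defensive.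
Import Order.TTheory GRing.Theory Num.Theory.
Import normed_module.numFieldNormedType.Exports.
Local Open Scope ring_scope.

Local Notation normsq z := (z * z^*).
Local Notation "x %:C" := (real_complex _ x) : ring_scope.

(** * Positive semi-definite matrices indexed by finite types *)

Section PositiveSemidefinite.
Variable C : numClosedFieldType.
Implicit Types I J : finType.

Lemma sum_deltaM I (i : I) (F : I -> C) : \sum_k (k == i)%:R * F k = F i.
Proof.
rewrite (bigD1 i) //= eqxx mul1r big1 ?addr0 // => k /negPf ->.
by rewrite mul0r.
Qed.

Lemma normsq_le0 (z : C) : normsq z <= 0 -> z = 0.
Proof.
move=> z_le0; have /eqP : normsq z = 0 by apply/le_anti; rewrite z_le0 mul_conjC_ge0.
by rewrite mul_conjC_eq0 => /eqP.
Qed.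

Lemma sum_normsq_ge0 (T : Type) (r : seq T) (P : pred T) (F : T -> C) :
  0 <= \sum_(i <- r | P i) normsq (F i).
Proof. by apply: sumr_ge0 => i _; exact: mul_conjC_ge0. Qed.

Lemma hermitian_form2_discr (x z w : C) : 0 <= x ->
  (forall t, 0 <= normsq t * x + t * w + t^* * w^* + z) -> normsq w <= x * z.
Proof.
move=> x_ge0 form_ge0.
have z_ge0 : 0 <= z by have := form_ge0 0; rewrite conjC0 !mul0r !add0r.
have [x_eq0|x_neq0] := eqVneq x 0; last first.
  rewrite -subr_ge0; have := mulr_ge0 x_ge0 (form_ge0 (- w^* / x)).
  rewrite rmorphM rmorphN fmorphV /= conjCK (geC0_conj x_ge0).
  by congr (0 <= _); field.
have [->|w_neq0] := eqVneq w 0; first by rewrite mul0r mulr_ge0.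
have nw_real : (normsq w)^* = normsq w by rewrite geC0_conj ?mul_conjC_ge0.
have := form_ge0 (- (z + 1) / normsq w * w^*).
rewrite x_eq0 mulr0 add0r !(rmorphM, rmorphN, rmorphD, fmorphV) /= conjCK conjC1.
rewrite (geC0_conj z_ge0).
have -> : - (z + 1) / normsq w * w^* * w + - (z + 1) / (w^* * w) * w * w^* + z = - (z + 2).
  by field; rewrite w_neq0 conjC_eq0.
by rewrite oppr_ge0 lt_geF // ltr_wpDl ?ltr0n.
Qed.

Lemma hermitian_form_CauchySchwarz (V : Type) (lincomb : C -> V -> V -> V)
    (H : V -> V -> C) :
  (forall a x y z, H (lincomb a x y) z = a * H x z + H y z) ->
  (forall x y, H y x = (H x y)^*) ->
  forall x y, 0 <= H x x -> (forall a, 0 <= H (lincomb a x y) (lincomb a x y)) ->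
  normsq (H x y) <= H x x * H y y.
Proof.
move=> H_linear H_herm x y Hxx_ge0 H_ge0; apply: hermitian_form2_discr => // t.
have := H_ge0 t; set z := lincomb t x y.
have Hz u : H u z = t^* * H u x + H u y.
  by rewrite (H_herm z u) H_linear rmorphD rmorphM /= -!H_herm.
rewrite {1}/z H_linear !Hz (H_herm x y).
by congr (0 <= _); ring.
Qed.

Definition qform I (K : I -> I -> C) (c : I -> C) : C :=
  \sum_i \sum_j (c i)^* * c j * K i j.

Definition psd I (K : I -> I -> C) := forall c, 0 <= qform K c.

Lemma eq_qform I (K L : I -> I -> C) c d :
  (forall i j, K i j = L i j) -> c =1 d -> qform K c = qform L d.
Proof.
by move=> KL cd; apply: eq_bigr => i _; apply: eq_bigr => j _; rewrite KL !cd.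
Qed.

Lemma eq_psd I (K L : I -> I -> C) : (forall i j, K i j = L i j) -> psd K -> psd L.
Proof. by move=> KL psdK c; rewrite -(eq_qform KL (frefl c)). Qed.

Lemma qform_scale I (K : I -> I -> C) a c :
  qform K (fun i => a * c i) = normsq a * qform K c.
Proof.
rewrite mulr_sumr; apply: eq_bigr => i _; rewrite mulr_sumr; apply: eq_bigr => j _.
by rewrite rmorphM /=; ring.
Qed.

Lemma qform_rescale I (K : I -> I -> C) (v : I -> C) c :
  qform (fun i j => v i * (v j)^* * K i j) c = qform K (fun i => (v i)^* * c i).
Proof.
apply: eq_bigr => i _; apply: eq_bigr => j _.
by rewrite rmorphM /= conjCK; ring.
Qed.

Lemma qformD I (K L : I -> I -> C) c :
  qform (fun i j => K i j + L i j) c = qform K c + qform L c.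
Proof.
rewrite -big_split; apply: eq_bigr => i _; rewrite -big_split; apply: eq_bigr => j _.
by rewrite /= mulrDr.
Qed.

Lemma qformZ I a (K : I -> I -> C) c : qform (fun i j => a * K i j) c = a * qform K c.
Proof.
rewrite mulr_sumr; apply: eq_bigr => i _; rewrite mulr_sumr; apply: eq_bigr => j _.
by rewrite mulrCA.
Qed.

Lemma qformB I (K L : I -> I -> C) c :
  qform (fun i j => K i j - L i j) c = qform K c - qform L c.
Proof.
rewrite -mulN1r -qformZ -qformD; apply: eq_qform => // i j.
by rewrite mulN1r.
Qed.

Lemma qform_sum (T : Type) (r : seq T) I (K : T -> I -> I -> C) c :
  qform (fun i j => \sum_(t <- r) K t i j) c = \sum_(t <- r) qform (K t) c.
Proof.
rewrite [RHS]exchange_big; apply: eq_bigr => i _; rewrite [RHS]exchange_big.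
by apply: eq_bigr => j _; rewrite mulr_sumr.
Qed.

Lemma qform_rank1 I (v c : I -> C) :
  qform (fun i j => v i * (v j)^*) c = normsq (\sum_i (c i)^* * v i).
Proof.
rewrite mulr_suml; apply: eq_bigr => i _.
rewrite rmorph_sum mulr_sumr; apply: eq_bigr => j _.
by rewrite rmorphM /= conjCK; ring.
Qed.

Lemma qform_comp I J (h : I -> J) (K : J -> J -> C) (c : I -> C) :
  qform (fun i i' => K (h i) (h i')) c = qform K (fun j => \sum_(i | h i == j) c i).
Proof.
rewrite /qform (partition_big h predT) //=; apply: eq_bigr => j _.
transitivity (\sum_(i | h i == j) \sum_j' \sum_(i' | h i' == j') (c i)^* * c i' * K j j').
  apply: eq_bigr => i /eqP hi; rewrite (partition_big h predT) //=.
  by apply: eq_bigr => j' _; apply: eq_bigr => i' /eqP hi'; rewrite hi hi'.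
rewrite exchange_big; apply: eq_bigr => j' _ /=.
rewrite rmorph_sum !mulr_suml; apply: eq_bigr => i _.
by rewrite mulr_sumr mulr_suml.
Qed.

Lemma qform_support I (K : I -> I -> C) (S : {set I}) (c : I -> C) :
  (forall i, i \notin S -> c i = 0) -> qform K c =
  qform (fun i j : 'I_#|S| => K (enum_val i) (enum_val j)) (fun i => c (enum_val i)).
Proof.
move=> c_supp.
have sumS (F : I -> C) : (forall i, i \notin S -> F i = 0) ->
    \sum_i F i = \sum_(i < #|S|) F (enum_val i).
  move=> F_supp; rewrite -(big_enum_val (A := mem S) F) [RHS]big_mkcond.
  by apply: eq_bigr => i _; case: ifPn => // /F_supp.
rewrite /qform sumS => [|i iS]; last first.
  by rewrite big1 // => j _; rewrite c_supp // conjC0 !mul0r.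
apply: eq_bigr => i _; rewrite sumS // => j jS.
by rewrite (c_supp j) // mulr0 mul0r.
Qed.

Lemma psd_comp I J (h : I -> J) (K : J -> J -> C) :
  psd K -> psd (fun i i' => K (h i) (h i')).
Proof. by move=> psdK c; rewrite qform_comp. Qed.

Lemma psdD I (K L : I -> I -> C) : psd K -> psd L -> psd (fun i j => K i j + L i j).
Proof. by move=> psdK psdL c; rewrite qformD addr_ge0. Qed.

Lemma psdZ I a (K : I -> I -> C) : 0 <= a -> psd K -> psd (fun i j => a * K i j).
Proof. by move=> a_ge0 psdK c; rewrite qformZ mulr_ge0. Qed.

Lemma psd_rank1 I (v : I -> C) : psd (fun i j => v i * (v j)^*).
Proof. by move=> c; rewrite qform_rank1 mul_conjC_ge0. Qed.

Lemma psd_qformD_le I (K : I -> I -> C) a b : psd K ->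
  qform K (fun i => a i + b i) <= 2 * qform K a + 2 * qform K b.
Proof.
move=> psdK; rewrite -subr_ge0; have := psdK (fun i => a i - b i); congr (0 <= _).
rewrite /qform !mulr_sumr -big_split -sumrB; apply: eq_bigr => i _ /=.
rewrite !mulr_sumr -big_split -sumrB; apply: eq_bigr => j _ /=.
by rewrite rmorphB rmorphD /=; ring.
Qed.

Definition gram (T : Type) J (v : T -> J -> C) (i i' : T) : C := \sum_r v i r * (v i' r)^*.

Lemma gram_psd I J (v : I -> J -> C) : psd (gram v).
Proof.
move=> c; rewrite /gram (qform_sum _ (fun r i j => v i r * (v j r)^*)).
by apply: sumr_ge0 => r _; exact: psd_rank1.
Qed.

Lemma psd_pair I (K : I -> I -> C) i j (a b : C) : psd K ->
  0 <= normsq a * K i i + a^* * b * K i j + b^* * a * K j i + normsq b * K j j.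
Proof.
pose h (x : bool) := if x then i else j.
move=> /(psd_comp h) /(_ (fun x => if x then a else b)).
by rewrite /qform !big_bool; congr (0 <= _); rewrite /=; ring.
Qed.

Lemma psd_diag_ge0 I (K : I -> I -> C) i : psd K -> 0 <= K i i.
Proof.
by move=> /(psd_pair i i 1 0); rewrite conjC1 conjC0 !(mul1r, mul0r, mulr0, addr0).
Qed.

Lemma psd_herm I (K : I -> I -> C) i j : psd K -> K j i = (K i j)^*.
Proof.
move=> psdK.
have Kii_real : (K i i)^* = K i i by rewrite geC0_conj ?psd_diag_ge0.
have Kjj_real : (K j j)^* = K j j by rewrite geC0_conj ?psd_diag_ge0.
have := geC0_conj (psd_pair i j 1 1 psdK); have := geC0_conj (psd_pair i j 1 'i psdK).
rewrite !rmorphD !rmorphM /= !conjCK !conjC1 Kii_real Kjj_real !conjCi !(mul1r, mulr1).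
move=> im_part re_part.
have sumE : (K i j)^* + (K j i)^* = K i j + K j i.
  by apply: (addrI (K i i)); apply: (addIr (K j j)); rewrite !addrA.
have diffE : (K i j)^* - (K j i)^* = K j i - K i j.
  apply: (mulfI (neq0Ci C)); apply: (addrI (- K i i)); apply: (addIr ('i * 'i * K j j)).
  transitivity (- (K i i + - 'i * (K i j)^* + 'i * (K j i)^* + - 'i * 'i * K j j)); first by ring.
  by rewrite im_part; ring.
apply: (@mulfI _ 2); first by rewrite pnatr_eq0.
transitivity (K i j + K j i + (K j i - K i j)); first by ring.
by rewrite -sumE -diffE; ring.
Qed.

Local Open Scope sesquilinear_scope.

Lemma psd_spectral n (A : 'M[C]_n) : psd (fun i j => A i j) ->
  exists (U : 'M[C]_n) (d : 'rV[C]_n), [/\ U *m U^t* = 1%:M,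
    A = U^t* *m diag_mx d *m U & forall i, 0 <= d 0 i].
Proof.
move=> psdA; pose U := spectralmx A; pose d := spectral_diag A.
have A_herm : A \is hermsymmx.
  apply/is_hermitianmxP; rewrite expr0 scale1r; apply/matrixP => i j.
  by rewrite !mxE; exact: (psd_herm j i psdA).
have U_unitary : U \is unitarymx by exact: spectral_unitarymx.
have AE : A = U^t* *m diag_mx d *m U.
  by rewrite -(invmx_unitary U_unitary); exact/orthomx_spectralP/hermitian_normalmx.
have UU : U *m U^t* = 1%:M by exact/unitarymxP.
exists U, d; split => // r.
have -> : d 0 r = (U *m A *m U^t*) r r.
  rewrite AE !mulmxA UU mul1mx -[diag_mx d *m U *m _]mulmxA UU mulmx1.
  by rewrite mxE eqxx mulr1n.
have := psdA (fun q => (U r q)^*); rewrite /qform exchange_big.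
congr (0 <= _); rewrite mxE; apply: eq_bigr => j _.
rewrite !mxE mulr_suml; apply: eq_bigr => i _.
by rewrite conjCK; ring.
Qed.

Lemma psd_gram I (K : I -> I -> C) : psd K ->
  exists v : I -> I -> C, forall i j, K i j = gram v i j.
Proof.
move=> psdK; pose A := \matrix_(p < #|I|, q < #|I|) K (enum_val p) (enum_val q).
have [|U [d [_ AE d_ge0]]] := @psd_spectral _ A.
  by apply: eq_psd (psd_comp enum_val psdK) => p q; rewrite mxE.
pose v i r := (U (enum_rank r) (enum_rank i))^* * sqrtC (d 0 (enum_rank r)).
exists v => i j; have := congr1 (fun M : 'M_(_) => M (enum_rank i) (enum_rank j)) AE.
rewrite /= !mxE !enum_rankK => ->; rewrite [RHS]big_enum_val; apply: eq_bigr => p _.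
rewrite /v !enum_valK mul_mx_diag !mxE rmorphM /= conjCK.
by rewrite (geC0_conj (_ : 0 <= sqrtC _)) ?sqrtC_ge0 // -[in LHS](sqrtCK (d 0 p)); ring.
Qed.

Lemma psdM I (K L : I -> I -> C) : psd K -> psd L -> psd (fun i j => K i j * L i j).
Proof.
move=> psdK /psd_gram[v LE] c.
rewrite (eq_qform (L := fun i j => \sum_r v i r * (v j r)^* * K i j) (d := c)) //.
  rewrite (qform_sum _ (fun r i j => v i r * (v j r)^* * K i j)).
  by apply: sumr_ge0 => r _; rewrite qform_rescale.
by move=> i j; rewrite LE mulrC mulr_suml.
Qed.

Lemma psdX I (K : I -> I -> C) n : psd K -> psd (fun i j => K i j ^+ n).
Proof.
move=> psdK; elim: n => [|n IHn].
  by apply: eq_psd (psd_rank1 (fun=> 1)) => i j; rewrite conjC1 mulr1.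
by apply: eq_psd (psdM psdK IHn) => i j; rewrite exprS.
Qed.

Lemma trmxC_mul m n p (A : 'M[C]_(m, n)) (B : 'M[C]_(n, p)) :
  (A *m B)^t* = B^t* *m A^t*.
Proof. by rewrite trmx_mul map_mxM. Qed.

Lemma mulmx_trmxC_eq0 m n (A : 'M[C]_(m, n)) : A *m A^t* = 0 -> A = 0.
Proof.
move=> AA0; apply/matrixP => i j; rewrite [RHS]mxE.
have /eqP : (A *m A^t*) i i = 0 by rewrite AA0 mxE.
rewrite mxE psumr_eq0; last by move=> k _; rewrite !mxE mul_conjC_ge0.
move=> /allP /(_ j); rewrite mem_index_enum => /(_ isT) /=.
by rewrite !mxE mul_conjC_eq0 => /eqP.
Qed.

Lemma psd_pseudo_inverse n (A : 'M[C]_n) : psd (fun i j => A i j) ->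
  exists P : 'M[C]_n, [/\ P^t* = P, A *m P *m A = A & P *m A *m P = P].
Proof.
move=> /psd_spectral[U [d [UU -> d_ge0]]].
pose e : 'rV[C]_n := \row_i (d 0 i)^-1.
have UC (S T : 'M[C]_n) :
    (U^t* *m S *m U) *m (U^t* *m T *m U) = U^t* *m (S *m T) *m U.
  by rewrite !mulmxA -[_ *m U *m U^t*]mulmxA UU mulmx1.
exists (U^t* *m diag_mx e *m U); split.
- rewrite !trmxC_mul trmxCK mulmxA; congr (_ *m _ *m _).
  apply/matrixP => i j; rewrite !mxE eq_sym; case: eqP => [->|] //.
    by rewrite !mulr1n fmorphV /= geC0_conj.
  by rewrite !mulr0n conjC0.
- rewrite !UC !mulmx_diag; congr (_ *m diag_mx _ *m _).
  apply/rowP => i; rewrite !mxE; have [->|di] := eqVneq (d 0 i) 0; first by rewrite mulr0.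
  by rewrite divff // mul1r.
- rewrite !UC !mulmx_diag; congr (_ *m diag_mx _ *m _).
  apply/rowP => i; rewrite !mxE; have [->|di] := eqVneq (d 0 i) 0.
    by rewrite invr0 !mulr0.
  by rewrite mulVf // mul1r.
Qed.

(* The contraction is [D^* (D D^* )^+ F], with a pseudo-inverse; it is a
   partial isometry. *)
Lemma gram_contraction_mx n a b (D : 'M[C]_(n, a)) (F : 'M[C]_(n, b)) :
  D *m D^t* = F *m F^t* ->
  exists2 V : 'M[C]_(a, b), D *m V = F &
    exists W : 'M[C]_b, V^t* *m V + W^t* *m W = 1%:M.
Proof.
move=> DF; have [|P [P_herm KPK PKP]] := @psd_pseudo_inverse _ (D *m D^t*).
  apply: eq_psd (gram_psd (fun i r => D i r)) => i j.
  by rewrite !mxE; apply: eq_bigr => r _; rewrite !mxE.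
pose V := D^t* *m (P *m F); pose Q := V^t* *m V.
have QE : Q = F^t* *m (P *m F).
  rewrite /Q /V 2!trmxC_mul trmxCK P_herm -!mulmxA; congr (_ *m _).
  by rewrite [D *m (D^t* *m _)]mulmxA !mulmxA -[P *m D *m _]mulmxA PKP.
have Q_idem : Q *m Q = Q.
  rewrite QE -!mulmxA; congr (_ *m _).
  by rewrite [F *m (F^t* *m _)]mulmxA -DF !mulmxA -[P *m D *m _]mulmxA PKP.
exists V.
  apply/eqP; rewrite -subr_eq0; apply/eqP; apply: mulmx_trmxC_eq0.
  have -> : D *m V - F = (D *m D^t* *m P - 1%:M) *m F.
    by rewrite mulmxBl mul1mx /V !mulmxA.
  by rewrite trmxC_mul mulmxA -[_ *m F *m _]mulmxA -DF mulmxBl mul1mx KPK subrr mul0mx.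
exists (1%:M - Q).
have -> : (1%:M - Q)^t* = 1%:M - Q.
  rewrite -[in RHS](_ : Q^t* = Q); last by rewrite /Q trmxC_mul trmxCK.
  apply/matrixP => i j; rewrite !mxE rmorphB /= eq_sym.
  by rewrite conjC_nat.
by rewrite mulmxBl mul1mx mulmxBr mulmx1 Q_idem subrr subr0 -/Q addrC subrK.
Qed.

Lemma gram_contraction (P A B : finType) (D : P -> A -> C) (F : P -> B -> C) :
  (forall p q, gram D p q = gram F p q) ->
  exists2 V : A -> B -> C, (forall p b, \sum_a D p a * V a b = F p b) &
    forall x : B -> C, \sum_a normsq (\sum_b V a b * x b) <= \sum_b normsq (x b).
Proof.
move=> DF.
pose D' := \matrix_(p < #|P|, a < #|A|) D (enum_val p) (enum_val a).
pose F' := \matrix_(p < #|P|, b < #|B|) F (enum_val p) (enum_val b).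
have [|V DV [W VW]] := @gram_contraction_mx _ _ _ D' F'.
  apply/matrixP => p q; rewrite !mxE; have := DF (enum_val p) (enum_val q).
  rewrite [LHS]big_enum_val [RHS]big_enum_val => DFpq.
  by under eq_bigr do rewrite !mxE; rewrite DFpq; apply: eq_bigr => b _; rewrite !mxE.
exists (fun a b => V (enum_rank a) (enum_rank b)).
  move=> p b; have := congr1 (fun M : 'M_(_,_) => M (enum_rank p) (enum_rank b)) DV.
  rewrite /= !mxE !enum_rankK => <-; rewrite [LHS]big_enum_val.
  by apply: eq_bigr => a _; rewrite !mxE enum_valK enum_rankK.
move=> x; pose x' := \col_(b < #|B|) x (enum_val b).
have normE k (Y : 'M[C]_(k, #|B|)) :
    (x'^t* *m (Y^t* *m Y) *m x') 0 0 = \sum_a normsq ((Y *m x') a 0).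
  rewrite mulmxA -mulmxA -trmxC_mul mxE; apply: eq_bigr => a _.
  by rewrite !mxE mulrC.
have := congr1 (fun M : 'M_(_) => (x'^t* *m M *m x') 0 0) VW.
rewrite /= mulmxDr mulmxDl mxE !normE mulmx1.
have -> : (x'^t* *m x') 0 0 = \sum_b normsq (x b).
  by rewrite mxE [RHS]big_enum_val; apply: eq_bigr => b _; rewrite !mxE mulrC.
have -> : \sum_a normsq ((V *m x') a 0) =
    \sum_a normsq (\sum_b V (enum_rank a) (enum_rank b) * x b).
  rewrite [RHS]big_enum_val; apply: eq_bigr => a _.
  suff -> : (V *m x') a 0 = \sum_b V (enum_rank (enum_val a)) (enum_rank b) * x b by [].
  by rewrite mxE [RHS]big_enum_val; apply: eq_bigr => b _; rewrite !enum_valK mxE.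
by move=> <-; rewrite lerDl; exact: sum_normsq_ge0.
Qed.

End PositiveSemidefinite.

(** * The full Fock space, indexed by words *)

Section Words.
Variable I : finType.
Local Notation W := (seq I).
Implicit Types (N n m : nat) (v w x z : W).

Fixpoint words N : seq W :=
  if N is N'.+1 then [::] :: [seq i :: w | i <- index_enum I, w <- words N']
  else [:: [::]].

Lemma mem_words N w : (w \in words N) = (size w <= N)%N.
Proof.
elim: N w => [|N IHN] [|i w] //=; rewrite in_cons /=.
rewrite ltnS -IHN; apply/allpairsP/idP => [[[j v] [_ v_in [_ ->]]] //|w_in].
by exists (i, w); rewrite mem_index_enum.
Qed.

Fixpoint splits z : seq (W * W) :=
  ([::], z) :: (if z is i :: z' then [seq (i :: p.1, p.2) | p <- splits z'] else [::]).

Section Nmodule.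
Variable V : nmodType.
Implicit Types F : W -> V.

Lemma sum_words_cons N F :
  \sum_(w <- words N.+1) F w = F [::] + \sum_i \sum_(w <- words N) F (i :: w).
Proof. by rewrite /= big_cons big_allpairs_dep. Qed.

Lemma eq_sum_words N F G : (forall w, (size w <= N)%N -> F w = G w) ->
  \sum_(w <- words N) F w = \sum_(w <- words N) G w.
Proof. by move=> FG; apply: eq_big_seq => w; rewrite mem_words; exact: FG. Qed.

Lemma sum_words_rcons N F :
  \sum_(w <- words N.+1) F w = F [::] + \sum_i \sum_(w <- words N) F (rcons w i).
Proof.
elim: N F => [|N IHN] F; rewrite sum_words_cons; congr (_ + _).
  by apply: eq_bigr => i _; rewrite !big_seq1.
under eq_bigr do rewrite IHN.
rewrite big_split exchange_big -big_split; apply: eq_bigr => i _ /=.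
by rewrite sum_words_cons.
Qed.

Lemma sum_words_rev N F : \sum_(w <- words N) F (rev w) = \sum_(w <- words N) F w.
Proof.
elim: N F => [|N IHN] F; first by rewrite /= !big_seq1.
rewrite sum_words_rcons sum_words_cons; congr (_ + _); apply: eq_bigr => i _.
by rewrite -[RHS]IHN; apply: eq_bigr => w _; rewrite rev_rcons.
Qed.

Definition wsupp n F := forall w, (n < size w)%N -> F w = 0.

Lemma sum_words_supp n N F : (n <= N)%N -> wsupp n F ->
  \sum_(w <- words N) F w = \sum_(w <- words n) F w.
Proof.
elim: n N F => [|n IHn] [|N] F // le_nN F_supp; last first.
  rewrite !sum_words_cons; congr (_ + _); apply: eq_bigr => i _.
  by apply: IHn => // w w_long; exact: F_supp.
rewrite sum_words_cons big_seq1 big1 ?addr0 // => i _.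
by rewrite big1 // => w _; exact: F_supp.
Qed.

Lemma sum_words_nil N F :
  (forall w, w != [::] -> F w = 0) -> \sum_(w <- words N) F w = F [::].
Proof.
by move=> F0; rewrite (@sum_words_supp 0) ?big_seq1 // => -[|i w] // _; exact: F0.
Qed.

Lemma sum_splits_cons (F : W * W -> V) i z :
  \sum_(p <- splits (i :: z)) F p =
  F ([::], i :: z) + \sum_(p <- splits z) F (i :: p.1, p.2).
Proof. by rewrite /= big_cons big_map. Qed.

Lemma sum_splits_rcons (F : W * W -> V) z i :
  \sum_(p <- splits (rcons z i)) F p =
  \sum_(p <- splits z) F (p.1, rcons p.2 i) + F (rcons z i, [::]).
Proof.
elim: z F => [|j z IHz] F; first by rewrite sum_splits_cons !big_seq1.
by rewrite rcons_cons !sum_splits_cons IHz addrA.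
Qed.

Lemma sum_splits_rev (F : W * W -> V) z :
  \sum_(p <- splits (rev z)) F p = \sum_(p <- splits z) F (rev p.2, rev p.1).
Proof.
elim: z F => [|i z IHz] F; first by rewrite !big_seq1.
rewrite rev_cons sum_splits_rcons sum_splits_cons IHz addrC rev_cons; congr (_ + _).
by apply: eq_bigr => p _; rewrite rev_cons.
Qed.

Lemma eq_sum_splits (F G : W * W -> V) z :
  (forall v w, v ++ w = z -> F (v, w) = G (v, w)) ->
  \sum_(p <- splits z) F p = \sum_(p <- splits z) G p.
Proof.
elim: z F G => [|i z IHz] F G FG; first by rewrite !big_seq1 FG.
rewrite !sum_splits_cons FG //; congr (_ + _).
by apply: IHz => v w vw; apply: FG; rewrite /= vw.
Qed.

Lemma sum_words_splits_sub N (F : W * W -> V) :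
  \sum_(z <- words N) \sum_(p <- splits z) F p =
  \sum_(v <- words N) \sum_(w <- words (N - size v)) F (v, w).
Proof.
elim: N F => [|N IHN] F; first by rewrite !big_seq1.
rewrite !sum_words_cons big_seq1; under eq_bigr do under eq_bigr do rewrite sum_splits_cons.
under eq_bigr do rewrite big_split /= IHN.
by rewrite big_split addrA.
Qed.

Lemma sum_words_splits N (F : W * W -> V) :
  (forall v w, (N < size v + size w)%N -> F (v, w) = 0) ->
  \sum_(z <- words N) \sum_(p <- splits z) F p =
  \sum_(v <- words N) \sum_(w <- words N) F (v, w).
Proof.
move=> F0; rewrite sum_words_splits_sub; apply: eq_sum_words => v _.
apply/esym/sum_words_supp => [|w w_long]; first exact: leq_subr.
by apply: F0; lia.
Qed.

End Nmodule.

Lemma sum_splits_cat (V : zmodType) (F : W * W -> V) x w :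
  \sum_(p <- splits (x ++ w)) F p =
  \sum_(p <- splits x) F (p.1, p.2 ++ w) + \sum_(p <- splits w) F (x ++ p.1, p.2)
  - F (x, w).
Proof.
elim: x F => [|i x IHx] F.
  by rewrite big_seq1 addrAC subrr add0r; apply: eq_bigr => -[].
by rewrite cat_cons !sum_splits_cons IHx !addrA.
Qed.

Section Numeric.
Variable R : numDomainType.
Implicit Types F : W -> R.

Lemma ler_sum_words N M F : (N <= M)%N -> (forall w, 0 <= F w) ->
  \sum_(w <- words N) F w <= \sum_(w <- words M) F w.
Proof.
elim: N M F => [|N IHN] [|M] F // le_NM F_ge0 //.
  by rewrite sum_words_cons big_seq1 lerDl; do 2![apply: sumr_ge0 => ? _].
by rewrite !sum_words_cons lerD2l; apply: ler_sum => i _; apply: IHN.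
Qed.

Lemma ler_sum_words_splits N (F : W * W -> R) : (forall p, 0 <= F p) ->
  \sum_(z <- words N) \sum_(p <- splits z) F p <=
  \sum_(v <- words N) \sum_(w <- words N) F (v, w).
Proof.
move=> F_ge0; rewrite sum_words_splits_sub; apply: ler_sum => v _.
by apply: ler_sum_words; rewrite ?leq_subr.
Qed.

Lemma sum_splits_prefix_le z m :
  \sum_(p <- splits z) (size p.1 <= m)%:R <= m.+1%:R :> R.
Proof.
elim: z m => [|i z IHz] m; first by rewrite big_seq1 /= ler_nat.
rewrite sum_splits_cons -nat1r /= mulr1n lerD2l; case: m => [|m]; last exact: IHz.
by rewrite big1.
Qed.

End Numeric.
End Words.

Arguments words {I} N.

Section Convolution.
Variables (C : numClosedFieldType) (I : finType).
Local Notation W := (seq I).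
Implicit Types f g h : W -> C.

Definition wconv f g : W -> C := fun z => \sum_(p <- splits z) f p.1 * g p.2.

Definition wsym f := forall v w, perm_eq v w -> f v = f w.

Definition wdelta : W -> C := fun w => (w == [::])%:R.

Lemma wsupp_wconv n m f g : wsupp n f -> wsupp m g -> wsupp (n + m)%N (wconv f g).
Proof.
move=> f_supp g_supp z z_long; transitivity (\sum_(p <- splits z) (0 : C)); last exact: big1_eq.
apply: eq_sum_splits => v w vw /=.
have [v_long|v_short] := ltnP n (size v); first by rewrite f_supp // mul0r.
by rewrite g_supp ?mulr0 //; move: z_long; rewrite -vw size_cat; lia.
Qed.

Lemma wsupp_rev n f : wsupp n f -> wsupp n (fun w => f (rev w)).
Proof. by move=> f_supp w w_long; rewrite f_supp // size_rev. Qed.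

Lemma wconv_cons f g i z :
  wconv f g (i :: z) = f [::] * g (i :: z) + wconv (fun w => f (i :: w)) g z.
Proof. exact: sum_splits_cons. Qed.

Lemma wconv_rev f g z :
  wconv f g (rev z) = wconv (fun w => g (rev w)) (fun w => f (rev w)) z.
Proof.
by rewrite /wconv sum_splits_rev; apply: eq_bigr => p _; rewrite mulrC.
Qed.

Lemma wconv_linearl a f f' g z :
  wconv (fun w => a * f w + f' w) g z = a * wconv f g z + wconv f' g z.
Proof. by rewrite mulr_sumr -big_split; apply: eq_bigr => p _; rewrite /=; ring. Qed.

Lemma wconv_sumr (E : finType) f (g : E -> W -> C) z :
  wconv f (fun w => \sum_e g e w) z = \sum_e wconv f (g e) z.
Proof. by rewrite exchange_big; apply: eq_bigr => p _; rewrite mulr_sumr. Qed.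

Lemma wconv_suml (E : finType) (f : E -> W -> C) g z :
  wconv (fun w => \sum_e f e w) g z = \sum_e wconv (f e) g z.
Proof. by rewrite exchange_big; apply: eq_bigr => p _; rewrite mulr_suml. Qed.

Lemma wconv_deltal g z : wconv wdelta g z = g z.
Proof.
case: z => [|i z]; first by rewrite /wconv big_seq1 mul1r.
by rewrite wconv_cons mul1r /wconv big1 ?addr0 // => p _; rewrite mul0r.
Qed.

Lemma wconv_deltar f z : wconv f wdelta z = f z.
Proof.
elim: z f => [|i z IHz] f; first by rewrite /wconv big_seq1 mulr1.
by rewrite wconv_cons IHz mulr0 add0r.
Qed.

Lemma mulr_sum_splits (g : W -> C) (F : W * W -> C) z :
  g z * \sum_(p <- splits z) F p = \sum_(p <- splits z) g (p.1 ++ p.2) * F p.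
Proof.
by rewrite mulr_sumr; apply: eq_sum_splits => v w /= ->.
Qed.

Lemma CauchySchwarz_sum (T : Type) (r : seq T) (a b : T -> C) :
  normsq (\sum_(t <- r) a t * b t) <=
  (\sum_(t <- r) normsq (a t)) * (\sum_(t <- r) normsq (b t)).
Proof.
pose H (x y : T -> C) := \sum_(t <- r) x t * (y t)^*.
have H_ge0 x : 0 <= H x x by exact: sum_normsq_ge0.
have := @hermitian_form_CauchySchwarz _ _ (fun c x y t => c * x t + y t) H _ _
  a (fun t => (b t)^*) (H_ge0 _) (fun=> H_ge0 _).
have -> : H a (fun t => (b t)^*) = \sum_(t <- r) a t * b t.
  by apply: eq_bigr => t _; rewrite conjCK.
have -> : H (fun t => (b t)^*) (fun t => (b t)^*) = \sum_(t <- r) normsq (b t).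
  by apply: eq_bigr => t _; rewrite conjCK mulrC.
apply=> [c x y z|x y].
  by rewrite mulr_sumr -big_split; apply: eq_bigr => t _; rewrite /=; ring.
by rewrite rmorph_sum; apply: eq_bigr => t _; rewrite rmorphM /= conjCK mulrC.
Qed.

Section TruncatedOperators.
Variable N : nat.

Definition wdot f g : C := \sum_(w <- words N) f w * (g w)^*.

(* The adjoints of the left and of the right multiplication by [f], for the
   words of length at most [N]. *)
Definition ladj f g : W -> C := fun x => \sum_(w <- words N) (f w)^* * g (w ++ x).
Definition radj f g : W -> C := fun x => \sum_(w <- words N) (f w)^* * g (x ++ w).

Lemma wdot_ge0 f : 0 <= wdot f f.
Proof. exact: sum_normsq_ge0. Qed.

Lemma eq_wdot f f' g g' : f =1 f' -> g =1 g' -> wdot f g = wdot f' g'.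
Proof. by move=> ff' gg'; apply: eq_bigr => w _; rewrite ff' gg'. Qed.

Lemma eq_ladj f f' g g' : f =1 f' -> g =1 g' -> ladj f g =1 ladj f' g'.
Proof. by move=> ff' gg' x; apply: eq_bigr => w _; rewrite ff' gg'. Qed.

Lemma wdotC f g : (wdot f g)^* = wdot g f.
Proof.
by rewrite rmorph_sum; apply: eq_bigr => w _; rewrite rmorphM /= conjCK mulrC.
Qed.

Lemma wdot_rev f g : wdot (fun w => f (rev w)) (fun w => g (rev w)) = wdot f g.
Proof. exact: (sum_words_rev N (fun w => f w * (g w)^*)). Qed.

Lemma wdot_linearl a f f' g :
  wdot (fun w => a * f w + f' w) g = a * wdot f g + wdot f' g.
Proof. by rewrite mulr_sumr -big_split; apply: eq_bigr => p _; rewrite /=; ring. Qed.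

Lemma wdot_suml (E : finType) (f : E -> W -> C) g :
  wdot (fun w => \sum_e f e w) g = \sum_e wdot (f e) g.
Proof. by rewrite exchange_big; apply: eq_bigr => w _; rewrite mulr_suml. Qed.

Lemma wdot_sumr (E : finType) f (g : E -> W -> C) :
  wdot f (fun w => \sum_e g e w) = \sum_e wdot f (g e).
Proof.
by rewrite -wdotC wdot_suml rmorph_sum; apply: eq_bigr => e _; rewrite /= wdotC.
Qed.

Lemma wdot_polar_ge0 a f g :
  0 <= wdot f f + a^* * wdot f g + a * wdot g f + normsq a * wdot g g.
Proof.
have := wdot_ge0 (fun w => a * g w + f w).
rewrite wdot_linearl -(wdotC _ g) -(wdotC _ f) !wdot_linearl !rmorphD !rmorphM /= !wdotC.
by congr (0 <= _); ring.
Qed.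

Lemma ladj_linear a f g g' x :
  ladj f (fun w => a * g w + g' w) x = a * ladj f g x + ladj f g' x.
Proof. by rewrite mulr_sumr -big_split; apply: eq_bigr => p _; rewrite /=; ring. Qed.

Lemma radj_linear a f g g' x :
  radj f (fun w => a * g w + g' w) x = a * radj f g x + radj f g' x.
Proof. by rewrite mulr_sumr -big_split; apply: eq_bigr => p _; rewrite /=; ring. Qed.

Lemma ladj_sumr (E : finType) f (g : E -> W -> C) x :
  ladj f (fun w => \sum_e g e w) x = \sum_e ladj f (g e) x.
Proof. by rewrite exchange_big; apply: eq_bigr => w _; rewrite mulr_sumr. Qed.

Lemma ladj_suml (E : finType) (f : E -> W -> C) g x :
  ladj (fun w => \sum_e f e w) g x = \sum_e ladj (f e) g x.
Proof.
by rewrite exchange_big; apply: eq_bigr => w _; rewrite rmorph_sum mulr_suml.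
Qed.

Lemma radj_sumr (E : finType) f (g : E -> W -> C) x :
  radj f (fun w => \sum_e g e w) x = \sum_e radj f (g e) x.
Proof. by rewrite exchange_big; apply: eq_bigr => w _; rewrite mulr_sumr. Qed.

Lemma radj_suml (E : finType) (f : E -> W -> C) g x :
  radj (fun w => \sum_e f e w) g x = \sum_e radj (f e) g x.
Proof.
by rewrite exchange_big; apply: eq_bigr => w _; rewrite rmorph_sum mulr_suml.
Qed.

Lemma ladj_nil f g : ladj f g [::] = wdot g f.
Proof. by apply: eq_bigr => w _; rewrite cats0 mulrC. Qed.

Lemma ladj_radjC f g h x : ladj f (radj g h) x = radj g (ladj f h) x.
Proof.
rewrite /ladj /radj; under eq_bigr do rewrite mulr_sumr.
rewrite exchange_big; apply: eq_bigr => v _; rewrite mulr_sumr; apply: eq_bigr => w _.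
by rewrite catA; ring.
Qed.

Lemma radj_ladj_rev f g x :
  radj f g x = ladj (fun w => f (rev w)) (fun w => g (rev w)) (rev x).
Proof.
rewrite /radj -sum_words_rev; apply: eq_bigr => w _.
by rewrite rev_cat revK.
Qed.

Lemma radj_sym f g : wsym g -> radj f g =1 ladj f g.
Proof.
by move=> g_sym x; apply: eq_bigr => w _; congr (_ * _); apply: g_sym; rewrite perm_catC.
Qed.

Lemma ladjC_sym f g h : wsym h -> ladj f (ladj g h) =1 ladj g (ladj f h).
Proof.
move=> h_sym x; rewrite /ladj; under eq_bigr do rewrite mulr_sumr.
rewrite exchange_big; apply: eq_bigr => v _; rewrite mulr_sumr; apply: eq_bigr => w _.
have -> : h (v ++ w ++ x) = h (w ++ v ++ x) by apply: h_sym; rewrite perm_catCA.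
by ring.
Qed.

Lemma ladj_wsym f g : wsym g -> wsym (ladj f g).
Proof.
move=> g_sym v w vw; apply: eq_bigr => u _.
by congr (_ * _); apply: g_sym; rewrite perm_cat2l.
Qed.

Lemma wsupp_ladj n f g : wsupp n g -> wsupp n (ladj f g).
Proof.
move=> g_supp x x_long; rewrite /ladj big1 // => w _.
by rewrite g_supp ?mulr0 // size_cat; lia.
Qed.

Lemma wdot_wconvl n m f g h : (n + m <= N)%N -> wsupp n f -> wsupp m h ->
  wdot g (wconv f h) = wdot (ladj f g) h.
Proof.
move=> nmN f_supp h_supp.
pose F (p : W * W) := g (p.1 ++ p.2) * (f p.1 * h p.2)^*.
transitivity (\sum_(z <- words N) \sum_(p <- splits z) F p).
  by apply: eq_bigr => z _; rewrite rmorph_sum mulr_sum_splits.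
rewrite sum_words_splits => [|v w vw_long].
  rewrite exchange_big; apply: eq_bigr => w _; rewrite mulr_suml.
  by apply: eq_bigr => v _; rewrite /F rmorphM /=; ring.
rewrite /F /=; have [v_long|v_short] := ltnP n (size v).
  by rewrite f_supp // mul0r conjC0 mulr0.
by rewrite (h_supp w) ?mulr0 ?conjC0 ?mulr0 //; lia.
Qed.

Lemma wdot_wconvr n m f g h : (n + m <= N)%N -> wsupp n h -> wsupp m f ->
  wdot g (wconv h f) = wdot (radj f g) h.
Proof.
move=> nmN h_supp f_supp; rewrite -wdot_rev.
under [RHS]eq_wdot => [w|w] do [rewrite radj_ladj_rev|over].
under eq_wdot => [w|w] do [over|rewrite wconv_rev].
rewrite (@wdot_wconvl m n) ?(addnC m) //; [|exact: wsupp_rev..].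
by rewrite -[RHS]wdot_rev; apply: eq_wdot => w; rewrite ?revK.
Qed.

(* A Leibniz rule: backward shifts act on one of the factors, except on the
   terms that consume exactly the first factor. *)
Lemma ladj_wconv m f g h x : (m <= N)%N -> wsupp m f ->
  ladj f (wconv g h) x =
  ladj (ladj g f) h x + wconv (ladj f g) h x - ladj f g [::] * h x.
Proof.
move=> mN f_supp.
transitivity (\sum_(w <- words N) (f w)^* * (\sum_(p <- splits w) g p.1 * h (p.2 ++ x)
    + \sum_(p <- splits x) g (w ++ p.1) * h p.2 - g w * h x)).
  by apply: eq_bigr => w _; rewrite /wconv sum_splits_cat.
under eq_bigr do rewrite mulrBr mulrDr.
rewrite sumrB big_split /=; congr (_ + _ - _).
- under eq_bigr do rewrite (mulr_sum_splits (fun w => (f w)^*)).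
  rewrite sum_words_splits => [|v w vw_long]; last first.
    by rewrite /= f_supp ?size_cat ?conjC0 ?mul0r //; lia.
  rewrite exchange_big; apply: eq_bigr => w _.
  rewrite rmorph_sum mulr_suml; apply: eq_bigr => v _.
  by rewrite rmorphM /= conjCK; ring.
- under eq_bigr do rewrite mulr_sumr.
  rewrite exchange_big; apply: eq_bigr => p _; rewrite mulr_suml.
  by apply: eq_bigr => w _; rewrite mulrA.
- by rewrite mulr_suml; apply: eq_bigr => w _; rewrite cats0 mulrA.
Qed.

Lemma radj_wconv m f g h x : (m <= N)%N -> wsupp m f ->
  radj f (wconv h g) x =
  wconv h (radj f g) x + radj (radj g f) h x - radj f g [::] * h x.
Proof.
move=> mN f_supp; rewrite radj_ladj_rev.
rewrite (eq_ladj (frefl _) (wconv_rev _ _)) (@ladj_wconv m) //; last exact: wsupp_rev.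
rewrite -[x in wconv h _ x]revK wconv_rev [radj (radj g f) h x]radj_ladj_rev revK.
rewrite [X in X - _]addrC [radj f g [::]]radj_ladj_rev; congr (_ + _ - _).
  by apply: eq_bigr => p _; rewrite radj_ladj_rev revK.
by apply: eq_ladj => // w; rewrite radj_ladj_rev revK.
Qed.

End TruncatedOperators.

Lemma wdot_supp N M n f g : (n <= N)%N -> (n <= M)%N -> wsupp n f ->
  wdot N f g = wdot M f g.
Proof.
move=> nN nM f_supp.
have fg_supp : wsupp n (fun w => f w * (g w)^*) by move=> w /f_supp ->; rewrite mul0r.
by rewrite /wdot (sum_words_supp nN) // (sum_words_supp nM).
Qed.

Lemma ler_wdot N M f : (N <= M)%N -> wdot N f f <= wdot M f f.
Proof. by move=> NM; apply: ler_sum_words => // w; exact: mul_conjC_ge0. Qed.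

Lemma wconv_norm_lel m N f g : wsupp m f ->
  wdot N (wconv f g) (wconv f g) <= m.+1%:R * wdot m f f * wdot N g g.
Proof.
move=> f_supp.
pose short (p : W * W) : C := (size p.1 <= m)%:R.
have wconvE z : wconv f g z = \sum_(p <- splits z) short p * (f p.1 * g p.2).
  apply: eq_bigr => p _; rewrite /short; case: leqP => p_long; first by rewrite mul1r.
  by rewrite f_supp ?mul0r.
have short_sum z : \sum_(p <- splits z) normsq (short p) <= m.+1%:R.
  rewrite (eq_bigr short) ?sum_splits_prefix_le // => p _.
  by rewrite conjC_nat -natrM mulnb andbb.
apply: (@le_trans _ _ (\sum_(z <- words N) m.+1%:R *
    \sum_(p <- splits z) normsq (f p.1) * normsq (g p.2))).
  apply: ler_sum => z _; rewrite wconvE; apply: le_trans (CauchySchwarz_sum _ _ _) _.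
  have -> : \sum_(p <- splits z) normsq (f p.1 * g p.2) =
      \sum_(p <- splits z) normsq (f p.1) * normsq (g p.2).
    by apply: eq_bigr => p _; rewrite rmorphM /=; ring.
  by rewrite ler_wpM2r // sumr_ge0 // => p _; rewrite mulr_ge0 ?mul_conjC_ge0.
rewrite -mulr_sumr -mulrA ler_wpM2l ?ler0n //.
apply: le_trans (ler_sum_words_splits N (F := fun p => normsq (f p.1) * normsq (g p.2)) _) _.
  by move=> p; rewrite mulr_ge0 ?mul_conjC_ge0.
under eq_bigr do rewrite /= -mulr_sumr.
rewrite -mulr_suml ler_wpM2r ?wdot_ge0 //.
rewrite -(@wdot_supp (N + m)%N m m) ?leq_addl //; apply: ler_wdot.
exact: leq_addr.
Qed.

Lemma wconv_norm_ler m N f g : wsupp m f ->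
  wdot N (wconv g f) (wconv g f) <= m.+1%:R * wdot m f f * wdot N g g.
Proof.
move=> f_supp; rewrite -wdot_rev -(wdot_rev m f) -(wdot_rev N g).
rewrite (eq_wdot N (wconv_rev _ _) (wconv_rev _ _)).
exact/wconv_norm_lel/wsupp_rev.
Qed.

End Convolution.

Section FockColumnRow.
Variables (C : numClosedFieldType) (I E : finType).
Local Notation W := (seq I).
Implicit Types a b : E -> W -> C.

Definition ladjs N a b : W -> C := fun x => \sum_e ladj N (a e) (b e) x.

Lemma wsupp_ladjs N n a b : (forall e, wsupp n (b e)) -> wsupp n (ladjs N a b).
Proof.
move=> b_supp x x_long; rewrite /ladjs big1 // => e _.
exact: wsupp_ladj x_long.
Qed.

Variables (f : E -> W -> C) (m : nat).
Hypothesis f_supp : forall e, wsupp m (f e).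
Hypothesis f_sym : forall e, wsym (f e).

Section Truncation.
Variable N : nat.
Hypothesis mN : (m <= N)%N.

Local Notation wdot := (wdot N).
Local Notation ladj := (ladj N).
Local Notation radj := (radj N).
Local Notation ladjs := (ladjs N).
Let mu := ladjs f f.

(* The sum of [R_e^* R_e], where [R_e] is the right multiplication by [f e]. *)
Definition right_gram (phi : W -> C) : W -> C :=
  fun x => \sum_e radj (f e) (wconv phi (f e)) x.

Let muE x : \sum_e radj (f e) (f e) x = mu x.
Proof. by apply: eq_bigr => e _; rewrite radj_sym. Qed.

Lemma right_gramE phi x :
  right_gram phi x = wconv phi mu x + radj mu phi x - mu [::] * phi x.
Proof.
have -> : right_gram phi x = \sum_e (wconv phi (radj (f e) (f e)) x +
    radj (radj (f e) (f e)) phi x - radj (f e) (f e) [::] * phi x).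
  by apply: eq_bigr => e _; rewrite (radj_wconv _ _ _ mN).
rewrite sumrB big_split /= -mulr_suml muE -wconv_sumr -radj_suml.
by rewrite (funext muE).
Qed.

Lemma right_gram_linear c phi psi x :
  right_gram (fun w => c * phi w + psi w) x = c * right_gram phi x + right_gram psi x.
Proof. by rewrite !right_gramE wconv_linearl radj_linear; ring. Qed.

Lemma right_gram_sum (phi : E -> W -> C) x :
  right_gram (fun w => \sum_e phi e w) x = \sum_e right_gram (phi e) x.
Proof.
rewrite right_gramE wconv_suml radj_sumr mulr_sumr -big_split -sumrB /=.
by apply: eq_bigr => e _; rewrite right_gramE.
Qed.

Lemma right_gram_delta x : right_gram (@wdelta C I) x = mu x.
Proof.
rewrite right_gramE wconv_deltal /radj sum_words_nil => [|w w_neq].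
  rewrite cats0 /mu /ladjs rmorph_sum mulr_suml -addrA -mulr_suml -rmorph_sum /=.
  suff -> : (ladjs f f [::])^* = ladjs f f [::] by rewrite subrr addr0.
  by rewrite rmorph_sum; apply: eq_bigr => e _; rewrite !ladj_nil /= wdotC.
by rewrite /wdelta -size_eq0 size_cat addn_eq0 !size_eq0 (negPf w_neq) andbF mulr0.
Qed.

Lemma ladj_right_gram e phi x : ladj (f e) (right_gram phi) x =
  right_gram (ladj (f e) phi) x + ladj (ladj phi (f e)) mu x - ladj (f e) phi [::] * mu x.
Proof.
have -> : ladj (f e) (right_gram phi) x = ladj (f e) (wconv phi mu) x +
    ladj (f e) (radj mu phi) x - mu [::] * ladj (f e) phi x.
  rewrite (_ : right_gram phi = fun w => - mu [::] * phi w + (1 * wconv phi mu w + radj mu phi w)).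
    by rewrite !ladj_linear; ring.
  by apply: funext => w; rewrite right_gramE; ring.
rewrite (ladj_wconv _ _ _ mN) // ladj_radjC right_gramE; ring.
Qed.

(* The gradient in [phi] of the form [defect k] below. *)
Definition defect_grad k phi e : W -> C :=
  fun x => right_gram (phi e) x + k * phi e x - ladj (ladjs phi f) (f e) x.

Definition reduced_ladjs phi : W -> C :=
  fun x => ladjs f phi x - ladjs f phi [::] * wdelta C x.

Lemma reduced_ladjs_nil phi : reduced_ladjs phi [::] = 0.
Proof. by rewrite /reduced_ladjs /wdelta eqxx mulr1 subrr. Qed.

Lemma reduced_ladjs_neq phi w : w != [::] -> reduced_ladjs phi w = ladjs f phi w.
Proof. by move=> /negPf w_neq; rewrite /reduced_ladjs /wdelta w_neq mulr0 subr0. Qed.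

Lemma wsupp_reduced_ladjs n phi : (forall e, wsupp n (phi e)) ->
  wsupp n (reduced_ladjs phi).
Proof.
move=> phi_supp x x_long; rewrite /reduced_ladjs (wsupp_ladjs N f phi_supp) //.
by case: x x_long => // i x _; rewrite /wdelta mulr0 subrr.
Qed.

Lemma ladjs_defect_grad k phi x : ladjs f (defect_grad k phi) x =
  right_gram (reduced_ladjs phi) x + k * ladjs f phi x.
Proof.
have rightE : right_gram (reduced_ladjs phi) x =
    \sum_e right_gram (ladj (f e) (phi e)) x - ladjs f phi [::] * mu x.
  rewrite -right_gram_sum -right_gram_delta.
  rewrite (_ : reduced_ladjs phi = fun w => - ladjs f phi [::] * wdelta C w + ladjs f phi w).
    by rewrite right_gram_linear; ring.
  by apply: funext => w; rewrite /reduced_ladjs; ring.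
have -> : ladjs f (defect_grad k phi) x = \sum_e (ladj (f e) (right_gram (phi e)) x +
    k * ladj (f e) (phi e) x - ladj (f e) (ladj (ladjs phi f) (f e)) x).
  apply: eq_bigr => e _.
  rewrite (_ : defect_grad k phi e = fun w => k * phi e w +
    (- 1 * ladj (ladjs phi f) (f e) w + right_gram (phi e) w)).
    by rewrite !ladj_linear; ring.
  by apply: funext => w; rewrite /defect_grad; ring.
under eq_bigr do rewrite ladj_right_gram ladjC_sym //.
rewrite sumrB big_split /= -ladj_sumr -mulr_sumr sumrB big_split /= -mulr_suml -ladj_suml.
by rewrite rightE -/(ladjs phi f) -/mu -/(ladjs f phi [::]) -/(ladjs f phi x); ring.
Qed.

Definition defect k phi psi : C :=
  \sum_e (\sum_e' wdot (wconv (phi e) (f e')) (wconv (psi e) (f e')) + k * wdot (phi e) (psi e))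
  - wdot (ladjs psi f) (ladjs phi f).

Lemma wdot_right_gram n phi psi : (n + m <= N)%N -> wsupp n psi ->
  \sum_e wdot (wconv phi (f e)) (wconv psi (f e)) = wdot (right_gram phi) psi.
Proof.
move=> nmN psi_supp; rewrite wdot_suml; apply: eq_bigr => e _.
by rewrite (wdot_wconvr _ nmN).
Qed.

Lemma wdot_ladjC n (g h psi : W -> C) : (n + m <= N)%N -> wsupp m g -> wsym g ->
  wsupp m h -> wsupp n psi -> wdot (ladj psi g) h = wdot (ladj h g) psi.
Proof.
move=> nmN g_supp g_sym h_supp psi_supp.
rewrite -(wdot_wconvl _ nmN) // -(eq_wdot _ (radj_sym _ _ g_sym) (frefl _)).
by rewrite -(wdot_wconvr _ nmN).
Qed.

Lemma defect_gradE k n phi psi : (n + m <= N)%N -> (forall e, wsupp n (psi e)) ->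
  defect k phi psi = \sum_e wdot (defect_grad k phi e) (psi e).
Proof.
move=> nmN psi_supp; rewrite /defect wdot_suml -sumrB; apply: eq_bigr => e _.
rewrite (wdot_ladjC nmN) //; last exact: wsupp_ladjs.
rewrite (wdot_right_gram _ nmN) //.
rewrite (_ : defect_grad k phi e = fun w => k * phi e w +
    (- 1 * ladj (ladjs phi f) (f e) w + right_gram (phi e) w)).
  by rewrite !wdot_linearl; ring.
by apply: funext => w; rewrite /defect_grad; ring.
Qed.

Lemma defect_reduced_ladjs k n phi : (n + m + m <= N)%N -> (forall e, wsupp n (phi e)) ->
  let A := reduced_ladjs phi in
  defect k phi (fun e => wconv (f e) A) =
  \sum_e wdot (wconv A (f e)) (wconv A (f e)) + k * wdot A A.
Proof.
move=> nmN phi_supp A; have A_supp : wsupp n A := wsupp_reduced_ladjs phi_supp.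
rewrite (@defect_gradE k (m + n)%N) => [||e]; [|lia|exact: wsupp_wconv].
transitivity (wdot (ladjs f (defect_grad k phi)) A).
  by rewrite wdot_suml; apply: eq_bigr => e _; rewrite (@wdot_wconvl _ _ _ m n) //; lia.
rewrite (@wdot_right_gram n) //; last by lia.
rewrite -[RHS]addrC -wdot_linearl /wdot; apply: eq_bigr => w _.
rewrite ladjs_defect_grad -/A; have [->|w_neq] := eqVneq w [::].
  by rewrite /A reduced_ladjs_nil conjC0 !mulr0.
by rewrite -(reduced_ladjs_neq phi w_neq) -/A; ring.
Qed.

Lemma defect_linear k c phi phi' psi :
  defect k (fun e w => c * phi e w + phi' e w) psi = c * defect k phi psi + defect k phi' psi.
Proof.
rewrite /defect; set y := wdot (ladjs psi f) _.
have -> : y = c * wdot (ladjs psi f) (ladjs phi f) + wdot (ladjs psi f) (ladjs phi' f).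
  have yC chi : wdot (ladjs psi f) (ladjs chi f) = (wdot (ladjs chi f) (ladjs psi f))^*.
    by rewrite wdotC.
  rewrite /y !yC -[c]conjCK -rmorphM -rmorphD /= -wdot_linearl; congr (_^*).
  apply: eq_wdot => // x; rewrite mulr_sumr -big_split; apply: eq_bigr => e _ /=.
  rewrite mulr_sumr -big_split; apply: eq_bigr => w _ /=.
  by rewrite rmorphD !rmorphM /= !conjCK; ring.
rewrite mulrBr addrACA -opprD; congr (_ - _).
rewrite mulr_sumr -big_split; apply: eq_bigr => e _ /=; rewrite wdot_linearl.
rewrite (eq_bigr (fun e' => c * wdot (wconv (phi e) (f e')) (wconv (psi e) (f e')) +
    wdot (wconv (phi' e) (f e')) (wconv (psi e) (f e')))).
  by rewrite big_split /= -mulr_sumr; ring.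
move=> e' _; rewrite -wdot_linearl; apply: eq_wdot => // x.
exact: wconv_linearl.
Qed.

Lemma defectC k phi psi : k^* = k -> defect k psi phi = (defect k phi psi)^*.
Proof.
move=> k_real; rewrite rmorphB /= wdotC rmorph_sum; congr (_ - _).
apply: eq_bigr => e _; rewrite rmorphD rmorphM /= k_real wdotC rmorph_sum.
by congr (_ + _); apply: eq_bigr => e' _; rewrite /= wdotC.
Qed.

Lemma sum_wdot_wconv_rev n phi : (n + m <= N)%N -> (forall e, wsupp n (phi e)) ->
  let A := ladjs f phi in let y := ladjs phi f in
  \sum_e \sum_e' wdot (wconv (phi e) (f e')) (wconv (f e) (fun w => phi e' (rev w))) =
  wdot y y + wdot A (fun x => A (rev x)) - normsq (A [::]).
Proof.
move=> nmN phi_supp A y.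
have phi_rev_supp e := wsupp_rev (phi_supp e).
have A_supp : wsupp n A by exact: wsupp_ladjs.
have f_rev e w : f e (rev w) = f e w by apply: f_sym; rewrite perm_rev.
transitivity (\sum_e' wdot (fun x => - A [::] * f e' x + (1 * ladj y (f e') x + wconv A (f e') x))
    (fun w => phi e' (rev w))).
  rewrite exchange_big; apply: eq_bigr => e' _.
  under eq_bigr do rewrite (@wdot_wconvl _ _ _ m n) ?(addnC m) //.
  rewrite -wdot_suml; apply: eq_wdot => // x.
  under eq_bigr do rewrite (ladj_wconv _ _ _ mN) //.
  rewrite sumrB big_split /= -ladj_suml -wconv_suml -mulr_suml.
  by rewrite -/(ladjs phi f) -/(ladjs f phi) -/y -/A -/(ladjs f phi [::]) -/(A [::]); ring.
under eq_bigr do rewrite !wdot_linearl mul1r.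
rewrite !big_split /= -mulr_sumr addrC mulNr; congr (_ + _ - _ * _).
- rewrite [RHS]wdot_suml; apply: eq_bigr => e _.
  rewrite [RHS](wdot_ladjC nmN) //; last exact: wsupp_ladjs.
  rewrite -[RHS]wdot_rev; apply: eq_wdot => // x.
  by apply: ladj_wsym; rewrite // perm_sym perm_rev.
- rewrite wdot_sumr; apply: eq_bigr => e _.
  rewrite -wdotC (wdot_wconvr _ nmN) // -[RHS]wdotC; congr (_^*).
  apply: eq_wdot => // x; rewrite radj_ladj_rev.
  by apply: eq_ladj => w; rewrite ?revK.
- rewrite /A /ladjs rmorph_sum; apply: eq_bigr => e _; rewrite /= ladj_nil wdotC.
  by rewrite -wdot_rev; apply: eq_wdot => w; rewrite ?revK.
Qed.

Lemma wdot_ladjs_le n phi : (n + m <= N)%N -> (forall e, wsupp n (phi e)) ->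
  wdot (ladjs phi f) (ladjs phi f) <=
  \sum_e \sum_e' wdot (wconv (phi e) (f e')) (wconv (phi e) (f e'))
  + wdot (reduced_ladjs phi) (reduced_ladjs phi).
Proof.
move=> nmN phi_supp; set y := ladjs phi f; set A := reduced_ladjs phi.
set S := \sum_e _.
pose A_rev x := A (rev x).
have := sum_wdot_wconv_rev nmN phi_supp; rewrite /= -/y; set Q := \sum_e _ => QE.
have {}QE : Q = wdot y y + wdot A A_rev.
  rewrite QE -addrA; congr (_ + _); apply/eqP; rewrite subr_eq addrC -subr_eq; apply/eqP.
  rewrite /wdot -sumrB sum_words_nil => [|w w_neq].
    by rewrite /A_rev /A reduced_ladjs_nil mul0r subr0.
  by rewrite /A_rev /A !reduced_ladjs_neq ?subrr // -size_eq0 size_rev size_eq0.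
have Q_le : Q + Q^* <= S + S.
  rewrite {2}/S exchange_big /Q /S rmorph_sum -!big_split; apply: ler_sum => e _ /=.
  rewrite rmorph_sum -!big_split; apply: ler_sum => e' _ /=.
  set p := wconv (phi e) (f e'); set q := wconv (f e) _.
  have -> : wdot (wconv (phi e') (f e)) (wconv (phi e') (f e)) = wdot q q.
    rewrite -wdot_rev; have conv_rev z : wconv (phi e') (f e) (rev z) = q z.
      rewrite wconv_rev; apply: eq_bigr => t _; congr (_ * _).
      by apply: f_sym; rewrite perm_rev.
    exact: eq_wdot.
  have := wdot_polar_ge0 N (-1) p q; rewrite rmorphN /= conjC1 -(wdotC N p q).
  by rewrite -subr_ge0; congr (0 <= _); ring.
have A_norm : wdot A_rev A_rev = wdot A A by exact: wdot_rev.
have := wdot_polar_ge0 N 1 A A_rev; rewrite A_norm conjC1 !mul1r => polar.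
rewrite -(ler_pM2l (ltr0n _ 2)) -subr_ge0; rewrite -subr_ge0 in Q_le.
have := addr_ge0 Q_le polar; rewrite QE rmorphD /= !wdotC.
by congr (0 <= _); ring.
Qed.

End Truncation.

Definition right_mult_bound : C := \sum_e m.+1%:R * wdot m (f e) (f e).
Local Notation rho := right_mult_bound.

Lemma right_mult_bound_ge0 : 0 <= rho.
Proof. by apply: sumr_ge0 => e _; rewrite mulr_ge0 ?ler0n ?wdot_ge0. Qed.

Lemma sum_wconv_norm_lel N g :
  \sum_e wdot N (wconv (f e) g) (wconv (f e) g) <= rho * wdot N g g.
Proof. by rewrite mulr_suml; apply: ler_sum => e _; exact: wconv_norm_lel. Qed.

Lemma sum_wconv_norm_ler N g :
  \sum_e wdot N (wconv g (f e)) (wconv g (f e)) <= rho * wdot N g g.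
Proof. by rewrite mulr_suml; apply: ler_sum => e _; exact: wconv_norm_ler. Qed.

Lemma defect_wconv_le N (k : C) g : 0 <= k ->
  defect N k (fun e => wconv (f e) g) (fun e => wconv (f e) g) <=
  (rho + k) * rho * wdot N g g.
Proof.
set psi := fun e : E => _ => k_ge0.
apply: (@le_trans _ _ (\sum_e (rho + k) * wdot N (psi e) (psi e))).
  rewrite /defect lerBlDr ler_wpDr ?wdot_ge0 //; apply: ler_sum => e _.
  by rewrite mulrDl lerD2r sum_wconv_norm_ler.
rewrite -mulr_sumr -mulrA ler_wpM2l ?sum_wconv_norm_lel //.
by rewrite addr_ge0 ?right_mult_bound_ge0.
Qed.

Lemma reduced_ladjs_norm_le N n phi : (n + m <= N)%N -> (forall e, wsupp n (phi e)) ->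
  wdot N (reduced_ladjs N phi) (reduced_ladjs N phi) <=
  (rho + 1) * \sum_e wdot N (phi e) (phi e).
Proof.
move=> nmN phi_supp; set A := reduced_ladjs N phi; set S := \sum_e _; pose psi e := wconv (f e) A.
have A_supp : wsupp n A := wsupp_reduced_ladjs N phi_supp.
have A_norm : \sum_e wdot N (phi e) (psi e) = wdot N A A.
  under eq_bigr do rewrite (@wdot_wconvl _ _ _ m n) ?(addnC m) //.
  rewrite -wdot_suml /wdot; apply: eq_bigr => w _.
  have [->|w_neq] := eqVneq w [::]; first by rewrite /A reduced_ladjs_nil conjC0 !mulr0.
  by rewrite {2}/A reduced_ladjs_neq.
have rho1_gt0 : 0 < rho + 1 by rewrite ltr_wpDl ?right_mult_bound_ge0.
have rho1_real : (rho + 1)^* = rho + 1 by rewrite geC0_conj ?ltW.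
have polar : 0 <= \sum_e (wdot N (psi e) (psi e) - (rho + 1) * (wdot N (phi e) (psi e))^* -
    (rho + 1) * wdot N (phi e) (psi e) + (rho + 1) * (rho + 1) * wdot N (phi e) (phi e)).
  apply: sumr_ge0 => e _; have := wdot_polar_ge0 N (- (rho + 1)) (psi e) (phi e).
  by congr (0 <= _); rewrite rmorphN /= rho1_real wdotC; ring.
move: polar; rewrite big_split !sumrB /= -!mulr_sumr -rmorph_sum /= A_norm wdotC -/S.
have := sum_wconv_norm_lel N A; rewrite -(ler_pM2l rho1_gt0).
set T := \sum_e _ => T_le polar; rewrite -subr_ge0.
have AA_ge0 := wdot_ge0 N A; rewrite -subr_ge0 in T_le.
have : 0 <= (rho * wdot N A A - T) + wdot N A A + (T - (rho + 1) * wdot N A A -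
  (rho + 1) * wdot N A A + (rho + 1) * (rho + 1) * S).
  by apply: addr_ge0 => //; apply: addr_ge0 => //; rewrite subr_ge0 sum_wconv_norm_lel.
have -> : rho * wdot N A A - T + wdot N A A + (T - (rho + 1) * wdot N A A -
    (rho + 1) * wdot N A A + (rho + 1) * (rho + 1) * S) =
  (rho + 1) * ((rho + 1) * S - wdot N A A) by ring.
by rewrite pmulr_rge0.
Qed.

Lemma defect_ge N n (k : C) phi : (n + m <= N)%N -> (forall e, wsupp n (phi e)) ->
  k * \sum_e wdot N (phi e) (phi e) - wdot N (reduced_ladjs N phi) (reduced_ladjs N phi)
  <= defect N k phi phi.
Proof.
move=> nmN phi_supp; have := wdot_ladjs_le (leq_trans (leq_addl n m) nmN) nmN phi_supp.
rewrite -subr_ge0 => ladjs_le; rewrite -subr_ge0; move: ladjs_le; congr (0 <= _).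
by rewrite /defect big_split /= mulr_sumr; ring.
Qed.

(* By the Cauchy-Schwarz inequality against [psi e = f e * A] the norm of
   [A] is controlled by the defect. *)
Lemma defect_coercive (k : C) N n phi : 0 < k -> (n + m + m <= N)%N ->
  (forall e, wsupp n (phi e)) ->
  (forall psi, (forall e, wsupp (n + m) (psi e)) -> 0 <= defect N k psi psi) ->
  k * k * (k * \sum_e wdot N (phi e) (phi e)) <=
  (k * k + (rho + k) * rho) * defect N k phi phi.
Proof.
move=> k_gt0 nmN phi_supp defect_ge0.
have [mN nN] : (m <= N)%N /\ (n + m <= N)%N by lia.
have k_real : k^* = k by rewrite geC0_conj ?ltW.
set A := reduced_ladjs N phi; set D := defect N k phi phi; set c := (rho + k) * rho.
have A_supp : wsupp n A := wsupp_reduced_ladjs N phi_supp.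
pose psi e := wconv (f e) A.
have phi_supp' e : wsupp (n + m) (phi e) by move=> w w_long; apply: phi_supp; lia.
have psi_supp e : wsupp (n + m) (psi e) by rewrite addnC; exact: wsupp_wconv.
have D_ge0 : 0 <= D by exact: defect_ge0.
have kA_ge0 : 0 <= k * wdot N A A by rewrite mulr_ge0 ?wdot_ge0 // ltW.
have kA_le : k * wdot N A A <= defect N k phi psi.
  rewrite (defect_reduced_ladjs mN k nmN) // -/A lerDr.
  by apply: sumr_ge0 => e _; exact: wdot_ge0.
have kkA_le : k * k * wdot N A A <= c * D.
  have [->|A_neq0] := eqVneq (wdot N A A) 0.
    by rewrite mulr0 !mulr_ge0 // ?addr_ge0 ?right_mult_bound_ge0 // ltW.
  have A_gt0 : 0 < wdot N A A by rewrite lt0r A_neq0 wdot_ge0.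
  rewrite -(ler_pM2r A_gt0); apply: (@le_trans _ _ (normsq (defect N k phi psi))).
    rewrite (geC0_conj (le_trans kA_ge0 kA_le)).
    have -> : k * k * wdot N A A * wdot N A A = (k * wdot N A A) * (k * wdot N A A) by ring.
    exact: ler_pM.
  apply: (@le_trans _ _ (D * defect N k psi psi)).
    apply: (hermitian_form_CauchySchwarz (defect_linear N k)
      (fun _ _ => defectC N _ _ k_real)) => //.
    move=> t; apply: defect_ge0 => e w w_long.
    by rewrite psi_supp // phi_supp' // mulr0 addr0.
  rewrite [c * D]mulrC -mulrA; apply: ler_wpM2l => //.
  by apply: defect_wconv_le; exact: ltW.
rewrite mulrDl; apply: le_trans (lerD (lexx _) kkA_le); rewrite -lerBlDr -mulrBr.
apply: ler_wpM2l; first by rewrite mulr_ge0 // ltW.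
exact: (defect_ge k nN phi_supp).
Qed.

Lemma defect_shift N k d phi : defect N (k + d) phi phi =
  defect N k phi phi + d * \sum_e wdot N (phi e) (phi e).
Proof. by rewrite /defect !big_split /= -!mulr_sumr mulrDl; ring. Qed.

Lemma defect_stable k n N M phi : (n + m <= N)%N -> (n + m <= M)%N ->
  (forall e, wsupp n (phi e)) -> defect N k phi phi = defect M k phi phi.
Proof.
move=> nmN nmM phi_supp; rewrite /defect; congr (_ - _).
  apply: eq_bigr => e _; congr (_ + _ * _); last by apply: (@wdot_supp _ _ N M n) => //; lia.
  apply: eq_bigr => e' _; apply: (@wdot_supp _ _ N M (n + m)%N) => //.
  exact: wsupp_wconv.
rewrite (@wdot_supp _ _ N M m); [|lia|lia|exact: wsupp_ladjs].
have ladjs_stable x : ladjs N phi f x = ladjs M phi f x.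
  apply: eq_bigr => e _; have phif_supp : wsupp n (fun w => (phi e w)^* * f e (w ++ x)).
    by move=> w w_long; rewrite phi_supp // conjC0 mul0r.
  by rewrite /ladj (@sum_words_supp _ _ n N) ?(@sum_words_supp _ _ n M) //; lia.
exact: eq_wdot.
Qed.

End FockColumnRow.

Lemma ltr0c (R : rcfType) (k : R) : (0 < k%:C) = (0 < k).
Proof. exact: (ltcR 0 k). Qed.

Lemma ler_addMgt0 (F : numFieldType) (x y b : F) :
  0 <= b -> (forall d, 0 < d -> x <= y + d * b) -> x <= y.
Proof.
move=> b_ge0 le_xy; apply/ler_addgt0Pr => e e_gt0.
have b1_gt0 : 0 < b + 1 by rewrite ltr_wpDl.
apply: le_trans (le_xy (e / (b + 1)) _) _; first by rewrite divr_gt0.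
by rewrite lerD2l mulrAC ler_pdivrMr // ler_wpM2l ?lerDl // ltW.
Qed.

Lemma exists_small_increment (R : archiRealFieldType) (a : nat -> R) (b e : R) :
  (forall n, 0 <= a n <= b) -> 0 < e -> exists n, a n.+1 - a n <= e.
Proof.
move=> a_bounded e_gt0; apply: contrapT => /forallNP big_increment.
have a_ge n : n%:R * e <= a n.
  elim: n => [|n IHn]; first by rewrite mul0r; case/andP: (a_bounded 0).
  by have /negP := big_increment n; rewrite -ltNge -natr1; lra.
have /andP[a0_ge0 a0_le] := a_bounded 0.
have := archi_boundP (divr_ge0 (le_trans a0_ge0 a0_le) (ltW e_gt0)).
set n := Num.bound _; rewrite ltr_pdivrMr // ltNge.
by have /andP[_ an_le] := a_bounded n; rewrite (le_trans (a_ge n)).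
Qed.

Section FockInequality.
Variables (R : realType) (I E : finType).
Local Notation C := R[i].
Local Notation W := (seq I).
Variables (f : E -> W -> C) (m : nat).
Hypothesis f_supp : forall e, wsupp m (f e).
Hypothesis f_sym : forall e, wsym (f e).

Let sqnorm_ge0 N (phi : E -> W -> C) : 0 <= \sum_e wdot N (phi e) (phi e).
Proof. by apply: sumr_ge0 => e _; exact: wdot_ge0. Qed.

Definition defect_nonneg (k : R) := forall N n phi, (n + m <= N)%N ->
  (forall e, wsupp n (phi e)) -> 0 <= defect f N k%:C phi phi.

Lemma defect_nonneg_le k k' : k <= k' -> defect_nonneg k -> defect_nonneg k'.
Proof.
move=> le_kk' k_ok N n phi nmN phi_supp.
have -> : k'%:C = k%:C + (k' - k)%:C by rewrite -rmorphD /= addrC subrK.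
rewrite defect_shift addr_ge0 ?(k_ok N n) // mulr_ge0 //.
by rewrite ler0c subr_ge0.
Qed.

Lemma defect_nonneg_lim k :
  (forall d, 0 < d -> defect_nonneg (k + d)) -> defect_nonneg k.
Proof.
move=> kd_ok N n phi nmN phi_supp; apply: ler_addMgt0 (sqnorm_ge0 N phi) _ => d d_gt0.
have dE : d = (complex.Re d)%:C by rewrite RRe_real // gtr0_real.
by rewrite dE -defect_shift -rmorphD; apply: (kd_ok _ _ N n); rewrite // -ltr0c -dE.
Qed.

Local Notation rho := (complex.Re (right_mult_bound f m)).

Let rhoE : right_mult_bound f m = rho%:C.
Proof. by rewrite RRe_real // ger0_real // right_mult_bound_ge0. Qed.

Let rho_ge0 : 0 <= rho.
Proof. by rewrite -ler0c -rhoE right_mult_bound_ge0. Qed.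

Lemma defect_nonneg_large : defect_nonneg (rho + 1).
Proof.
move=> N n phi nmN phi_supp; apply: le_trans (defect_ge f_supp f_sym _ nmN phi_supp).
rewrite rmorphD rmorph1 /= -rhoE subr_ge0.
exact: (reduced_ladjs_norm_le f_supp nmN).
Qed.

Lemma defect_nonneg_lt k : 0 < k -> defect_nonneg k ->
  exists2 k', 0 < k' < k & defect_nonneg k'.
Proof.
move=> k_gt0 k_ok; pose b := k * k + (rho + k) * rho; pose e := k * k * k / b.
have b_gt0 : 0 < b by rewrite ltr_wpDr ?mulr_gt0 // mulr_ge0 // addr_ge0 // ltW.
have e_gt0 : 0 < e by rewrite divr_gt0 ?mulr_gt0.
have e_le : e <= k.
  rewrite ler_pdivrMr // [k * b]mulrC ler_pM2r // lerDl.
  by rewrite mulr_ge0 // addr_ge0 // ltW.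
exists (k - e / 2); first by apply/andP; split; lra.
move=> N n phi nmN phi_supp; set M := (n + m + m)%N.
rewrite (defect_stable f_supp _ nmN (_ : (n + m <= M)%N) phi_supp) ?leq_addr //.
have kC_gt0 : 0 < k%:C by rewrite ltr0c.
have := defect_coercive f_supp f_sym kC_gt0 (leqnn M) phi_supp
  (fun psi psi_supp => k_ok M _ psi (leqnn M) psi_supp).
rewrite rmorphB rmorphM fmorphV rmorph_nat /= -mulNr defect_shift.
set S := \sum_e _; set D := defect _ _ _ _ _.
have -> : k%:C * k%:C + (right_mult_bound f m + k%:C) * right_mult_bound f m = b%:C.
  by rewrite rhoE !(rmorphD, rmorphM).
rewrite mulrA => coercive.
have bC_gt0 : 0 < b%:C by rewrite ltr0c.
have S_ge0 : 0 <= S by exact: sqnorm_ge0.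
have eS_le : e%:C * S <= D.
  by rewrite !rmorphM fmorphV /= mulrAC ler_pdivrMr // [D * _]mulrC.
rewrite !mulNr subr_ge0; apply: le_trans eS_le; apply: ler_wpM2r => //.
by rewrite ler_pdivrMr ?ltr0n // ler_peMr ?ler1n // ler0c ltW.
Qed.

(* If some [k > 0] is admissible then so is a smaller one, hence the infimum
   of the admissible [k] is [0]. *)
Lemma defect_nonneg0 : defect_nonneg 0.
Proof.
pose S := [set k : R | 0 < k /\ defect_nonneg k]%classic.
have S_neq0 : nonempty S.
  by exists (rho + 1); split; [rewrite ltr_wpDl|exact: defect_nonneg_large].
have S_lb : has_lbound S by exists 0 => k [k_gt0 _]; exact: ltW.
have inf_ge0 : 0 <= inf S by apply: lb_le_inf => // k [k_gt0 _]; exact: ltW.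
have inf_ok : defect_nonneg (inf S).
  apply: defect_nonneg_lim => d d_gt0.
  have [k [_ k_ok] k_lt] := inf_adherent d_gt0 (conj S_neq0 S_lb).
  exact: defect_nonneg_le (ltW k_lt) k_ok.
have [<-//|inf_neq0] := eqVneq (inf S) 0.
have inf_gt0 : 0 < inf S by rewrite lt0r inf_neq0.
have [k /andP[k_gt0 k_lt] k_ok] := defect_nonneg_lt inf_gt0 inf_ok.
have /negP[] : ~~ (inf S <= k) by rewrite -ltNge.
by apply: ge_inf.
Qed.

Lemma Fock_column_row N n phi : (n + m <= N)%N -> (forall e, wsupp n (phi e)) ->
  wdot N (ladjs N phi f) (ladjs N phi f) <=
  \sum_e \sum_e' wdot N (wconv (phi e) (f e')) (wconv (phi e) (f e')).
Proof.
move=> nmN phi_supp; have := defect_nonneg0 nmN phi_supp.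
rewrite /defect rmorph0 subr_ge0.
by under eq_bigr do rewrite mul0r addr0.
Qed.

End FockInequality.

Section Cutoff.
Variables (C : numClosedFieldType) (I : finType).
Local Notation W := (seq I).
Implicit Types phi g : W -> C.

Definition cutoff n phi : W -> C := fun w => phi w * (size w <= n)%:R.

Lemma wsupp_cutoff n phi : wsupp n (cutoff n phi).
Proof. by move=> w w_long; rewrite /cutoff leqNgt w_long mulr0. Qed.

Lemma cutoffE n phi w : (size w <= n)%N -> cutoff n phi w = phi w.
Proof. by move=> w_short; rewrite /cutoff w_short mulr1. Qed.

Lemma wdot_cutoff n N phi : (n <= N)%N ->
  wdot N (cutoff n phi) (cutoff n phi) = wdot n phi phi.
Proof.
move=> nN; rewrite (@wdot_supp _ _ N n n) //; last exact: wsupp_cutoff.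
by apply: eq_sum_words => w w_short; rewrite cutoffE.
Qed.

Definition annulus k n phi : W -> C := fun w => cutoff n phi w - cutoff k phi w.

Lemma wdot_annulus k n N phi : (k <= n)%N -> (n <= N)%N ->
  wdot N (annulus k n phi) (annulus k n phi) = wdot n phi phi - wdot k phi phi.
Proof.
move=> kn nN; rewrite -(wdot_cutoff phi nN) -(wdot_cutoff phi (leq_trans kn nN)).
rewrite /wdot -sumrB; apply: eq_bigr => w _; rewrite /annulus /cutoff.
have [wk|kw] := leqP (size w) k; first by rewrite (leq_trans wk kn) !subrr mul0r.
by rewrite mulr0 mul0r !subr0.
Qed.

(* Words of length at most [n] only see the values of [phi] that are kept by
   the cutoff at [n]; longer words only see the values on the annulus. *)
Lemma wconv_cutoff_norm_le m k n N phi g :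
  wsupp m g -> (k + m <= n)%N -> (n <= N)%N ->
  wdot N (wconv (cutoff n phi) g) (wconv (cutoff n phi) g) <=
  wdot n (wconv phi g) (wconv phi g) +
  wdot N (wconv (annulus k n phi) g) (wconv (annulus k n phi) g).
Proof.
move=> g_supp kmn nN; rewrite -(wdot_cutoff (wconv phi g) nN) -big_split.
apply: ler_sum => z _ /=; have [z_short|z_long] := leqP (size z) n.
  rewrite cutoffE // (_ : wconv _ _ z = wconv phi g z) ?lerDl ?mul_conjC_ge0 //.
  apply: eq_sum_splits => v w vw /=; rewrite cutoffE //.
  by move: z_short; rewrite -vw size_cat; lia.
rewrite (_ : wconv _ _ z = wconv (annulus k n phi) g z).
  by rewrite lerDr mul_conjC_ge0.
apply: eq_sum_splits => v w vw /=; rewrite /annulus.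
have [kv|vk] := ltnP k (size v); first by rewrite (@wsupp_cutoff k phi v) ?subr0.
by rewrite g_supp ?mulr0 //; move: z_long; rewrite -vw size_cat; lia.
Qed.

Lemma ladjs_cutoff (E : finType) (f phi : E -> W -> C) m n N x :
  (forall e, wsupp m (f e)) -> (m <= n)%N -> (n <= N)%N ->
  ladjs N (fun e => cutoff n (phi e)) f x = ladjs m phi f x.
Proof.
move=> f_supp mn nN; apply: eq_bigr => e _.
rewrite /ladj (@sum_words_supp _ _ m N) ?(leq_trans mn nN) // => [|w w_long].
  by apply: eq_sum_words => w w_short; rewrite cutoffE // (leq_trans w_short).
by rewrite (f_supp e) ?mulr0 // size_cat; lia.
Qed.

End Cutoff.

Section SquareSummableColumnRow.
Variables (R : realType) (I E J : finType).
Local Notation C := R[i].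
Local Notation W := (seq I).
Variables (f : E -> W -> C) (m : nat) (phi : J -> E -> W -> C) (b G : C).
Hypothesis f_supp : forall e, wsupp m (f e).
Hypothesis f_sym : forall e, wsym (f e).
Hypothesis phi_bounded : forall N, \sum_j \sum_e wdot N (phi j e) (phi j e) <= b.
Hypothesis conv_bounded : forall N, \sum_j \sum_e \sum_e'
  wdot N (wconv (phi j e) (f e')) (wconv (phi j e) (f e')) <= G.

Lemma exists_small_annulus (d : C) : 0 < d -> exists k,
  \sum_j \sum_e (wdot (k + m) (phi j e) (phi j e) - wdot k (phi j e) (phi j e)) <= d.
Proof.
move=> d_gt0; pose S N : C := \sum_j \sum_e wdot N (phi j e) (phi j e).
have S_ge0 N : 0 <= S N by do 2![apply: sumr_ge0 => ? _]; exact: wdot_ge0.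
have SE N : S N = (complex.Re (S N))%:C by rewrite RRe_real // ger0_real.
have bE : b = (complex.Re b)%:C.
  by rewrite RRe_real // ger0_real // (le_trans (S_ge0 0%N)) ?phi_bounded.
have dE : d = (complex.Re d)%:C by rewrite RRe_real // gtr0_real.
have S_bounded n : 0 <= complex.Re (S (n * m)%N) <= complex.Re b.
  by rewrite -ler0c -lecR -SE -bE S_ge0 phi_bounded.
have Re_d_gt0 : 0 < complex.Re d by rewrite -ltr0c -dE.
have [n S_small] := exists_small_increment S_bounded Re_d_gt0.
exists (n * m)%N; rewrite addnC -mulSn.
under eq_bigr do rewrite sumrB.
by move: S_small; rewrite sumrB -lecR rmorphB /= -!SE -dE.
Qed.

Lemma Fock_column_row_l2 :
  \sum_j wdot m (ladjs m (phi j) f) (ladjs m (phi j) f) <= G.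
Proof.
pose rho := right_mult_bound f m; have rho_ge0 : 0 <= rho := right_mult_bound_ge0 f m.
apply: (ler_addMgt0 rho_ge0) => d d_gt0.
have [k small] := exists_small_annulus d_gt0.
pose n := (k + m)%N; pose N := (n + m)%N; have nN : (n <= N)%N := leq_addr m n.
pose phi_cut j e := cutoff n (phi j e); pose chi j e := annulus k n (phi j e).
apply: (@le_trans _ _ (\sum_j \sum_e \sum_e'
    wdot N (wconv (phi_cut j e) (f e')) (wconv (phi_cut j e) (f e')))).
  apply: ler_sum => j _.
  rewrite -(@wdot_supp _ _ N m m) ?leq_addl //; last exact: wsupp_ladjs.
  rewrite -(eq_wdot _ (fun x => ladjs_cutoff (phi j) x f_supp (leq_addl k m) nN)
    (fun x => ladjs_cutoff (phi j) x f_supp (leq_addl k m) nN)).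
  apply: (Fock_column_row f_supp f_sym (leqnn _)) => e; exact: wsupp_cutoff.
apply: (@le_trans _ _ (\sum_j \sum_e (\sum_e'
    wdot n (wconv (phi j e) (f e')) (wconv (phi j e) (f e')) + rho * wdot N (chi j e) (chi j e)))).
  apply: ler_sum => j _; apply: ler_sum => e _.
  apply: le_trans (lerD (lexx _) (sum_wconv_norm_ler f_supp N _)).
  rewrite -big_split; apply: ler_sum => e' _.
  by apply: wconv_cutoff_norm_le => //; exact: f_supp.
under eq_bigr do rewrite big_split /= -mulr_sumr.
rewrite big_split /= -mulr_sumr [d * rho]mulrC.
apply: lerD (conv_bounded n) (ler_wpM2l rho_ge0 _); apply: le_trans small.
rewrite le_eqVlt; apply/predU1P; left; apply: eq_bigr => j _; apply: eq_bigr => e _.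
by apply: wdot_annulus; rewrite ?leq_addr.
Qed.

End SquareSummableColumnRow.

(** * Transfer functions of contractive block operators *)

Lemma sum_option (V : nmodType) (T : finType) (F : option T -> V) :
  \sum_o F o = F None + \sum_t F (Some t).
Proof.
rewrite (bigD1 None) //= (reindex_omap Some id) /=; last by case.
by congr (_ + _); apply: eq_bigl => t; rewrite eqxx.
Qed.

Lemma sum_prod (V : nmodType) (S T : finType) (F : S * T -> V) :
  \sum_p F p = \sum_x \sum_y F (x, y).
Proof. by rewrite pair_bigA; apply: eq_bigr => -[]. Qed.

Section Evaluation.
Variables (C : numClosedFieldType) (I : finType).
Local Notation W := (seq I).
Implicit Types beta gamma : I -> C.

(* The value of the noncommutative monomial [w] at the commuting point [beta]. *)
Definition wpow beta (w : W) : C := \prod_(i <- w) beta i.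

Lemma wpow_nil beta : wpow beta [::] = 1.
Proof. exact: big_nil. Qed.

Lemma wpow_cons beta i w : wpow beta (i :: w) = beta i * wpow beta w.
Proof. exact: big_cons. Qed.

Lemma wpow_cat beta v w : wpow beta (v ++ w) = wpow beta v * wpow beta w.
Proof. exact: big_cat. Qed.

Lemma wsym_wpow beta : wsym (wpow beta).
Proof. by move=> v w; exact: perm_big. Qed.

Lemma wdot_wpow beta gamma M :
  wdot M (wpow beta) (wpow gamma) = \sum_(l < M.+1) (\sum_i beta i * (gamma i)^*) ^+ l.
Proof.
elim: M => [|M IHM]; first by rewrite /wdot big_seq1 !wpow_nil conjC1 mulr1 big_ord1.
rewrite /wdot sum_words_cons big_ord_recl !wpow_nil conjC1 mulr1; congr (_ + _).
under [RHS]eq_bigr do rewrite exprS.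
rewrite -mulr_sumr -IHM mulr_suml; apply: eq_bigr => i _.
by rewrite mulr_sumr; apply: eq_bigr => w _; rewrite !wpow_cons rmorphM /=; ring.
Qed.

End Evaluation.

Section TransferFunction.
Variables (C : numClosedFieldType) (I O S : finType).
Local Notation W := (seq I).
Variable V : O + I * S -> option S -> C.
Hypothesis V_contractive : forall x : option S -> C,
  \sum_a normsq (\sum_b V a b * x b) <= \sum_b normsq (x b).

(* The discrete-time system with input at [None], states [Some r] and outputs
   [inl o], started at rest and fed with the unit impulse: its state after
   reading [w]. *)
Fixpoint impulse_state (w : W) (b : option S) : C :=
  if b is Some r then
    if w is i :: w' then \sum_b' V (inr (i, r)) b' * impulse_state w' b' else 0
  else wdelta C w.

Definition transfer (o : O) (w : W) : C := \sum_b V (inl o) b * impulse_state w b.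

Section Contractive.
Variable q : W -> C.
Let state z b := wconv (fun w => impulse_state w b) q z.

Let state_None z : state z None = q z.
Proof.
rewrite -[RHS]wconv_deltal /state; apply: eq_bigr => p _.
by congr (_ * _); case: (p.1).
Qed.

Let state_nil r : state [::] (Some r) = 0.
Proof. by rewrite /state /wconv big_seq1 mul0r. Qed.

Let wconv_lincomb (F : option S -> W -> C) (h : option S -> C) z :
  wconv (fun w => \sum_b h b * F b w) q z = \sum_b h b * wconv (F b) q z.
Proof.
rewrite (wconv_suml (fun b w => h b * F b w)); apply: eq_bigr => b _.
by rewrite mulr_sumr; apply: eq_bigr => p _; rewrite mulrA.
Qed.

Let state_cons i z r : state (i :: z) (Some r) = \sum_b V (inr (i, r)) b * state z b.
Proof. by rewrite /state wconv_cons mul0r add0r wconv_lincomb. Qed.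

Let wconv_transfer o z : wconv (transfer o) q z = \sum_b V (inl o) b * state z b.
Proof. exact: wconv_lincomb. Qed.

Lemma transfer_contractive N :
  \sum_o wdot N (wconv (transfer o) q) (wconv (transfer o) q) <= wdot N q q.
Proof.
pose energy z := \sum_r normsq (state z (Some r)).
have energy_ge0 z : 0 <= energy z by exact: sum_normsq_ge0.
have balance z : \sum_o normsq (wconv (transfer o) q z) + \sum_i energy (i :: z) <=
    normsq (q z) + energy z.
  have := V_contractive (state z); rewrite big_sumType sum_prod sum_option state_None /=.
  congr (_ + _ <= _); first by apply: eq_bigr => o _; rewrite wconv_transfer.
  by apply: eq_bigr => i _; apply: eq_bigr => r _; rewrite state_cons.
have := @ler_sum _ _ (words N) xpredT _ _ (fun z _ => balance z); rewrite !big_split /=.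
rewrite exchange_big [in X in _ + X]exchange_big /=.
have -> : \sum_i \sum_(z <- words N) energy (i :: z) = \sum_(z <- words N.+1) energy z.
  rewrite sum_words_cons [energy [::]]big1 ?add0r // => r _.
  by rewrite state_nil mul0r.
have := ler_sum_words (leqnSn N) energy_ge0.
rewrite -/(wdot N q q) => le_energy le_total; rewrite -(lerD2r (\sum_(z <- words N) energy z)).
by apply: le_trans le_total; rewrite lerD2l.
Qed.

End Contractive.

Section Value.
Variable beta : I -> C.
Local Notation pw := (wpow beta).
Local Notation nbeta := (\sum_i normsq (beta i)).

Let value m b := \sum_(w <- words m) impulse_state w b * pw w.
Let increment m r := value m.+1 (Some r) - value m (Some r).

Let value_None m : value m None = 1.
Proof.
rewrite /value sum_words_nil; first by rewrite wpow_nil mulr1.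
by move=> w /negPf w_neq; case: w w_neq => // i w _; rewrite mul0r.
Qed.

Let value0 r : value 0 (Some r) = 0.
Proof. by rewrite /value big_seq1 mul0r. Qed.

Let valueS m r : value m.+1 (Some r) =
  \sum_i beta i * \sum_b V (inr (i, r)) b * value m b.
Proof.
rewrite /value sum_words_cons mul0r add0r; apply: eq_bigr => i _.
under eq_bigr do rewrite wpow_cons mulrCA mulr_suml.
rewrite -mulr_sumr exchange_big; congr (_ * _); apply: eq_bigr => b _.
by rewrite mulr_sumr; apply: eq_bigr => w _; rewrite mulrA.
Qed.

Let step_norm_le (x : option S -> C) :
  \sum_r normsq (\sum_i beta i * \sum_b V (inr (i, r)) b * x b) <= nbeta * \sum_b normsq (x b).
Proof.
apply: (@le_trans _ _ (\sum_r nbeta * \sum_i normsq (\sum_b V (inr (i, r)) b * x b))).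
  by apply: ler_sum => r _; exact: CauchySchwarz_sum.
have nbeta_ge0 : 0 <= nbeta by exact: sum_normsq_ge0.
rewrite -mulr_sumr; apply: ler_wpM2l => //; apply: le_trans (V_contractive x).
rewrite big_sumType sum_prod exchange_big /= lerDr.
exact: sum_normsq_ge0.
Qed.

Let increment_norm_le m : \sum_r normsq (increment m r) <= nbeta ^+ m.+1.
Proof.
elim: m => [|m IHm].
  have := step_norm_le (value 0); rewrite sum_option value_None conjC1 mulr1.
  rewrite [X in 1 + X]big1 ?addr0 ?mulr1 => [|r _]; last by rewrite value0 mul0r.
  by congr (_ <= _); apply: eq_bigr => r _; rewrite /increment value0 subr0 valueS.
pose x b := if b is Some r then increment m r else 0.
have := step_norm_le x; rewrite sum_option mul0r add0r /=.
have -> : \sum_r normsq (\sum_i beta i * \sum_b V (inr (i, r)) b * x b) =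
    \sum_r normsq (increment m.+1 r).
  apply: eq_bigr => r _.
  suff -> : increment m.+1 r = \sum_i beta i * \sum_b V (inr (i, r)) b * x b by [].
  rewrite /increment !valueS -sumrB; apply: eq_bigr => i _.
  rewrite -mulrBr -sumrB; congr (_ * _); apply: eq_bigr => -[s|] _; rewrite -mulrBr //=.
  by rewrite !value_None subrr.
move/le_trans; apply; rewrite exprS; apply: ler_wpM2l => //.
exact: sum_normsq_ge0.
Qed.

(* If [(v, beta i * gamma r)] is mapped by [V] to [(t, gamma)], then [v]
   applied to the transfer function at [beta] is [t]. *)
Lemma transfer_value_error (v : O -> C) (gamma : S -> C) (t : C) m :
  (forall b, \sum_o v o * V (inl o) b + \sum_i \sum_r beta i * gamma r * V (inr (i, r)) b =
     if b is Some r then gamma r else t) ->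
  normsq (\sum_o v o * (\sum_(w <- words m) transfer o w * pw w) - t) <=
  (\sum_r normsq (gamma r)) * nbeta ^+ m.+1.
Proof.
move=> row_eq.
have transfer_value o : \sum_(w <- words m) transfer o w * pw w = \sum_b V (inl o) b * value m b.
  under eq_bigr do rewrite mulr_suml.
  rewrite exchange_big; apply: eq_bigr => b _; rewrite mulr_sumr.
  by apply: eq_bigr => w _; rewrite mulrA.
have errorE : \sum_o v o * (\sum_(w <- words m) transfer o w * pw w) - t =
    - \sum_r gamma r * increment m r.
  have -> : \sum_o v o * (\sum_(w <- words m) transfer o w * pw w) =
      \sum_b ((if b is Some r then gamma r else t) -
        \sum_i \sum_r beta i * gamma r * V (inr (i, r)) b) * value m b.
    under eq_bigr do rewrite transfer_value mulr_sumr.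
    rewrite exchange_big; apply: eq_bigr => b _; rewrite -row_eq addrK mulr_suml.
    by apply: eq_bigr => o _; rewrite mulrA.
  under eq_bigr do rewrite mulrBl.
  rewrite sumrB sum_option value_None mulr1.
  have -> : \sum_b (\sum_i \sum_r beta i * gamma r * V (inr (i, r)) b) * value m b =
      \sum_r gamma r * value m.+1 (Some r).
    under eq_bigr do rewrite exchange_big mulr_suml.
    rewrite exchange_big; apply: eq_bigr => r _; rewrite valueS mulr_sumr.
    under eq_bigr do rewrite mulr_suml.
    rewrite exchange_big; apply: eq_bigr => i _; rewrite !mulr_sumr.
    by apply: eq_bigr => b _; ring.
  have -> : \sum_r gamma r * increment m r =
      \sum_r gamma r * value m.+1 (Some r) - \sum_r gamma r * value m (Some r).
    by rewrite -sumrB; apply: eq_bigr => r _; rewrite mulrBr.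
  by ring.
rewrite errorE rmorphN mulrNN; apply: le_trans (CauchySchwarz_sum _ _ _) _.
by apply: ler_wpM2l (increment_norm_le m); exact: sum_normsq_ge0.
Qed.

End Value.
End TransferFunction.

(** * Kernels and finite combinations of kernel functions *)

Section Kernels.
Variables (R : realType) (X : Type).
Local Notation C := R[i].
Implicit Types k l : X -> X -> C.

(* [kform] for an arbitrary finite index type. *)
Definition fform (H : finType) k (z : H -> X) (c : H -> C) : C :=
  qform (fun i j => k (z i) (z j)) c.

Lemma fform_scale (H : finType) k (z : H -> X) a c :
  fform k z (fun i => a * c i) = normsq a * fform k z c.
Proof. exact: qform_scale. Qed.

Lemma fform_comp (H K : finType) (h : H -> K) k (z : K -> X) c :
  fform k (fun i => z (h i)) c = fform k z (fun j => \sum_(i | h i == j) c i).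
Proof. exact: (qform_comp h (fun i j => k (z i) (z j))). Qed.

Lemma eq_fform (H : finType) k (z : H -> X) c d : c =1 d -> fform k z c = fform k z d.
Proof. by move=> cd; exact: eq_qform. Qed.

Lemma kernel_psd k (H : finType) (z : H -> X) :
  is_kernel k -> psd (fun i j => k (z i) (z j)).
Proof.
move=> k_ker c; have := k_ker _ (fun i : 'I_#|H| => z (enum_val i)) (fun i => c (enum_val i)).
congr (0 <= _); rewrite /kform /qform [RHS]big_enum_val; apply: eq_bigr => i _.
by rewrite [RHS]big_enum_val.
Qed.

Lemma fform_ge0 k (H : finType) (z : H -> X) c : is_kernel k -> 0 <= fform k z c.
Proof. by move=> k_ker; exact: (kernel_psd z k_ker). Qed.

Lemma eq_kernel k l : (forall x y, k x y = l x y) -> is_kernel k -> is_kernel l.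
Proof. by move=> kl k_ker n x; exact: eq_psd (kernel_psd x k_ker). Qed.

Lemma kernelD k l : is_kernel k -> is_kernel l -> is_kernel (fun z w => k z w + l z w).
Proof. by move=> k_ker l_ker n x; exact: psdD (kernel_psd x k_ker) (kernel_psd x l_ker). Qed.

Lemma kernelM k l : is_kernel k -> is_kernel l -> is_kernel (fun z w => k z w * l z w).
Proof. by move=> k_ker l_ker n x; exact: psdM (kernel_psd x k_ker) (kernel_psd x l_ker). Qed.

Lemma kernelZ a k : 0 <= a -> is_kernel k -> is_kernel (fun z w => a * k z w).
Proof. by move=> a_ge0 k_ker n x; exact: psdZ a_ge0 (kernel_psd x k_ker). Qed.

Lemma kernel_rank1 (h : X -> C) : is_kernel (fun z w => h z * (h w)^*).
Proof. by move=> n x; exact: psd_rank1. Qed.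

Lemma gram_kernel (J : finType) (v : X -> J -> C) : is_kernel (gram v).
Proof. by move=> n x; exact: (gram_psd (fun i => v (x i))). Qed.

Lemma kernel_ge0 k x : is_kernel k -> 0 <= k x x.
Proof. by move=> k_ker; have := psd_diag_ge0 tt (kernel_psd (fun=> x) k_ker). Qed.

Lemma kernel_herm k x y : is_kernel k -> k y x = (k x y)^*.
Proof.
by move=> k_ker; have := psd_herm true false (kernel_psd (fun b => if b then x else y) k_ker).
Qed.

Lemma kernel_CauchySchwarz k x y : is_kernel k -> normsq (k x y) <= k x x * k y y.
Proof.
move=> k_ker; apply: hermitian_form2_discr => [|t]; first exact: kernel_ge0.
have := psd_pair true false t^* 1 (kernel_psd (fun b => if b then x else y) k_ker).
by congr (0 <= _); rewrite /= conjC1 conjCK (kernel_herm x y k_ker); ring.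
Qed.

Lemma kernel_diag_eq0 k x y : is_kernel k -> k y y = 0 -> k x y = 0.
Proof.
move=> k_ker kyy0; apply: normsq_le0; have := kernel_CauchySchwarz x y k_ker.
by rewrite kyy0 mulr0.
Qed.

Lemma kernel_diag_gt0 k x : is_kernel k -> (exists y, k y x != 0) -> 0 < k x x.
Proof.
move=> k_ker [y kyx_neq0]; rewrite lt0r kernel_ge0 // andbT.
by apply: contraNneq kyx_neq0 => kxx0; rewrite (kernel_diag_eq0 y k_ker kxx0).
Qed.

(* Formal linear combinations of points of [X], as lists, stand for the
   corresponding combinations of kernel functions. *)
Definition lscale (a : C) (u : seq (C * X)) := [seq (a * p.1, p.2) | p <- u].

Definition lval (f : X -> C) (u : seq (C * X)) : C := \sum_(p <- u) (p.1)^* * f p.2.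

Definition lcomb k (u : seq (C * X)) : X -> C := fun z => \sum_(p <- u) p.1 * k z p.2.

Definition lform k u v : C := lval (lcomb k v) u.

Definition lfamily (H : finType) (z : H -> X) (c : H -> C) : seq (C * X) :=
  [seq (c i, z i) | i <- enum H].

Lemma lval_cat f u v : lval f (u ++ v) = lval f u + lval f v.
Proof. by rewrite /lval big_cat. Qed.

Lemma lval_scale f a u : lval f (lscale a u) = a^* * lval f u.
Proof.
by rewrite /lval big_map mulr_sumr; apply: eq_bigr => p _; rewrite rmorphM /= mulrA.
Qed.

Lemma lval_family f (H : finType) (z : H -> X) c :
  lval f (lfamily z c) = \sum_i (c i)^* * f (z i).
Proof. by rewrite /lval big_map big_enum. Qed.

Lemma lcomb_family k (H : finType) (z : H -> X) c x :
  lcomb k (lfamily z c) x = \sum_i c i * k x (z i).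
Proof. by rewrite /lcomb big_map big_enum. Qed.

Lemma lform_family k (H : finType) (z : H -> X) c :
  lform k (lfamily z c) (lfamily z c) = fform k z c.
Proof.
rewrite /lform lval_family; apply: eq_bigr => i _; rewrite lcomb_family mulr_sumr.
by apply: eq_bigr => j _; rewrite mulrA.
Qed.

Lemma lfamily_tnth (u : seq (C * X)) :
  lfamily (fun i => (tnth (in_tuple u) i).2) (fun i => (tnth (in_tuple u) i).1) = u.
Proof.
transitivity [seq tnth (in_tuple u) i | i <- enum 'I_(size u)].
  by apply: eq_map => i; rewrite -surjective_pairing.
exact: map_tnth_enum.
Qed.

Lemma lform_catl k u v w : lform k (u ++ v) w = lform k u w + lform k v w.
Proof. exact: lval_cat. Qed.

Section Hermitian.
Variable k : X -> X -> C.
Hypothesis k_ker : is_kernel k.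

Lemma lform_ge0 u : 0 <= lform k u u.
Proof. by rewrite -(lfamily_tnth u) lform_family fform_ge0. Qed.

Lemma lform_herm u v : lform k v u = (lform k u v)^*.
Proof.
rewrite /lform /lval rmorph_sum /lcomb; under eq_bigr do rewrite mulr_sumr.
rewrite exchange_big; apply: eq_bigr => p _; rewrite rmorphM rmorph_sum mulr_sumr /=.
by apply: eq_bigr => q _; rewrite (kernel_herm p.2 q.2 k_ker) rmorphM /= conjCK; ring.
Qed.

Lemma lform_CauchySchwarz u v : normsq (lform k u v) <= lform k u u * lform k v v.
Proof.
apply: (hermitian_form_CauchySchwarz (lincomb := fun a x y => lscale a^* x ++ y)) => //.
- by move=> a x y z; rewrite lform_catl {1}/lform lval_scale conjCK.
- exact: lform_herm.
- exact: lform_ge0.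
- by move=> a; exact: lform_ge0.
Qed.

Lemma kernel_schur x : k x x != 0 -> is_kernel (fun z w => k z w - k z x * k x w / k x x).
Proof.
move=> kxx_neq0 n z c; have kxx_gt0 : 0 < k x x by rewrite lt0r kxx_neq0 kernel_ge0.
have := lform_CauchySchwarz (lfamily z c) [:: (1, x)].
have -> : lform k (lfamily z c) [:: (1, x)] = \sum_i (c i)^* * k (z i) x.
  by rewrite /lform lval_family; apply: eq_bigr => i _; rewrite /lcomb big_seq1 mul1r.
rewrite lform_family /lform /lval /lcomb !big_seq1 conjC1 !mul1r -qform_rank1.
rewrite -ler_pdivrMr // mulrC -qformZ -subr_ge0 -qformB; congr (0 <= _).
apply: eq_qform => // i j; rewrite (kernel_herm x (z j) k_ker) conjCK.
by rewrite mulrC.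
Qed.

End Hermitian.
End Kernels.

Section CompletePickKernels.
Variables (R : realType) (X : Type).
Local Notation C := R[i].
Variable B : X -> X -> C.
Hypothesis B_ker : is_kernel B.
Hypothesis B_lt1 : forall z, B z z < 1.

Definition pick_kernel (z w : X) : C := (1 - B z w)^-1.
Local Notation s := pick_kernel.

Lemma pick_kernel_base_neq1 z w : 1 - B z w != 0.
Proof.
rewrite subr_eq0; apply: contraTneq (kernel_CauchySchwarz z w B_ker) => <-.
rewrite conjC1 mulr1 lt_geF // (le_lt_trans _ (B_lt1 w)) // ler_piMl ?kernel_ge0 //.
exact: ltW.
Qed.

Lemma pick_kernel_neq0 z w : s z w != 0.
Proof. by rewrite invr_eq0 pick_kernel_base_neq1. Qed.

Lemma pick_kernel_gt0 z : 0 < s z z.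
Proof. by rewrite invr_gt0 subr_gt0. Qed.

Lemma pick_kernel_herm z w : s w z = (s z w)^*.
Proof. by rewrite /s fmorphV rmorphB /= conjC1 -(kernel_herm z w B_ker). Qed.

Lemma pick_kernel_geometric M z w :
  s z w = \sum_(l < M) B z w ^+ l + B z w ^+ M * s z w.
Proof.
apply: (mulfI (pick_kernel_base_neq1 z w)); rewrite mulrDr mulrCA divff ?pick_kernel_base_neq1 //.
by rewrite mulr1 -[(1 - _) * _]opprK -mulNr opprB -subrX1 opprB subrK.
Qed.

(* The kernel [<b(z), b(w)>] after moving [b(x)] to the origin by an
   automorphism of the ball. *)
Definition mobius_base x z w : C := 1 - s z x * s x w / (s x x * s z w).

Lemma mobius_numerator_kernel x :
  is_kernel (fun z w => (1 - B z x) * (1 - B x w) - (1 - B z w) * (1 - B x x)).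
Proof.
have Bxx_real : (B x x)^* = B x x by rewrite -(kernel_herm x x B_ker).
have [Bxx0|Bxx_neq0] := eqVneq (B x x) 0.
  apply: eq_kernel B_ker => z w; rewrite Bxx0 (kernel_herm w x B_ker).
  by rewrite !(kernel_diag_eq0 _ B_ker Bxx0) conjC0; ring.
apply: (@eq_kernel _ _ (fun z w => (1 - B x x) * (B z w - B z x * B x w / B x x) +
    (B x x)^-1 * ((B x x - B z x) * (B x x - B w x)^*))).
  move=> z w; rewrite rmorphB /= Bxx_real -(kernel_herm w x B_ker).
  by field.
apply: kernelD; last by apply: kernelZ (kernel_rank1 _); rewrite invr_ge0 kernel_ge0.
by apply: kernelZ (kernel_schur B_ker Bxx_neq0); rewrite subr_ge0 ltW.
Qed.

Lemma mobius_base_kernel x : is_kernel (mobius_base x).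
Proof.
apply: eq_kernel (kernelM (mobius_numerator_kernel x) (kernel_rank1 (fun z => s z x))) => z w.
rewrite -pick_kernel_herm /mobius_base /s.
by field; rewrite !pick_kernel_base_neq1.
Qed.

Lemma mobius_base_l x w : mobius_base x x w = 0.
Proof. by rewrite /mobius_base divff ?subrr // mulf_neq0 ?pick_kernel_neq0. Qed.

Lemma mobius_base_r x w : mobius_base x w x = 0.
Proof.
by rewrite /mobius_base [s x x * _]mulrC divff ?subrr // mulf_neq0 ?pick_kernel_neq0.
Qed.

Lemma pick_kernel_mobius x z w : s z w = s z x * s x w / s x x + s z w * mobius_base x z w.
Proof.
rewrite /mobius_base.
by have zw := pick_kernel_neq0 z w; have xx := pick_kernel_neq0 x x; field; rewrite zw xx.
Qed.

(* Splitting off the first point: the remainder is a Schur product that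
   vanishes at it. *)
Lemma pick_kernel_kernel : is_kernel s.
Proof.
move=> n; elim: n => [|n IHn] x c; first by rewrite /kform big_ord0.
pose x0 := x ord0; pose x' (i : 'I_n) := x (lift ord0 i).
pose K i j := s (x i) (x j) * mobius_base x0 (x i) (x j).
have K_ge0 : 0 <= qform (fun i j => K (lift ord0 i) (lift ord0 j)) (fun i => c (lift ord0 i)).
  apply: psdM (kernel_psd x' (mobius_base_kernel x0)) _ => d.
  exact: IHn x' d.
have -> : kform s x c =
    qform (fun i j => (s x0 x0)^-1 * (s (x i) x0 * (s (x j) x0)^*) + K i j) c.
  apply: eq_qform => // i j; rewrite -pick_kernel_herm /K.
  by rewrite {1}(pick_kernel_mobius x0 (x i) (x j)) mulrC.
rewrite qformD qformZ qform_rank1 addr_ge0 //.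
  by rewrite mulr_ge0 ?mul_conjC_ge0 // invr_ge0 ltW ?pick_kernel_gt0.
move: K_ge0; congr (0 <= _); rewrite /qform [RHS]big_ord_recl [in RHS]big1 => [|j _].
  rewrite add0r; apply: eq_bigr => i _; rewrite [RHS]big_ord_recl.
  by rewrite /K mobius_base_r !mulr0 add0r.
by rewrite /K mobius_base_l !mulr0.
Qed.

End CompletePickKernels.

Lemma normalized_complete_pickP (R : realType) (X : Type) (s : X -> X -> R[i]) :
  normalized_complete_pick s -> exists B,
  [/\ is_kernel B, forall z, B z z < 1 & s = pick_kernel B].
Proof.
move=> [K [ip [b [[lin herm pos _] _ b_lt1 _ sE]]]].
exists (fun z w => ip (b z) (b w)); split => // [n z c|]; last first.
  by apply: funext => z; apply: funext => w; exact: sE.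
have ip0 y : ip 0 y = 0 by have := lin (-1) 0 0 y; rewrite scaler0 addr0 mulN1r addNr.
have ip_sum (a : 'I_n -> R[i]) (y : 'I_n -> K) w :
    ip (\sum_i a i *: y i) w = \sum_i a i * ip (y i) w.
  by elim/big_rec2: _ => // i u v _ <-; rewrite lin.
have := pos (\sum_i (c i)^* *: b (z i)); rewrite ip_sum; congr (0 <= _).
apply: eq_bigr => i _; rewrite herm ip_sum rmorph_sum mulr_sumr; apply: eq_bigr => j _.
by rewrite rmorphM /= conjCK -herm mulrA.
Qed.

(** * The column-row inequality *)

Section Realization.
Variables (C : numClosedFieldType) (I E J : finType).
Local Notation W := (seq I).
Variables (beta : J -> I -> C) (u : J -> E -> C) (tau : J -> C).

Definition diag_target (p : J * J) : C := tau p.1 * (p.1 == p.2)%:R.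

(* The Pick matrix for a contractive column of multipliers whose [n]-th entry
   takes the value [tau j] at the [j]-th node if [j = n] and [0] otherwise. *)
Definition column_pick_matrix (p q : J * J) : C :=
  (gram u p.1 q.1 * (p.2 == q.2)%:R - diag_target p * (diag_target q)^*)
  / (1 - gram beta p.1 q.1).

Lemma qform_column_pick_matrix d : qform column_pick_matrix d =
  \sum_n qform (fun i j => gram u i j / (1 - gram beta i j)) (fun i => d (i, n)) -
  qform (fun i j => (1 - gram beta i j)^-1) (fun i => (tau i)^* * d (i, i)).
Proof.
pose s i j := (1 - gram beta i j)^-1.
transitivity (qform (fun p q => gram u p.1 q.1 * (p.2 == q.2)%:R * s p.1 q.1) d -
    qform (fun p q => diag_target p * (diag_target q)^* * s p.1 q.1) d).
  by rewrite -qformB; apply: eq_qform => // p q; rewrite -mulrBl.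
congr (_ - _).
  rewrite /qform sum_prod exchange_big /=; apply: eq_bigr => n _; apply: eq_bigr => i _.
  rewrite sum_prod; apply: eq_bigr => j _.
  rewrite -[RHS](sum_deltaM n (fun m =>
    (d (i, n))^* * d (j, m) * (gram u i j / (1 - gram beta i j)))).
  by apply: eq_bigr => m _; rewrite eq_sym /s /=; ring.
rewrite (qform_rescale (fun p q => s p.1 q.1)) (qform_comp fst s).
apply: eq_qform => // j; rewrite -(sum_deltaM j (fun n => (tau j)^* * d (j, n))).
rewrite (partition_big snd predT) //=; apply: eq_bigr => n _.
rewrite (big_pred1 (j, n)) => [|[j' n'] /=]; last by rewrite -xpair_eqE.
by rewrite /diag_target rmorphM /= conjC_nat eq_sym; ring.
Qed.

Hypothesis gram_neq1 : forall i j, 1 - gram beta i j != 0.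
Hypothesis pick_psd : psd column_pick_matrix.

(* A lurking isometry: [column_pick_matrix] is a Gram matrix, and moving the
   denominator to the other side equates two Gram matrices. *)
Lemma lurking_isometry : exists (gamma : J * J -> J * J -> C)
    (V : J * E + I * (J * J) -> option (J * J) -> C),
  (forall p b, \sum_(o : J * E) (p.2 == o.1)%:R * u p.1 o.2 * V (inl o) b +
      \sum_i \sum_r beta p.1 i * gamma p r * V (inr (i, r)) b =
    if b is Some r then gamma p r else diag_target p) /\
  forall x : option (J * J) -> C,
    \sum_a normsq (\sum_b V a b * x b) <= \sum_b normsq (x b).
Proof.
have [gamma gammaE] := psd_gram pick_psd.
pose D p (a : J * E + I * (J * J)) : C :=
  match a with
  | inl o => (p.2 == o.1)%:R * u p.1 o.2
  | inr ir => beta p.1 ir.1 * gamma p ir.2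
  end.
pose F p (b : option (J * J)) : C := if b is Some r then gamma p r else diag_target p.
have [p q|V DV V_contr] := @gram_contraction _ _ _ _ D F; last first.
  exists gamma, V; split=> // p b.
  by rewrite -[RHS]/(F p b) -DV big_sumType; congr (_ + _); rewrite [RHS]sum_prod.
rewrite {1 2}/gram /D /F big_sumType sum_option [X in X + _ = _]sum_prod [X in _ + X = _]sum_prod /=
  -/(gram gamma p q) -gammaE.
have -> : \sum_n \sum_e (p.2 == n)%:R * u p.1 e * ((q.2 == n)%:R * u q.1 e)^* =
    gram u p.1 q.1 * (p.2 == q.2)%:R.
  transitivity (\sum_n (n == p.2)%:R * (gram u p.1 q.1 * (q.2 == n)%:R)).
    apply: eq_bigr => n _; rewrite /gram mulr_suml mulr_sumr; apply: eq_bigr => e _.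
    by rewrite rmorphM /= conjC_nat [n == _]eq_sym; ring.
  by rewrite sum_deltaM eq_sym.
have -> : \sum_i \sum_r beta p.1 i * gamma p r * (beta q.1 i * gamma q r)^* =
    gram beta p.1 q.1 * column_pick_matrix p q.
  rewrite gammaE mulr_suml; apply: eq_bigr => i _; rewrite mulr_sumr.
  by apply: eq_bigr => r _; rewrite rmorphM /=; ring.
rewrite /column_pick_matrix; set x := gram u _ _ * _; set y := diag_target p * _.
by field.
Qed.

Lemma realization : exists Om : J -> E -> W -> C,
  (forall N q, \sum_n \sum_e wdot N (wconv (Om n e) q) (wconv (Om n e) q) <= wdot N q q) /\
  exists2 K : C, 0 <= K & forall m j n,
    normsq (\sum_e u j e * (\sum_(w <- words m) Om n e w * wpow (beta j) w)
      - diag_target (j, n)) <= K * gram beta j j ^+ m.+1.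
Proof.
have [gamma [V [row_eq V_contr]]] := lurking_isometry.
exists (fun n e => transfer V (n, e)); split=> [N q|].
  by have := transfer_contractive V_contr q N; rewrite sum_prod.
pose K := \sum_p \sum_r normsq (gamma p r).
exists K => [|m j n]; first by apply: sumr_ge0 => p _; exact: sum_normsq_ge0.
have -> : \sum_e u j e * (\sum_(w <- words m) transfer V (n, e) w * wpow (beta j) w) =
    \sum_(o : J * E) (n == o.1)%:R * u j o.2 *
      (\sum_(w <- words m) transfer V o w * wpow (beta j) w).
  rewrite [RHS]sum_prod -[LHS](sum_deltaM n (fun n' => \sum_e u j e *
    (\sum_(w <- words m) transfer V (n', e) w * wpow (beta j) w))).
  by apply: eq_bigr => n' _; rewrite mulr_sumr; apply: eq_bigr => e _; rewrite eq_sym mulrA.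
apply: le_trans (transfer_value_error V_contr m (row_eq (j, n))) _.
rewrite -[\sum_i normsq (beta _ i)]/(gram beta j j); apply: ler_wpM2r.
  by rewrite exprn_ge0 // sum_normsq_ge0.
rewrite /K [X in _ <= X](bigD1 (j, n)) //= lerDl; apply: sumr_ge0 => p _.
exact: sum_normsq_ge0.
Qed.

End Realization.

Lemma sum_normsq_closed (C : numClosedFieldType) (T : Type) (r : seq T) (t : T -> C) (b : C) :
  (forall d, 0 < d -> exists2 y : T -> C, \sum_(i <- r) normsq (y i) <= b &
    \sum_(i <- r) normsq (y i - t i) <= d) ->
  \sum_(i <- r) normsq (t i) <= b.
Proof.
move=> approx.
have b_ge0 : 0 <= b by have [y + _] := approx 1 ltr01; apply: le_trans; exact: sum_normsq_ge0.
apply: (@ler_addMgt0 _ _ _ (b + 2)) => [|d d_gt0]; first by rewrite addr_ge0.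
have [h [h_gt0 h_le1 h_le]] : exists h : C, [/\ 0 < h, h <= 1 & h <= d].
  have d1_gt0 : 0 < d + 1 by rewrite addr_gt0.
  exists (d / (d + 1)); split; first by rewrite divr_gt0.
    by rewrite ler_pdivrMr // mul1r lerDl.
  by rewrite ler_pdivrMr // ler_peMr ?lerDr // ltW.
have h_neq0 : h != 0 by rewrite gt_eqF.
have young (a c : C) : normsq a <= (1 + h) * normsq c + (1 + h^-1) * normsq (c - a).
  have -> : (1 + h) * normsq c + (1 + h^-1) * normsq (c - a) =
      normsq a + h^-1 * normsq ((1 + h) * c - a).
    have h_real : h^* = h by rewrite geC0_conj ?ltW.
    by rewrite !(rmorphB, rmorphM, rmorphD) /= rmorph1 h_real; field.
  by rewrite lerDl mulr_ge0 ?mul_conjC_ge0 // invr_ge0 ltW.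
have [y y_le yt_le] := approx (h * h) (mulr_gt0 h_gt0 h_gt0).
apply: (@le_trans _ _ ((1 + h) * b + (1 + h^-1) * (h * h))).
  apply: le_trans (ler_sum _ (fun i _ => young (t i) (y i))) _.
  rewrite big_split /= -!mulr_sumr.
  by apply: lerD; apply: ler_wpM2l; rewrite ?addr_ge0 ?invr_ge0 // ltW.
have -> : (1 + h) * b + (1 + h^-1) * (h * h) = b + h * (b + 1 + h) by field.
rewrite lerD2l; apply: ler_pM => //; [exact: ltW|by rewrite !addr_ge0 // ltW|].
by rewrite -addrA lerD2l -[2]/(1 + 1) lerD2l.
Qed.

Lemma exists_expr_le (R : realType) (x e : R[i]) : 0 <= x -> x < 1 -> 0 < e ->
  exists m, x ^+ m <= e.
Proof.
move=> x_ge0 x_lt1 e_gt0; have /complex_realP[y xE] := ger0_real x_ge0.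
have /complex_realP[d eE] := gtr0_real e_gt0; subst x e.
rewrite ler0c in x_ge0; rewrite ltr0c in e_gt0; move: x_lt1; rewrite -[1]/(1%:C) ltcR => y_lt1.
have y_norm : `|y| < 1 by rewrite ger0_norm.
have /pseudometric_normed_Zmodule.cvgr0Pnorm_le /(_ d e_gt0) [m _ /(_ m (leqnn m))] :=
  sequences.cvg_expr y_norm.
by exists m; rewrite -rmorphXn lecR -[y ^+ m]ger0_norm ?exprn_ge0.
Qed.

Section ColumnRow.
Variables (R : realType) (I E J : finType).
Local Notation C := R[i].
Local Notation W := (seq I).
Variables (beta : J -> I -> C) (u : J -> E -> C) (tau c : J -> C).
Hypothesis beta_lt1 : forall j, gram beta j j < 1.
Hypothesis pick_psd : psd (column_pick_matrix beta u tau).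
Local Notation B := (gram beta).
Local Notation s := (pick_kernel B).
Local Notation pw j := (wpow (beta j)).

Definition row_form : C := qform (fun i j => gram u i j * s i j) c.

Definition row_vector e (w : W) : C := \sum_j c j * (u j e)^* * (pw j w)^*.

Definition limit_vector n (x : W) : C := c n * (tau n)^* * (pw n x)^*.

Let s_ker : is_kernel s.
Proof. exact: pick_kernel_kernel (gram_kernel beta) beta_lt1. Qed.

Let B_ge0 j : 0 <= B j j.
Proof. exact: sum_normsq_ge0. Qed.

Lemma row_vector_norm_le M : \sum_e wdot M (row_vector e) (row_vector e) <= row_form.
Proof.
have -> : \sum_e wdot M (row_vector e) (row_vector e) =
    qform (fun i j => gram u i j * \sum_(l < M.+1) B i j ^+ l) c.
  transitivity (\sum_e \sum_(w <- words M)
      qform (fun i j => u i e * pw i w * (u j e * pw j w)^*) c).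
    apply: eq_bigr => e _; apply: eq_bigr => w _.
    rewrite (qform_rank1 (fun i => u i e * pw i w)).
    have -> : row_vector e w = (\sum_i (c i)^* * (u i e * pw i w))^*.
      by rewrite rmorph_sum; apply: eq_bigr => i _; rewrite !rmorphM /= conjCK mulrA.
    by rewrite conjCK mulrC.
  under eq_bigr do rewrite -qform_sum.
  rewrite -qform_sum; apply: eq_qform => // i j.
  rewrite -wdot_wpow /gram mulr_suml; apply: eq_bigr => e _.
  by rewrite mulr_sumr; apply: eq_bigr => w _; rewrite rmorphM /=; ring.
rewrite -subr_ge0 -qformB.
have := psdM (psdM (gram_psd u) (psdX M.+1 (gram_psd beta))) (kernel_psd id s_ker) c.
congr (0 <= _); apply: eq_qform => // i j.
by rewrite [in RHS](pick_kernel_geometric (gram_kernel beta) beta_lt1 M.+1) /=; ring.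
Qed.

Variable Om : J -> E -> W -> C.
Hypothesis Om_contractive : forall N q,
  \sum_n \sum_e wdot N (wconv (Om n e) q) (wconv (Om n e) q) <= wdot N q q.

Let value m j n := \sum_e u j e * (\sum_(w <- words m) Om n e w * pw j w).

Let truncation M e : W -> C := cutoff M (row_vector e).

Lemma transfer_row_le M :
  \sum_n wdot M (ladjs M (Om n) (truncation M)) (ladjs M (Om n) (truncation M)) <= row_form.
Proof.
apply: (@Fock_column_row_l2 _ _ _ _ _ _ _ 1) => [e|e v w vw|N|N].
- exact: wsupp_cutoff.
- rewrite /truncation /cutoff (perm_size vw); congr (_ * _); apply: eq_bigr => j _.
  by rewrite (wsym_wpow (beta j) vw).
- have := Om_contractive N (@wdelta C I); congr (_ <= _).
    apply: eq_bigr => n _; apply: eq_bigr => e _.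
    by apply: eq_wdot => w; rewrite wconv_deltar.
  rewrite /wdot sum_words_nil => [|w /negPf w_neq]; first by rewrite conjC1 mulr1.
  by rewrite /wdelta w_neq mul0r.
- under eq_bigr do rewrite exchange_big; rewrite exchange_big /=.
  apply: le_trans (row_vector_norm_le M); apply: ler_sum => e _.
  apply: le_trans (Om_contractive N (truncation M e)) _.
  rewrite -(wdot_cutoff (row_vector e) (leqnn M)).
  have [NM|MN] := leqP N M; first exact: ler_wdot.
  by rewrite (@wdot_supp _ _ N M M) ?(ltnW MN) //; exact: wsupp_cutoff.
Qed.

Lemma transfer_rowE M n x : (size x <= M)%N -> ladjs M (Om n) (truncation M) x =
  \sum_j c j * (pw j x)^* * (value (M - size x) j n)^*.
Proof.
move=> x_short.
transitivity (\sum_e \sum_(w <- words (M - size x)) (Om n e w)^* * row_vector e (w ++ x)).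
  apply: eq_bigr => e _; rewrite /ladj (@sum_words_supp _ _ (M - size x) M) ?leq_subr //.
    apply: eq_sum_words => w w_short; rewrite /truncation cutoffE // size_cat.
    by lia.
  by move=> w w_long; rewrite /truncation wsupp_cutoff ?mulr0 // size_cat; lia.
rewrite /row_vector; under eq_bigr do under eq_bigr do rewrite mulr_sumr.
under eq_bigr do rewrite exchange_big; rewrite exchange_big; apply: eq_bigr => j _.
rewrite rmorph_sum mulr_sumr; apply: eq_bigr => e _.
rewrite rmorphM rmorph_sum /= mulrA mulr_sumr; apply: eq_bigr => w _.
by rewrite wpow_cat !rmorphM /=; ring.
Qed.

Variable K : C.
Hypothesis K_ge0 : 0 <= K.
Hypothesis Om_value : forall m j n,
  normsq (value m j n - diag_target tau (j, n)) <= K * B j j ^+ m.+1.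

Let wpow_le1 j w : normsq (pw j w) <= 1.
Proof.
elim: w => [|i w IHw]; first by rewrite wpow_nil conjC1 mulr1.
rewrite wpow_cons rmorphM mulrACA -[X in _ <= X]mulr1.
apply: ler_pM; rewrite ?mul_conjC_ge0 //; apply: le_trans (ltW (beta_lt1 j)).
by rewrite /gram (bigD1 i) //= lerDl sum_normsq_ge0.
Qed.

Lemma exists_uniform_expr_le (d : C) : 0 < d -> exists m, forall j, B j j ^+ m <= d.
Proof.
move=> d_gt0.
have /boolp.choice[m m_small] j := exists_expr_le (B_ge0 j) (beta_lt1 j) d_gt0.
exists (\max_j m j) => j; apply: le_trans (m_small j).
by apply: ler_wiXn2l; [exact: B_ge0|exact: ltW|exact: leq_bigmax].
Qed.

Lemma transfer_row_error_le M n x d :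
  (size x <= M)%N -> (forall j, B j j ^+ (M - size x) <= d) ->
  normsq (ladjs M (Om n) (truncation M) x - limit_vector n x) <=
  (\sum_j normsq (c j)) * (K * #|J|%:R) * d.
Proof.
move=> x_short B_small; rewrite transfer_rowE //.
have -> : limit_vector n x = \sum_j c j * (pw j x)^* * (diag_target tau (j, n))^*.
  rewrite /limit_vector -[LHS](sum_deltaM n (fun j => c j * (tau j)^* * (pw j x)^*)).
  by apply: eq_bigr => j _; rewrite /diag_target rmorphM /= conjC_nat; ring.
rewrite -sumrB -mulrA; under eq_bigr do rewrite -mulrBr -rmorphB -mulrA -rmorphM.
apply: le_trans (CauchySchwarz_sum _ _ _) _; rewrite ler_wpM2l ?sum_normsq_ge0 //.
rewrite mulrAC mulr_natr -sumr_const; apply: ler_sum => j _.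
set y := value _ _ _ - _; rewrite conjCK mulrC rmorphM mulrACA -[K * d]mul1r.
apply: ler_pM; rewrite ?mul_conjC_ge0 ?wpow_le1 //; apply: le_trans (Om_value _ _ _) _.
rewrite ler_wpM2l // exprS; apply: le_trans (B_small j).
by rewrite ler_piMl ?exprn_ge0 // ltW.
Qed.

Lemma limit_vector_norm_le D :
  \sum_n wdot D (limit_vector n) (limit_vector n) <= row_form.
Proof.
pose r := [seq (n, x) | n <- index_enum J, x <- (words D : seq W)].
have sum_r (F : J * W -> C) : \sum_(p <- r) F p = \sum_n \sum_(x <- words D) F (n, x).
  by rewrite big_allpairs_dep.
rewrite -(sum_r (fun p => normsq (limit_vector p.1 p.2))).
apply: sum_normsq_closed => d d_gt0.
pose b := \sum_(p <- r) (\sum_j normsq (c j)) * (K * #|J|%:R).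
have b_ge0 : 0 <= b.
  by apply: sumr_ge0 => p _; rewrite !mulr_ge0 ?ler0n ?sum_normsq_ge0.
have [m m_small] := exists_uniform_expr_le (divr_gt0 d_gt0 (ltr_wpDl b_ge0 ltr01)).
pose M := (m + D)%N.
exists (fun p => ladjs M (Om p.1) (truncation M) p.2).
  rewrite (sum_r (fun p => normsq (ladjs M (Om p.1) (truncation M) p.2))) /=.
  apply: le_trans (transfer_row_le M); apply: ler_sum => n _.
  exact: ler_wdot (leq_addl m D).
apply: (@le_trans _ _ (\sum_(p <- r) (\sum_j normsq (c j)) * (K * #|J|%:R) * (d / (b + 1)))).
  rewrite !sum_r; apply: ler_sum => n _; rewrite big_seq [in X in _ <= X]big_seq.
  apply: ler_sum => x; rewrite mem_words => x_short.
  apply: transfer_row_error_le => [|j]; first by rewrite (leq_trans x_short) ?leq_addl.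
  apply: le_trans (m_small j); apply: ler_wiXn2l => //; first exact: ltW.
  by rewrite /M -addnBA ?leq_addr.
by rewrite -mulr_suml -/b mulrCA ler_piMr ?(ltW d_gt0) // ler_pdivrMr ?mul1r ?lerDl // ltr_wpDl.
Qed.

End ColumnRow.

Theorem column_row (R : realType) (I E J : finType) (beta : J -> I -> R[i])
    (u : J -> E -> R[i]) (tau : J -> R[i]) :
  (forall j, gram beta j j < 1) -> psd (column_pick_matrix beta u tau) ->
  forall c : J -> R[i],
    \sum_n normsq (c n * tau n) * pick_kernel (gram beta) n n <=
    qform (fun i j => gram u i j * pick_kernel (gram beta) i j) c.
Proof.
move=> beta_lt1 pick_psd c; have B_ker := gram_kernel beta.
have [Om [Om_contractive [K K_ge0 Om_value]]] :=
  realization (pick_kernel_base_neq1 B_ker beta_lt1) pick_psd.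
set S := \sum_n _.
have s_ge0 n : 0 <= pick_kernel (gram beta) n n := ltW (pick_kernel_gt0 beta_lt1 n).
have S_ge0 : 0 <= S by apply: sumr_ge0 => n _; rewrite mulr_ge0 ?mul_conjC_ge0.
apply: (ler_addMgt0 S_ge0) => d d_gt0.
have [m m_small] := exists_uniform_expr_le beta_lt1 d_gt0.
rewrite -lerBlDr; apply: le_trans (limit_vector_norm_le c beta_lt1 Om_contractive K_ge0 Om_value m).
rewrite /S mulr_sumr -sumrB; apply: ler_sum => n _.
have -> : wdot m (limit_vector beta tau c n) (limit_vector beta tau c n) =
    normsq (c n * tau n) * \sum_(l < m.+1) gram beta n n ^+ l.
  rewrite -wdot_wpow mulr_sumr -wdotC rmorph_sum; apply: eq_bigr => x _.
  by rewrite /limit_vector !rmorphM /= !conjCK; ring.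
rewrite [X in _ * X - _](pick_kernel_geometric B_ker beta_lt1 m.+1) mulrDr -addrA gerDl subr_le0.
rewrite [X in X <= _]mulrCA ler_wpM2r //; first by rewrite mulr_ge0 ?mul_conjC_ge0.
by rewrite exprS; apply: le_trans (m_small n); rewrite ler_piMl ?exprn_ge0 ?sum_normsq_ge0 // ltW.
Qed.

(** * Reproducing kernel Hilbert spaces *)

Lemma ler_sqr_cancel (F : numDomainType) (x y : F) :
  0 <= x -> 0 <= y -> x * x <= y * x -> x <= y.
Proof.
move=> x_ge0 y_ge0; have [->|x_neq0] := eqVneq x 0; first by [].
by rewrite ler_pM2r // lt0r x_neq0.
Qed.

Section ComplexModulus.
Variable R : realType.
Local Notation C := R[i].

Lemma cabsE (z : C) : (cabs z)%:C = `|z|.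
Proof. by rewrite /cabs normc_def. Qed.

Lemma cabs_sqr (z : C) : (cabs z ^+ 2)%:C = normsq z.
Proof. by rewrite rmorphXn /= cabsE normCK. Qed.

Lemma cabs_ge0 (z : C) : 0 <= cabs z.
Proof. by rewrite -ler0c cabsE. Qed.

Lemma conjC_real (r : R) : (r%:C)^* = r%:C.
Proof. exact: conjc_real. Qed.

End ComplexModulus.

Section Rkhs.
Variables (R : realType) (X : Type).
Local Notation C := R[i].
Implicit Types (k l : X -> X -> C) (u v : seq (C * X)) (f phi : X -> C).

Lemma rkhs_boundP k f M : rkhs_bound k f M <->
  forall u, normsq (lval f u) <= (M ^+ 2)%:C * lform k u u.
Proof.
split=> [f_le u|f_le n x c]; last first.
  by rewrite normCK -lval_family; apply: le_trans (f_le _) _; rewrite lform_family.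
have := f_le _ (fun i => (tnth (in_tuple u) i).2) (fun i => (tnth (in_tuple u) i).1).
by rewrite normCK -lval_family -[kform _ _ _]lform_family lfamily_tnth.
Qed.

Lemma rkhs_bound_norm k f M : rkhs_bound k f M -> rkhs_bound k f `|M|.
Proof. by move=> f_le n x c; rewrite (real_normK (num_real M)). Qed.

Lemma rkhs_norm_ge0 k f : in_rkhs k f -> 0 <= rkhs_norm k f.
Proof.
move=> [M f_le]; apply: lb_le_inf; last by move=> r [].
by exists `|M|; split; [exact: normr_ge0|exact: rkhs_bound_norm].
Qed.

Lemma rkhs_norm_le k f M : 0 <= M -> rkhs_bound k f M -> rkhs_norm k f <= M.
Proof. by move=> M_ge0 f_le; apply: ge_inf; [exists 0 => r []|]. Qed.

Lemma rkhs_norm_bound k f : is_kernel k -> in_rkhs k f -> rkhs_bound k f (rkhs_norm k f).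
Proof.
move=> k_ker f_in; have [M0 M0_bound] := f_in; apply/rkhs_boundP => u.
have /complex_realP[a aE] := ger0_real (mul_conjC_ge0 (lval f u)).
have /complex_realP[q qE] := ger0_real (lform_ge0 k_ker u).
have a_ge0 : 0 <= a by rewrite -ler0c -aE mul_conjC_ge0.
have q_ge0 : 0 <= q by rewrite -ler0c -qE lform_ge0.
have a_le M : rkhs_bound k f M -> a <= M ^+ 2 * q.
  by move=> /rkhs_boundP/(_ u); rewrite aE qE -rmorphM lecR.
rewrite aE qE -rmorphM lecR.
have [q0|q_neq0] := eqVneq q 0; first by have := a_le _ M0_bound; rewrite q0 !mulr0.
have q_gt0 : 0 < q by rewrite lt0r q_neq0.
rewrite -ler_pdivrMr // -[a / q]sqr_sqrtr ?divr_ge0 //.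
rewrite ler_sqr ?nnegrE ?sqrtr_ge0 ?rkhs_norm_ge0 //; apply: lb_le_inf.
  by exists `|M0|; split; [exact: normr_ge0|exact: rkhs_bound_norm].
move=> M [M_ge0 /a_le aq_le]; rewrite -[M]ger0_norm // -sqrtr_sqr ler_wsqrtr //.
by rewrite ler_pdivrMr.
Qed.

Lemma rkhs_lcomb k u : is_kernel k ->
  in_rkhs k (lcomb k u) /\ (rkhs_norm k (lcomb k u) ^+ 2)%:C = lform k u u.
Proof.
move=> k_ker; have /complex_realP[q qE] := ger0_real (lform_ge0 k_ker u).
have q_ge0 : 0 <= q by rewrite -ler0c -qE lform_ge0.
have u_bound : rkhs_bound k (lcomb k u) (Num.sqrt q).
  apply/rkhs_boundP => v; rewrite sqr_sqrtr // -qE [X in _ <= X]mulrC.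
  exact: (lform_CauchySchwarz k_ker v u).
have u_in : in_rkhs k (lcomb k u) by exists (Num.sqrt q).
split=> //; rewrite qE; congr (_%:C).
have norm_ge0 := rkhs_norm_ge0 u_in.
apply/le_anti/andP; split.
  by rewrite -[q in _ <= q]sqr_sqrtr // ler_sqr ?nnegrE ?sqrtr_ge0 ?rkhs_norm_le ?sqrtr_ge0.
have /rkhs_boundP/(_ u) := rkhs_norm_bound k_ker u_in.
rewrite -[lval _ _]/(lform k u u) qE conjC_real -!rmorphM lecR.
by apply: ler_sqr_cancel; rewrite ?sqr_ge0.
Qed.

Lemma lcomb1 k x : lcomb k [:: (1, x)] = (fun z => k z x).
Proof. by apply: funext => z; rewrite /lcomb big_seq1 mul1r. Qed.

Lemma lform1 k x : lform k [:: (1, x)] [:: (1, x)] = k x x.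
Proof. by rewrite /lform lcomb1 /lval big_seq1 conjC1 mul1r. Qed.

Lemma knorm_sqr k x : is_kernel k -> (knorm k x ^+ 2)%:C = k x x.
Proof.
by move=> k_ker; have [_] := rkhs_lcomb [:: (1, x)] k_ker; rewrite lcomb1 lform1.
Qed.

Lemma knorm_ge0 k x : is_kernel k -> 0 <= knorm k x.
Proof.
move=> k_ker; apply: rkhs_norm_ge0.
by have [] := rkhs_lcomb [:: (1, x)] k_ker; rewrite lcomb1.
Qed.

Lemma knorm_gt0 k x : is_kernel k -> 0 < k x x -> 0 < knorm k x.
Proof.
move=> k_ker kxx_gt0; rewrite lt0r knorm_ge0 // andbT.
apply: contraTneq kxx_gt0 => knorm0.
by rewrite -knorm_sqr // knorm0 expr0n ltxx.
Qed.

Lemma norm_ratio_sqr k l x : is_kernel k -> is_kernel l -> 0 < k x x ->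
  normsq ((knorm l x / knorm k x)%:C) * k x x = l x x.
Proof.
move=> k_ker l_ker kxx_gt0; rewrite conjC_real -!knorm_sqr // -!rmorphM; congr (_%:C).
by field; rewrite gt_eqF ?knorm_gt0.
Qed.

(* The adjoint of the multiplication by [phi], on combinations of kernel
   functions. *)
Definition lmul phi u := [seq ((phi p.2)^* * p.1, p.2) | p <- u].

Lemma lval_mul phi f u : lval (fun z => phi z * f z) u = lval f (lmul phi u).
Proof.
by rewrite /lval big_map; apply: eq_bigr => p _; rewrite rmorphM /= conjCK; ring.
Qed.

Lemma lmul_family phi (H : finType) (z : H -> X) c :
  lmul phi (lfamily z c) = lfamily z (fun i => (phi (z i))^* * c i).
Proof. by rewrite /lmul -map_comp. Qed.

Lemma is_multiplierP k l phi : is_kernel k -> is_kernel l ->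
  is_multiplier k l phi <->
  exists2 M : R, 0 <= M & forall u, lform k (lmul phi u) (lmul phi u) <= M%:C * lform l u u.
Proof.
move=> k_ker l_ker; split=> [[M0 phi_mult]|[M M_ge0 form_le]].
  exists (M0 ^+ 2) => [|u]; first exact: sqr_ge0.
  have [f_in f_norm] := rkhs_lcomb (lmul phi u) k_ker; have [phif_in phif_norm] := phi_mult _ f_in.
  have /rkhs_boundP/(_ u) := rkhs_norm_bound l_ker phif_in.
  rewrite lval_mul -[lval _ _]/(lform k (lmul phi u) (lmul phi u)) -f_norm conjC_real => sq_le.
  apply: ler_sqr_cancel; rewrite ?ler0c ?sqr_ge0 ?mulr_ge0 ?ler0c ?sqr_ge0 ?lform_ge0 //.
  apply: le_trans sq_le _; rewrite mulrAC ler_wpM2r ?lform_ge0 // -rmorphM lecR -exprMn.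
  have phif_ge0 := rkhs_norm_ge0 phif_in.
  by rewrite ler_sqr ?nnegrE // (le_trans phif_ge0).
exists (Num.sqrt M) => f f_in; have /rkhs_boundP f_bound := rkhs_norm_bound k_ker f_in.
have phif_bound : rkhs_bound l (fun z => phi z * f z) (Num.sqrt M * rkhs_norm k f).
  apply/rkhs_boundP => u; rewrite lval_mul; apply: le_trans (f_bound _) _.
  rewrite exprMn sqr_sqrtr // [(M * _)%:C]rmorphM -mulrA [X in _ <= X]mulrCA ler_wpM2l //.
  by rewrite ler0c sqr_ge0.
split; first by exists (Num.sqrt M * rkhs_norm k f).
by apply: rkhs_norm_le => //; rewrite mulr_ge0 ?sqrtr_ge0 ?rkhs_norm_ge0.
Qed.

End Rkhs.

Section SequenceConditions.
Variables (R : realType) (X : Type).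
Local Notation C := R[i].
Variables (k : X -> X -> C) (lam : nat -> X).
Hypotheses (k_ker : is_kernel k) (k_gt0 : forall z, 0 < k z z).

Lemma carleson_sumE (f : X -> C) N :
  (\sum_(i < N) cabs (f (lam i)) ^+ 2 / knorm k (lam i) ^+ 2)%:C =
  \sum_(i < N) normsq (f (lam i)) / k (lam i) (lam i).
Proof.
rewrite rmorph_sum; apply: eq_bigr => i _.
by rewrite rmorphM fmorphV /= cabs_sqr knorm_sqr.
Qed.

Lemma carleson_lcomb : carleson k lam -> exists2 b : R, 0 < b & forall u N,
  \sum_(i < N) normsq (lcomb k u (lam i)) / k (lam i) (lam i) <= b%:C * lform k u u.
Proof.
move=> [b [b_gt0 b_le]]; exists b => // u N; have [f_in f_norm] := rkhs_lcomb u k_ker.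
by rewrite -carleson_sumE -f_norm -rmorphM lecR; exact: b_le.
Qed.

(* An upper Riesz bound for the normalized kernel functions; it is dual to the
   Carleson condition. *)
Definition bessel_bound (b : R) := forall N (a : 'I_N -> C),
  fform k (fun i : 'I_N => lam i) a <= b%:C * \sum_i normsq (a i) * k (lam i) (lam i).

Lemma CauchySchwarz_weighted N (a f : 'I_N -> C) :
  normsq (\sum_i (a i)^* * f i) <=
  (\sum_i normsq (a i) * k (lam i) (lam i)) * (\sum_i normsq (f i) / k (lam i) (lam i)).
Proof.
pose r (i : 'I_N) := sqrtC (k (lam i) (lam i)).
have r_neq0 i : r i != 0 by rewrite sqrtC_eq0 gt_eqF.
have r_real i : (r i)^* = r i by rewrite geC0_conj ?sqrtC_ge0 ?ltW.
have kE (i : 'I_N) : k (lam i) (lam i) = r i * r i by rewrite -expr2 sqrtCK.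
have := CauchySchwarz_sum (index_enum 'I_N) (fun i => (a i)^* * r i) (fun i => f i / r i).
have -> : \sum_i (a i)^* * r i * (f i / r i) = \sum_i (a i)^* * f i.
  by apply: eq_bigr => i _; field.
congr (_ <= _ * _); apply: eq_bigr => i _; rewrite kE rmorphM ?fmorphV /= ?conjCK r_real.
  by ring.
by field.
Qed.

Lemma carleson_bessel : carleson k lam -> exists2 b : R, 0 < b & bessel_bound b.
Proof.
move=> /carleson_lcomb[b b_gt0 b_le]; exists b => // N a.
pose u := lfamily (fun i : 'I_N => lam i) a; rewrite -(lform_family k (fun i : 'I_N => lam i)) -/u.
have diag_ge0 : 0 <= \sum_i normsq (a i) * k (lam i) (lam i).
  by apply: sumr_ge0 => i _; rewrite mulr_ge0 ?mul_conjC_ge0 ?ltW.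
apply: ler_sqr_cancel; rewrite ?lform_ge0 // ?mulr_ge0 ?ler0c ?(ltW b_gt0) //.
have := CauchySchwarz_weighted a (fun i => lcomb k u (lam i)).
rewrite -(lval_family _ (fun i : 'I_N => lam i)) -/u -[lval _ _]/(lform k u u).
rewrite (geC0_conj (lform_ge0 k_ker u)) => /le_trans; apply.
rewrite [b%:C * _]mulrC -mulrA ler_wpM2l //; exact: b_le.
Qed.

Lemma bessel_carleson b : 0 < b -> bessel_bound b -> carleson k lam.
Proof.
move=> b_gt0 b_le; exists b; split=> // f f_in N; rewrite -lecR carleson_sumE rmorphM.
set S := \sum_(i < N) _; set M := (rkhs_norm k f ^+ 2)%:C.
have M_ge0 : 0 <= M by rewrite ler0c sqr_ge0.
have S_ge0 : 0 <= S.
  by apply: sumr_ge0 => i _; rewrite mulr_ge0 ?mul_conjC_ge0 // invr_ge0 ltW.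
have k_real i : (k (lam i) (lam i))^* = k (lam i) (lam i) by rewrite geC0_conj ?ltW.
pose a (i : 'I_N) := f (lam i) / k (lam i) (lam i).
have lvalE : lval f (lfamily (fun i : 'I_N => lam i) a) = S.
  rewrite lval_family; apply: eq_bigr => i _.
  by rewrite rmorphM fmorphV /= k_real; ring.
have diagE : \sum_i normsq (a i) * k (lam i) (lam i) = S.
  apply: eq_bigr => i _; rewrite /a rmorphM fmorphV /= k_real.
  by field; rewrite gt_eqF.
apply: ler_sqr_cancel => //; first by rewrite mulr_ge0 // ler0c ltW.
have /rkhs_boundP/(_ (lfamily (fun i : 'I_N => lam i) a)) := rkhs_norm_bound k_ker f_in.
rewrite lvalE (geC0_conj S_ge0) => /le_trans; apply; rewrite -/M mulrAC [_ * M]mulrC.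
by rewrite ler_wpM2l // lform_family; have := b_le N a; rewrite diagE.
Qed.

Definition separated_with n (e : R) := forall mu : 'I_n -> X, injective mu ->
  (forall i, exists m, mu i = lam m) -> forall i0 c,
  e%:C * (normsq (c i0) * k (mu i0) (mu i0)) <= fform k mu c.

Lemma khat_combE n (mu : 'I_n -> X) i0 (c : 'I_n -> C) :
  (fun z => khat k (mu i0) z - \sum_(j < n | j != i0) c j * khat k (mu j) z) =
  lcomb k (lfamily mu (fun j => (if j == i0 then 1 else - c j) / (knorm k (mu j))%:C)).
Proof.
apply: funext => z; rewrite lcomb_family [RHS](bigD1 i0) //= eqxx div1r /khat [_ / _]mulrC.
congr (_ + _); rewrite -sumrN; apply: eq_bigr => j /negPf ->.
by rewrite !mulNr [c j / _ * _]mulrAC mulrA.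
Qed.

Lemma le_rkhs_dist_khatP n (mu : 'I_n -> X) i0 e : 0 <= e ->
  e <= rkhs_dist k (khat k (mu i0)) (fun j => khat k (mu j)) (fun j => j != i0) <->
  forall c, (e ^+ 2)%:C * (normsq (c i0) * k (mu i0) (mu i0)) <= fform k mu c.
Proof.
move=> e_ge0; have kn_neq0 j : (knorm k (mu j))%:C != 0.
  by rewrite gt_eqF // ltr0c knorm_gt0.
pose coef c j : C := (if j == i0 then 1 else - c j) / (knorm k (mu j))%:C.
have normE c := rkhs_lcomb (lfamily mu (coef c)) k_ker.
have kE : k (mu i0) (mu i0) = (knorm k (mu i0))%:C * (knorm k (mu i0))%:C.
  by rewrite -knorm_sqr // rmorphM.
split=> [e_le c|form_ge]; last first.
  apply: lb_le_inf => [|_ [c ->]]; first by eexists; exists (fun=> 0).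
  have [f_in f_norm] := normE c; rewrite khat_combE -ler_sqr ?nnegrE ?rkhs_norm_ge0 //.
  rewrite -lecR f_norm lform_family; apply: le_trans (form_ge (coef c)).
  rewrite /coef eqxx div1r fmorphV /= conjC_real kE.
  by rewrite -invfM mulVf ?mulr1 // mulf_neq0.
have [c_eq0|c_neq0] := eqVneq (c i0) 0.
  by rewrite c_eq0 mul0r mul0r mulr0 fform_ge0.
pose d j := - (c j * (knorm k (mu j))%:C) / (c i0 * (knorm k (mu i0))%:C).
have [f_in f_norm] := normE d.
have e_le_norm : e <= rkhs_norm k (lcomb k (lfamily mu (coef d))).
  apply: le_trans e_le _; apply: ge_inf; last by exists d; rewrite khat_combE.
  by exists 0 => _ [d' ->]; rewrite khat_combE rkhs_norm_ge0 //; case: (normE d').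
have : (e ^+ 2)%:C <= fform k mu (coef d).
  by rewrite -lform_family -f_norm lecR ler_sqr ?nnegrE ?rkhs_norm_ge0.
have -> : fform k mu (coef d) = fform k mu (fun j => (c i0 * (knorm k (mu i0))%:C)^-1 * c j).
  apply: eq_fform => j; rewrite /coef /d; case: eqP => [->|_].
    by field; rewrite c_neq0 kn_neq0.
  by field; rewrite c_neq0 !kn_neq0.
have scaleE : normsq (c i0 * (knorm k (mu i0))%:C)^-1 = (normsq (c i0) * k (mu i0) (mu i0))^-1.
  by rewrite fmorphV rmorphM /= conjC_real kE -invfM; congr (_^-1); ring.
rewrite fform_scale scaleE mulrC ler_pdivlMr // mulr_gt0 //.
by rewrite lt0r mul_conjC_ge0 andbT mulf_neq0 ?conjC_eq0.
Qed.

Lemma weakly_separatedP n :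
  weakly_separated k lam n <-> exists2 e : R, 0 < e & separated_with n e.
Proof.
split=> [[e [e_gt0 e_le]]|[e e_gt0 e_le]].
  exists (e ^+ 2) => [|mu mu_inj mu_lam i0]; first by rewrite exprn_gt0.
  by apply/(le_rkhs_dist_khatP _ _ (ltW e_gt0)); exact: e_le.
exists (Num.sqrt e); split=> [|mu mu_inj mu_lam i0]; first by rewrite sqrtr_gt0.
apply/le_rkhs_dist_khatP; first exact: sqrtr_ge0.
by move=> c; rewrite sqr_sqrtr ?(ltW e_gt0) //; exact: e_le.
Qed.

End SequenceConditions.

(** * Strong separation *)

Lemma expR_le_prod_onem (R : realType) (T : eqType) (r : seq T) (a : T -> R) :
  (forall x, x \in r -> 0 <= a x <= 1 / 2) ->
  sequences.expR (- (2 * \sum_(x <- r) a x)) <= \prod_(x <- r) (1 - a x).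
Proof.
have expR_le_onem b : 0 <= b <= 1 / 2 -> sequences.expR (- (2 * b)) <= 1 - b :> R.
  move=> /andP[b_ge0 b_le]; rewrite exp.expRN invf_ple ?posrE ?exp.expR_gt0 //; last by lra.
  apply: le_trans (exp.expR_ge1Dx (2 * b)).
  by rewrite -div1r ler_pdivrMr; [nra|lra].
elim: r => [|x r IHr] a_le; first by rewrite !big_nil mulr0 oppr0 exp.expR0.
rewrite !big_cons mulrDr opprD exp.expRD; apply: ler_pM; rewrite ?exp.expR_ge0 //.
  by apply/expR_le_onem/a_le; rewrite mem_head.
by apply: IHr => y y_in; apply: a_le; rewrite in_cons y_in orbT.
Qed.

Section StrongSeparation.
Variables (R : realType) (X : Type).
Local Notation C := R[i].
Variables (B g : X -> X -> C).
Hypotheses (B_ker : is_kernel B) (B_lt1 : forall z, B z z < 1) (g_ker : is_kernel g).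
Local Notation s := (pick_kernel B).
Local Notation l := (fun z w => g z w * s z w).
Local Notation base := (mobius_base B).

Let s_ker : is_kernel s := pick_kernel_kernel B_ker B_lt1.
Let l_ker : is_kernel l := kernelM g_ker s_ker.
Let s_neq0 z w : s z w != 0 := pick_kernel_neq0 B_ker B_lt1 z w.

(* [theta] is a multiplier of [H_l] of norm at most one. *)
Definition contractive (theta : X -> C) :=
  is_kernel (fun z w => (1 - theta z * (theta w)^*) * l z w).

Lemma contractive_fform_le theta (H : finType) (z : H -> X) c : contractive theta ->
  fform l z (fun i => (theta (z i))^* * c i) <= fform l z c.
Proof.
move=> theta_contr; rewrite -subr_ge0; have := fform_ge0 z c theta_contr.
rewrite /fform -(qform_rescale (fun i j => l (z i) (z j)) (fun i => theta (z i))) -qformB.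
by congr (0 <= _); apply: eq_qform => // i j; ring.
Qed.

Lemma contractive1 : contractive (fun=> 1).
Proof.
have zero_ker : is_kernel (fun z w : X => (0 : C) * l z w) by apply: kernelZ.
by apply: eq_kernel zero_ker => z w; rewrite conjC1 mulr1 subrr.
Qed.

Lemma contractiveM theta eta :
  contractive theta -> contractive eta -> contractive (fun z => theta z * eta z).
Proof.
move=> theta_contr eta_contr.
apply: eq_kernel (kernelD theta_contr (kernelM (kernel_rank1 theta) eta_contr)) => z w.
by rewrite rmorphM /=; ring.
Qed.

Lemma contractive_mobius x y : exists2 theta : X -> C,
  theta x = 0 /\ normsq (theta y) = base x y y & contractive theta.
Proof.
have base_ker := mobius_base_kernel B_ker B_lt1 x.
have [byy0|byy_neq0] := eqVneq (base x y y) 0.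
  exists (fun=> 0); first by rewrite byy0 mul0r.
  by apply: eq_kernel l_ker => z w; rewrite mul0r subr0 mul1r.
pose r := sqrtC (base x y y).
have r_sqr : r * r = base x y y by rewrite -expr2 sqrtCK.
have r_real : r^* = r by rewrite geC0_conj // sqrtC_ge0 kernel_ge0.
have r_neq0 : r != 0 by rewrite sqrtC_eq0.
exists (fun z => base x z y / r).
  split; first by rewrite mobius_base_l // mul0r.
  rewrite rmorphM fmorphV /= r_real (geC0_conj (kernel_ge0 y base_ker)) -r_sqr.
  by field.
have sxx_ge0 : 0 <= (s x x)^-1 by rewrite invr_ge0 ltW // pick_kernel_gt0.
apply: eq_kernel (kernelM g_ker (kernelD (kernelZ sxx_ge0 (kernel_rank1 (fun z => s z x)))
  (kernelM s_ker (kernel_schur base_ker byy_neq0)))) => z w.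
have -> : (base x w y / r)^* = base x y w / r.
  by rewrite rmorphM fmorphV /= r_real -(kernel_herm w y base_ker).
rewrite -(pick_kernel_herm B_ker w x) -r_sqr.
have -> : (s x x)^-1 * (s z x * s x w) = s z w - s z w * base x z w.
  by rewrite mulrC {1}(pick_kernel_mobius B_ker B_lt1 x z w) addrK.
by field.
Qed.

Lemma contractive_blaschke (T : eqType) (p : T -> X) (r : seq T) y : exists2 theta : X -> C,
  (forall t, t \in r -> theta (p t) = 0) /\
  normsq (theta y) = \prod_(t <- r) base (p t) y y & contractive theta.
Proof.
elim: r => [|t r [theta [theta0 theta_y] theta_contr]].
  by exists (fun=> 1); [split=> //; rewrite big_nil conjC1 mulr1|exact: contractive1].
have [eta [eta_t eta_y] eta_contr] := contractive_mobius (p t) y.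
exists (fun z => eta z * theta z); last exact: contractiveM.
split=> [t'|]; last by rewrite big_cons -eta_y -theta_y rmorphM /=; ring.
by rewrite in_cons => /orP[/eqP ->|/theta0 ->]; rewrite ?eta_t ?mul0r ?mulr0.
Qed.

(* The squared inner product of the normalized kernel functions of [s]. *)
Definition overlap (x y : X) : R := complex.Re (normsq (s x y) / s x x / s y y).

Lemma overlapE x y : (overlap x y)%:C = normsq (s x y) / s x x / s y y.
Proof.
by rewrite RRe_real // ger0_real // !divr_ge0 ?mul_conjC_ge0 ?kernel_ge0.
Qed.

Lemma overlap_ge0 x y : 0 <= overlap x y.
Proof. by rewrite -ler0c overlapE !divr_ge0 ?mul_conjC_ge0 ?kernel_ge0. Qed.

Lemma overlap_self x : overlap x x = 1.
Proof.
apply: complexI; rewrite overlapE -pick_kernel_herm // rmorph1.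
by field; rewrite s_neq0.
Qed.

Lemma mobius_base_overlap x y : base x y y = (1 - overlap x y)%:C.
Proof.
rewrite rmorphB rmorph1 /= overlapE /mobius_base (pick_kernel_herm B_ker y x).
by rewrite conjCK; field; rewrite !s_neq0.
Qed.

Section Sequence.
Variable lam : nat -> X.
Hypothesis lam_inj : injective lam.
Hypothesis l_gt0 : forall z, 0 < l z z.

Definition strongly_separated (e : R) := forall N (n : 'I_N) (c : 'I_N -> C),
  e%:C * (normsq (c n) * l (lam n) (lam n)) <= fform l (fun i : 'I_N => lam i) c.

Lemma separated_with_le n (e e' : R) :
  e <= e' -> separated_with l lam n e' -> separated_with l lam n e.
Proof.
move=> le_ee' sep mu mu_inj mu_lam i0 c; apply: le_trans (sep mu mu_inj mu_lam i0 c).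
by rewrite ler_wpM2r ?lecR // mulr_ge0 ?mul_conjC_ge0 ?ltW.
Qed.

Lemma separated_with1 : separated_with l lam 1 1.
Proof.
move=> mu _ _ i0 c; rewrite /fform /qform !big_ord1 !ord1 [(c _)^* * _]mulrC.
by rewrite rmorph1 mul1r.
Qed.

Lemma separated_uniformly M :
  (forall n, (2 <= n)%N -> exists2 e, 0 < e & separated_with l lam n e) ->
  exists2 e, 0 < e & forall n, (n <= M)%N -> separated_with l lam n e.
Proof.
move=> sep; elim: M => [|M [e e_gt0 e_sep]].
  by exists 1 => // n; rewrite leqn0 => /eqP -> mu _ _ [].
have [e' e'_gt0 e'_sep] : exists2 e, 0 < e & separated_with l lam M.+1 e.
  by case: M {e_sep} => [|M]; [exists 1 => //; exact: separated_with1|exact: sep].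
exists (Num.min e e'); first by rewrite lt_min e_gt0.
move=> n; rewrite leq_eqVlt => /orP[/eqP ->|nM].
  by apply: separated_with_le e'_sep; rewrite ge_min lexx orbT.
by apply: separated_with_le (e_sep _ nM); rewrite ge_min lexx.
Qed.

Lemma carleson_overlap_sum : carleson s lam ->
  exists b : R, forall N n, \sum_(i < N) overlap (lam i) (lam n) <= b.
Proof.
move=> /(carleson_lcomb s_ker)[b b_gt0 b_le]; exists b => N n.
have := b_le [:: (1, lam n)] N; rewrite lform1 lcomb1 -ler_pdivrMr ?pick_kernel_gt0 //.
rewrite mulr_suml -lecR rmorph_sum; congr (_ <= _); apply: eq_bigr => i _.
by rewrite /= overlapE.
Qed.

Variable b : R.
Hypothesis overlap_sum_le : forall N n, \sum_(i < N) overlap (lam i) (lam n) <= b.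

Lemma far_points_multiplier N n : exists2 theta : X -> C,
  (forall i : 'I_N, overlap (lam i) (lam n) <= 1 / 2 -> theta (lam i) = 0) /\
  (sequences.expR (- (2 * b)))%:C <= normsq (theta (lam n)) & contractive theta.
Proof.
pose r := [seq i : 'I_N <- enum 'I_N | overlap (lam i) (lam n) <= 1 / 2].
have [theta [theta0 theta_n] theta_contr] :=
  contractive_blaschke (fun i : 'I_N => lam i) r (lam n).
exists theta => //; split=> [i i_far|].
  by apply: theta0; rewrite mem_filter i_far mem_enum.
rewrite theta_n; under eq_bigr do rewrite mobius_base_overlap.
rewrite -rmorph_prod lecR; apply: le_trans (expR_le_prod_onem (a := fun i : 'I_N =>
  overlap (lam i) (lam n)) _); last first.
  by move=> i; rewrite mem_filter overlap_ge0 => /andP[].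
rewrite exp.ler_expR lerN2 ler_pM2l //; apply: le_trans (overlap_sum_le N n).
rewrite big_filter big_enum_cond /=.
rewrite [X in _ <= X](bigID (fun i : 'I_N => overlap (lam i) (lam n) <= 1 / 2)) /=.
by rewrite lerDl sumr_ge0 // => i _; exact: overlap_ge0.
Qed.

Lemma card_near_points N n : #|[set i : 'I_N | 1 / 2 < overlap (lam i) (lam n)]|%:R <= 2 * b.
Proof.
set S := [set i | _].
have : \sum_(i in S) (1 / 2 : R) <= \sum_(i in S) overlap (lam i) (lam n).
  by apply: ler_sum => i; rewrite inE => /ltW.
rewrite sumr_const -mulr_natr => card_le.
have : \sum_(i in S) overlap (lam i) (lam n) <= b.
  apply: le_trans (overlap_sum_le N n); rewrite [X in _ <= X](bigID (mem S)) /= lerDl.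
  by apply: sumr_ge0 => i _; exact: overlap_ge0.
by move=> /(le_trans card_le); lra.
Qed.

Lemma strong_separation :
  (forall n, (2 <= n)%N -> exists2 e, 0 < e & separated_with l lam n e) ->
  exists2 e, 0 < e & strongly_separated e.
Proof.
move=> sep; pose M := Num.bound (2 * b).
have b_ge0 : 0 <= b by have := overlap_sum_le 0 0; rewrite big_ord0.
have [e e_gt0 e_sep] := separated_uniformly M sep.
exists (e * sequences.expR (- (2 * b))) => [|N n c]; first by rewrite mulr_gt0 ?exp.expR_gt0.
have [theta [theta_far theta_n] theta_contr] := far_points_multiplier N n.
pose d (i : 'I_N) := (theta (lam i))^* * c i.
apply: le_trans (contractive_fform_le (fun i : 'I_N => lam i) c theta_contr).
rewrite -/d; pose S := [set i : 'I_N | 1 / 2 < overlap (lam i) (lam n)].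
have d_supp i : i \notin S -> d i = 0.
  by rewrite inE -leNgt => /theta_far theta_i; rewrite /d theta_i conjC0 mul0r.
have nS : n \in S by rewrite inE overlap_self; lra.
have S_small : (#|S| <= M)%N.
  rewrite ltnW // -(ltr_nat R); apply: le_lt_trans (card_near_points N n) _.
  by apply: archi_boundP; rewrite mulr_ge0.
pose mu (i : 'I_#|S|) := lam (enum_val i).
have mu_inj : injective mu by move=> i j /lam_inj/val_inj/enum_val_inj.
have mu_lam i : exists m, mu i = lam m by exists (enum_val i).
rewrite [X in _ <= X](qform_support _ d_supp).
have := e_sep _ S_small mu mu_inj mu_lam (enum_rank_in nS n) (fun i => d (enum_val i)).
rewrite /mu enum_rankK_in //; apply: le_trans.
have -> : (e * sequences.expR (- (2 * b)))%:C = e%:C * (sequences.expR (- (2 * b)))%:C.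
  exact: rmorphM.
rewrite -mulrA ler_wpM2l ?ler0c ?(ltW e_gt0) // mulrA ler_wpM2r ?(ltW (l_gt0 _)) //.
have -> : normsq (d n) = normsq (theta (lam n)) * normsq (c n).
  by rewrite /d rmorphM /= conjCK; ring.
by rewrite ler_wpM2r ?mul_conjC_ge0.
Qed.

End Sequence.
End StrongSeparation.

(** * Riesz bounds *)

Lemma finite_range_nat (T : Type) (lam : nat -> T) (H : finType) (z : H -> T) :
  (forall h, exists m, z h = lam m) -> exists N (m : H -> 'I_N), forall h, z h = lam (m h).
Proof.
move=> /choice[m zE]; exists (\max_h m h).+1.
have m_lt h : (m h < (\max_h m h).+1)%N by rewrite ltnS; exact: leq_bigmax.
by exists (fun h => Ordinal (m_lt h)).
Qed.

Section LowerRieszBound.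
Variables (R : realType) (X : Type).
Local Notation C := R[i].
Implicit Types (k l : X -> X -> C) (lam : nat -> X).

Definition lower_riesz_bound k lam (a : R) := forall N (c : 'I_N -> C),
  a%:C * (\sum_i normsq (c i) * k (lam i) (lam i)) <= fform k (fun i : 'I_N => lam i) c.

Lemma lower_riesz_separated k lam n a : is_kernel k -> 0 <= a ->
  lower_riesz_bound k lam a -> separated_with k lam n a.
Proof.
move=> k_ker a_ge0 a_le mu mu_inj /finite_range_nat[N [m muE]] i0 c.
have -> : fform k mu c = fform k (fun j : 'I_N => lam j) (fun j => \sum_(i | m i == j) c i).
  rewrite -(fform_comp m k (fun j : 'I_N => lam j)).
  by apply: eq_qform => // i j; rewrite !muE.
apply: le_trans (a_le _ _); rewrite ler_wpM2l ?ler0c // (bigD1 (m i0)) //= (big_pred1 i0).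
  rewrite -muE lerDl; apply: sumr_ge0 => j _.
  by rewrite mulr_ge0 ?mul_conjC_ge0 ?kernel_ge0.
by move=> i; apply/eqP/eqP => [mi|->//]; apply: mu_inj; rewrite !muE mi.
Qed.

(* [M] bounds the squared norm of the multiplier with values
   [w i * ||l_{lam i}|| / ||k_{lam i}||], on the span of the kernel functions
   at the points of the sequence. *)
Definition target_bound k l lam (M : R) (w : nat -> C) := forall N (c : 'I_N -> C),
  fform k (fun i : 'I_N => lam i)
      (fun i => (w i * (knorm l (lam i) / knorm k (lam i))%:C)^* * c i) <=
    M%:C * fform l (fun i : 'I_N => lam i) c.

Lemma bessel_riesz_target_bound k l lam (a b W : R) (w : nat -> C) :
  is_kernel k -> is_kernel l -> (forall z, 0 < k z z) -> 0 < a -> 0 <= b ->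
  bessel_bound k lam b -> lower_riesz_bound l lam a -> (forall i, cabs (w i) <= W) ->
  target_bound k l lam (b * W ^+ 2 / a) w.
Proof.
move=> k_ker l_ker k_gt0 a_gt0 b_ge0 b_le a_le w_le N c; apply: le_trans (b_le N _) _.
have -> : (b * W ^+ 2 / a)%:C = b%:C * ((W ^+ 2)%:C / a%:C).
  by rewrite -fmorphV -!rmorphM mulrA.
rewrite -mulrA ler_wpM2l ?ler0c //.
apply: (@le_trans _ _ ((W ^+ 2)%:C * \sum_(i < N) normsq (c i) * l (lam i) (lam i))).
  rewrite mulr_sumr; apply: ler_sum => i _; set ratio := (_ / _)%:C.
  have -> : normsq ((w i * ratio)^* * c i) * k (lam i) (lam i) =
      normsq (w i) * (normsq (c i) * (normsq ratio * k (lam i) (lam i))).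
    by rewrite !rmorphM /= !conjCK; ring.
  rewrite norm_ratio_sqr // ler_wpM2r //.
    by rewrite mulr_ge0 ?mul_conjC_ge0 ?kernel_ge0.
  rewrite -cabs_sqr lecR ler_sqr ?nnegrE ?cabs_ge0 //.
  exact: le_trans (cabs_ge0 _) (w_le i).
rewrite -mulrA ler_wpM2l ?ler0c ?sqr_ge0 // mulrC ler_pdivlMr ?ltr0c // mulrC.
exact: a_le.
Qed.

End LowerRieszBound.

Section StronglySeparatedRiesz.
Variables (R : realType) (X : Type).
Local Notation C := R[i].
Variables (B g : X -> X -> C) (lam : nat -> X) (b e : R).
Hypotheses (B_ker : is_kernel B) (B_lt1 : forall z, B z z < 1) (g_ker : is_kernel g).
Local Notation s := (pick_kernel B).
Local Notation l := (fun z w => g z w * s z w).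
Hypotheses (b_gt0 : 0 < b) (e_gt0 : 0 < e).
Hypotheses (b_le : bessel_bound s lam b) (e_le : strongly_separated B g lam e).

Let s_ker : is_kernel s := pick_kernel_kernel B_ker B_lt1.
Let s_gt0 z : 0 < s z z := pick_kernel_gt0 B_lt1 z.

Let t (i : nat) := (e / b)%:C * l (lam i) (lam i) / s (lam i) (lam i).
Let tau (i : nat) := sqrtC (t i).

Let normsq_mul_tau c i : normsq (c * tau i) = t i * normsq c.
Proof.
have t_ge0 : 0 <= t i.
  rewrite divr_ge0 ?(ltW (s_gt0 _)) // mulr_ge0 //; first by rewrite ler0c divr_ge0 ?ltW.
  exact: kernel_ge0 (kernelM g_ker s_ker).
have tau_real : (tau i)^* = tau i by rewrite geC0_conj ?sqrtC_ge0.
have tau_sqr : tau i * tau i = t i by rewrite -expr2 sqrtCK.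
by rewrite rmorphM /= tau_real -tau_sqr; ring.
Qed.

(* By strong separation, the column whose [n]-th entry is [tau n] at [lam n] and
   [0] at the other points is a contractive multiplier. *)
Lemma strongly_separated_column_psd N (beta u : 'I_N -> 'I_N -> C) :
  (forall i j : 'I_N, B (lam i) (lam j) = gram beta i j) ->
  (forall i j : 'I_N, g (lam i) (lam j) = gram u i j) ->
  psd (column_pick_matrix beta u (fun i : 'I_N => tau i)).
Proof.
move=> betaE uE d; rewrite qform_column_pick_matrix subr_ge0.
have -> : qform (fun i j => (1 - gram beta i j)^-1) (fun i => (tau i)^* * d (i, i)) =
    fform s (fun i : 'I_N => lam i) (fun i => (tau i)^* * d (i, i)).
  by apply: eq_qform => // i j; rewrite -betaE.
apply: le_trans (b_le (fun i : 'I_N => (tau i)^* * d (i, i))) _.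
rewrite mulr_sumr; apply: ler_sum => i _.
have -> : qform (fun j j' => gram u j j' / (1 - gram beta j j')) (fun j => d (j, i)) =
    fform l (fun i : 'I_N => lam i) (fun j => d (j, i)).
  by apply: eq_qform => // j j'; rewrite -betaE -uE.
apply: le_trans (e_le i (fun j : 'I_N => d (j, i))).
have -> : normsq ((tau i)^* * d (i, i)) = t i * normsq (d (i, i)).
  by rewrite -normsq_mul_tau !rmorphM /= conjCK; ring.
rewrite le_eqVlt; apply/predU1P; left; rewrite /t fmorph_div /=.
by field; rewrite !gt_eqF ?ltr0c.
Qed.

Lemma strongly_separated_riesz : lower_riesz_bound l lam (e / b).
Proof.
move=> N c.
have [beta betaE] := psd_gram (kernel_psd (fun i : 'I_N => lam i) B_ker).
have [u uE] := psd_gram (kernel_psd (fun i : 'I_N => lam i) g_ker).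
have beta_lt1 i : gram beta i i < 1 by rewrite -betaE.
have pickE i j : pick_kernel (gram beta) i j = s (lam i) (lam j).
  by rewrite /pick_kernel -betaE.
have -> : fform l (fun i : 'I_N => lam i) c =
    qform (fun i j => gram u i j * pick_kernel (gram beta) i j) c.
  by apply: eq_qform => // i j; rewrite pickE -uE.
apply: le_trans (column_row beta_lt1 (strongly_separated_column_psd betaE uE) c).
rewrite mulr_sumr; apply: ler_sum => i _; rewrite pickE normsq_mul_tau.
rewrite le_eqVlt; apply/predU1P; left; rewrite /t.
by field; rewrite !gt_eqF ?ltr0c.
Qed.

End StronglySeparatedRiesz.

(** * Extending solutions of the Pick problem *)

Lemma dominated_functional_extend (R : realType) (V : Type) (v0 : V) (add : V -> V -> V)
    (scale : R -> V -> V) (F : V -> R) (P : V -> R -> R) :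
  (forall u v, F (add u v) = F u + F v) ->
  (forall r u, F (scale r u) = r * F u) ->
  (forall u, F u <= P u 0) ->
  (forall u v a b, P (add u v) (a + b) <= P u a + P v b) ->
  (forall r u a, 0 < r -> P (scale r u) (r * a) = r * P u a) ->
  exists a, forall u t, F u + t * a <= P u t.
Proof.
move=> FD FZ F_le PD PZ.
pose E := [set x : R | exists u, x = F u - P u (- 1)]%classic.
have gap u v : F u - P u (- 1) <= P v 1 - F v.
  have := le_trans (F_le (add u v)) (eq_ind _ (fun x => P _ x <= _) (PD u v (- 1) 1) _ (addNr 1)).
  by rewrite FD; lra.
have sup_ge u : F u - P u (- 1) <= sup E.
  by apply: ub_le_sup; [exists (P v0 1 - F v0) => x [w ->]; exact: gap|exists u].
have sup_le v : sup E <= P v 1 - F v.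
  by apply: ge_sup => [|x [u ->]]; [exists (F v0 - P v0 (- 1)), v0|exact: gap].
exists (sup E) => u t; have [t_lt0|t_gt0|->] := ltgtP t 0; last by rewrite mul0r addr0.
  have t_inv : 0 < (- t)^-1 by rewrite invr_gt0 oppr_gt0.
  have := sup_ge (scale (- t)^-1 u); rewrite FZ.
  have -> : - 1 = (- t)^-1 * t by rewrite invrN mulNr mulVf // lt_eqF.
  by rewrite PZ // -mulrBr ler_pdivrMl ?oppr_gt0 // mulNr; lra.
have t_inv : 0 < t^-1 by rewrite invr_gt0.
have := sup_le (scale t^-1 u); rewrite FZ.
have -> : 1 = t^-1 * t by rewrite mulVf // gt_eqF.
by rewrite PZ // -mulrBr ler_pdivlMl //; lra.
Qed.

Section ListNorm.
Variables (R : realType) (X : Type).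
Local Notation C := R[i].
Variable k : X -> X -> C.
Hypothesis k_ker : is_kernel k.

Definition lnorm (u : seq (C * X)) : R := rkhs_norm k (lcomb k u).

Lemma lnorm_sqr u : (lnorm u ^+ 2)%:C = lform k u u.
Proof. by have [] := rkhs_lcomb u k_ker. Qed.

Lemma lnorm_ge0 u : 0 <= lnorm u.
Proof. by apply: rkhs_norm_ge0; have [] := rkhs_lcomb u k_ker. Qed.

Lemma eq_lcomb u v : (forall f, lval f u = lval f v) -> lcomb k u = lcomb k v.
Proof.
have lcombE w z : lcomb k w z = (lval (fun x => (k z x)^*) w)^*.
  by rewrite rmorph_sum; apply: eq_bigr => p _; rewrite rmorphM /= !conjCK.
by move=> uv; apply: funext => z; rewrite !lcombE uv.
Qed.

Lemma eq_lform u v : (forall f, lval f u = lval f v) -> lform k u u = lform k v v.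
Proof. by move=> uv; rewrite /lform (eq_lcomb uv) uv. Qed.

Lemma eq_lnorm u v : (forall f, lval f u = lval f v) -> lnorm u = lnorm v.
Proof. by move=> uv; rewrite /lnorm (eq_lcomb uv). Qed.

Lemma Re_le_cabs (z : C) : complex.Re z <= cabs z.
Proof. by rewrite -lecR cabsE; apply: le_trans (normc_ge_Re z); rewrite lecR ler_norm. Qed.

Lemma lnorm_cat u v : lnorm (u ++ v) <= lnorm u + lnorm v.
Proof.
have lform_catr w : lform k w (u ++ v) = lform k w u + lform k w v.
  by rewrite lform_herm // lform_catl rmorphD /= -!lform_herm.
rewrite -ler_sqr ?nnegrE ?addr_ge0 ?lnorm_ge0 // -lecR lnorm_sqr.
rewrite lform_catl !lform_catr (lform_herm k_ker u v); set z := lform k u v.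
have -> : lform k u u + z + (z^* + lform k v v) =
    (lnorm u ^+ 2 + 2 * complex.Re z + lnorm v ^+ 2)%:C.
  rewrite !rmorphD /= !lnorm_sqr rmorphM rmorph_nat /=.
  by rewrite -addcJ; ring.
have z_le : cabs z <= lnorm u * lnorm v.
  rewrite -ler_sqr ?nnegrE ?cabs_ge0 ?mulr_ge0 ?lnorm_ge0 // -lecR cabs_sqr exprMn rmorphM /=.
  by rewrite !lnorm_sqr; exact: lform_CauchySchwarz.
by rewrite lecR; have := Re_le_cabs z; rewrite sqrrD; lra.
Qed.

Lemma lnorm_scale a u : lnorm (lscale a u) = cabs a * lnorm u.
Proof.
apply/eqP; rewrite -(eqrXn2 (n := 2)) ?mulr_ge0 ?lnorm_ge0 ?cabs_ge0 //; apply/eqP/complexI.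
have -> : ((cabs a * lnorm u) ^+ 2)%:C = normsq a * lform k u u.
  by rewrite exprMn rmorphM /= cabs_sqr lnorm_sqr.
rewrite lnorm_sqr [LHS]lval_scale -[lval _ u]/(lform k u (lscale a u)) lform_herm //.
by rewrite [lform _ _ _]lval_scale rmorphM /= conjCK -lform_herm // mulrA [a^* * a]mulrC.
Qed.

End ListNorm.

Lemma rkhs_bound1P (R : realType) (X : Type) (k : X -> X -> R[i]) f :
  rkhs_bound k f 1 <-> is_kernel (fun x y => k x y - f x * (f y)^*).
Proof.
have formE n (x : 'I_n -> X) c : kform (fun x y => k x y - f x * (f y)^*) x c =
    kform k x c - normsq (\sum_i (c i)^* * f (x i)).
  by rewrite -qform_rank1 -qformB.
split=> [f_le n x c|diff_ker n x c].
  rewrite formE subr_ge0 -normCK; apply: le_trans (f_le n x c) _.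
  by rewrite expr1n mul1r.
by rewrite expr1n mul1r normCK -subr_ge0 -formE; exact: diff_ker.
Qed.

Section OnePointExtension.
Variables (R : realType) (T : Type).
Local Notation C := R[i].

Definition lcons_none (u : seq (C * T)) (z : C) : seq (C * option T) :=
  (z, None) :: [seq (p.1, Some p.2) | p <- u].

Lemma lval_lcons_none f u z :
  lval f (lcons_none u z) = z^* * f None + lval (fun x => f (Some x)) u.
Proof. by rewrite /lval big_cons big_map. Qed.

Lemma lcons_none_surj (w : seq (C * option T)) :
  exists u z, forall f, lval f w = lval f (lcons_none u z).
Proof.
elim: w => [|[a [x|]] w [u [z wE]]].
- by exists [::], 0 => f; rewrite lval_lcons_none /lval !big_nil conjC0 mul0r addr0.
- exists ((a, x) :: u), z => f; rewrite lval_lcons_none /lval !big_cons addrCA.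
  by congr (_ + _); rewrite -[LHS]/(lval f w) wE lval_lcons_none.
- exists u, (a + z) => f; rewrite lval_lcons_none rmorphD mulrDl -addrA /= -lval_lcons_none -wE.
  by rewrite /lval big_cons.
Qed.

Variable k : option T -> option T -> C.
Hypothesis k_ker : is_kernel k.
Local Notation kS := (fun x y => k (Some x) (Some y)).
Local Notation P u z := (lnorm k (lcons_none u z)).

Let P_cat u v a b : P (u ++ v) (a + b) <= P u a + P v b.
Proof.
apply: le_trans (lnorm_cat k_ker _ _); rewrite le_eqVlt; apply/predU1P; left.
by apply: eq_lnorm => f; rewrite lval_cat !lval_lcons_none lval_cat rmorphD /=; ring.
Qed.

Let P_scale a u z : P (lscale a u) (a * z) = cabs a * P u z.
Proof.
rewrite -lnorm_scale //; apply: eq_lnorm => f.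
by rewrite lval_scale !lval_lcons_none lval_scale rmorphM /=; ring.
Qed.

Let P_scale_real r u z : 0 < r -> P (lscale r%:C u) (r%:C * z) = r * P u z.
Proof.
move=> r_gt0; rewrite P_scale; congr (_ * _); apply: complexI.
by rewrite cabsE gtr0_norm ?ltr0c.
Qed.

Variable f : T -> C.
Hypothesis f_le : rkhs_bound kS f 1.

Let dominated u : complex.Re (lval f u) <= P u 0.
Proof.
apply: le_trans (Re_le_cabs _) _.
rewrite -ler_sqr ?nnegrE ?cabs_ge0 ?lnorm_ge0 // -lecR cabs_sqr lnorm_sqr //.
have /rkhs_boundP/(_ u) := f_le; rewrite expr1n mul1r => /le_trans; apply.
rewrite /lform lval_lcons_none conjC0 mul0r add0r.
suff -> : lcomb kS u = (fun x => lcomb k (lcons_none u 0) (Some x)) by [].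
by apply: funext => x; rewrite /lcomb big_cons big_map mul0r add0r.
Qed.

Let dominated_real_extension : exists a b : R, forall u x y,
  complex.Re (lval f u) + x * a + y * b <= P u (x +i* y)%C.
Proof.
have FD u v : complex.Re (lval f (u ++ v)) = complex.Re (lval f u) + complex.Re (lval f v).
  by rewrite lval_cat raddfD.
have FZ (r : R) u : complex.Re (lval f (lscale r%:C u)) = r * complex.Re (lval f u).
  by rewrite lval_scale conjC_real; case: (lval f u) => x y /=; rewrite mul0r subr0.
have [a a_le] : exists a, forall u x, complex.Re (lval f u) + x * a <= P u x%:C.
  apply: (dominated_functional_extend [::] (add := cat) (scale := fun r => lscale r%:C)
    (P := fun u x => P u x%:C)) => [//|//|u|u v x y|r u x r_gt0].
  - exact: dominated.
  - by rewrite rmorphD; exact: P_cat.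
  - by rewrite rmorphM P_scale_real.
have [b b_le] : exists b, forall (v : seq (C * T) * R) y,
    complex.Re (lval f v.1) + v.2 * a + y * b <= P v.1 (v.2 +i* y)%C.
  apply: (dominated_functional_extend ([::], 0)
    (F := fun v : seq (C * T) * R => complex.Re (lval f v.1) + v.2 * a)
    (add := fun v w => (v.1 ++ w.1, v.2 + w.2)) (scale := fun r v => (lscale r%:C v.1, r * v.2))
    (P := fun v y => P v.1 (v.2 +i* y)%C)) => //=.
  - by move=> v w; rewrite FD; ring.
  - by move=> r v; rewrite FZ; ring.
  - by move=> v w x y; exact: (P_cat v.1 w.1 (v.2 +i* x)%C (w.2 +i* y)%C).
  - move=> r v y r_gt0; rewrite -P_scale_real //; congr (P _ _).
    by apply/eqP; rewrite eq_complex /= !mul0r subr0 addr0 !eqxx.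
by exists a, b => u x y; exact: (b_le (u, x)).
Qed.

Lemma rkhs_bound_extend_point : exists t, rkhs_bound k (oapp f t) 1.
Proof.
have [a [b ab_le]] := dominated_real_extension.
pose t : C := (a +i* b)%C; exists t.
have Re_le u z : complex.Re (lval f u + z^* * t) <= P u z.
  case: z => x y; apply: le_trans (ab_le u x y); rewrite raddfD /= -addrA.
  by rewrite lerD2l mulNr opprK.
have cabs_le u z : cabs (lval f u + z^* * t) <= P u z.
  set w := lval f u + z^* * t.
  have [w0|w_neq0] := eqVneq (cabs w) 0; first by rewrite w0 lnorm_ge0.
  have := Re_le (lscale w u) (w * z); rewrite lval_scale rmorphM /= -mulrA -mulrDr -/w P_scale.
  rewrite [w^* * w]mulrC -cabs_sqr /= expr2 ler_pM2l //.
  by rewrite lt0r w_neq0 cabs_ge0.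
apply/rkhs_boundP => w; have [u [z wE]] := lcons_none_surj w.
rewrite expr1n mul1r (eq_lform k wE) wE lval_lcons_none addrC /= -lnorm_sqr // -cabs_sqr.
by rewrite lecR ler_sqr ?nnegrE ?cabs_ge0 ?lnorm_ge0.
Qed.

End OnePointExtension.

Lemma chain_bigcup_finite (T : Type) (H : finType) (F : set (set T)) (z : H -> T) :
  total_on F subset -> (F !=set0)%classic ->
  (forall h, (\bigcup_(Y in F) Y)%classic (z h)) -> exists2 Y, F Y & forall h, Y (z h).
Proof.
move=> F_chain [Y0 FY0] zF.
suff [Y FY Yz] : exists2 Y, F Y & forall h, h \in enum H -> Y (z h).
  by exists Y => // h; apply: Yz; rewrite mem_enum.
elim: (enum H) => [|h r [Y FY Yr]]; first by exists Y0.
have [Z FZ Zh] := zF h; have [YZ|ZY] := F_chain _ _ FY FZ; [exists Z|exists Y] => // h'.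
  by rewrite in_cons => /predU1P[->|/Yr/YZ].
by rewrite in_cons => /predU1P[->|/Yr //]; exact: ZY.
Qed.

(* Tukey's lemma above a given set. *)
Lemma finite_character_maximal (T : Type) (Q : forall H : finType, (H -> T) -> Prop)
    (P := fun A : set T => forall (H : finType) (z : H -> T), (forall h, A (z h)) -> Q H z)
    (A0 : set T) :
  P A0 -> exists A, [/\ (A0 `<=` A)%classic, P A & forall x, P (A `|` [set x])%classic -> A x].
Proof.
move=> P_A0; pose P0 A := P (A0 `|` A)%classic.
have [F F_P F_chain H z zF|A [P_A A_max]] := @Zorn_bigcup T P0.
  have [F_ne|/set0P/negP/negPn/eqP F0] := pselect (F !=set0)%classic; last first.
    by apply: P_A0 => h; have := zF h; rewrite F0 bigcup_set0 setU0.
  have [| |h|_ [Y FY <-] Yz] :=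
    @chain_bigcup_finite _ _ [set (A0 `|` Y)%classic | Y in F]%classic z.
  - move=> _ _ [Y FY <-] [Z FZ <-].
    by have [YZ|ZY] := F_chain _ _ FY FZ; [left|right]; apply: setUS.
  - by have [Y FY] := F_ne; exists (A0 `|` Y)%classic, Y.
  - have [A0z|[Y FY Yz]] := zF h; last by exists (A0 `|` Y)%classic; [exists Y|right].
    by have [Y FY] := F_ne; exists (A0 `|` Y)%classic; [exists Y|left].
  - exact: F_P FY _ _ Yz.
exists (A0 `|` A)%classic; split=> // x P_Ax.
apply: contrapT => nAx; apply: (A_max (A `|` [set x])%classic); last by rewrite /P0 setUA.
split; first by move=> y; left.
by move=> /(_ x) Ax; apply: nAx; right; apply: Ax; right.
Qed.

Section PickExtension.
Variables (R : realType) (X : Type).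
Local Notation C := R[i].

Lemma kernel_option0 (T : Type) (k : T -> T -> C) : is_kernel k ->
  is_kernel (fun o o' => if o is Some x then if o' is Some y then k x y else 0 else 0).
Proof.
set k0 := fun o o' => _; move=> k_ker n x c.
have [u [a uE]] := lcons_none_surj (lfamily x c).
rewrite -[kform _ _ _]lform_family (eq_lform k0 uE) /lform lval_lcons_none.
rewrite {1}/lcomb big1 => [|p _]; last by rewrite mulr0.
rewrite mulr0 add0r -[lval _ _]/(lval (fun y => lcomb k0 (lcons_none u a) (Some y)) u).
have -> : (fun y => lcomb k0 (lcons_none u a) (Some y)) = lcomb k u.
  by apply: funext => y; rewrite /lcomb big_cons big_map mulr0 add0r.
exact: lform_ge0.
Qed.

Variables (B g : X -> X -> C) (M : C).
Hypotheses (B_ker : is_kernel B) (B_lt1 : forall z, B z z < 1) (g_ker : is_kernel g).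
Hypothesis M_ge0 : 0 <= M.
Local Notation s := (pick_kernel B).
Local Notation l := (fun z w => g z w * s z w).
Local Open Scope classical_set_scope.

Let s_gt0 z : 0 < s z z := pick_kernel_gt0 B_lt1 z.

(* Positivity of these matrices says that [p.1 |-> p.2] is, on the points
   considered, a multiplier from [H_s] to [H_l] of squared norm at most [M]. *)
Definition pick_matrix (p q : X * C) : C := (M * g p.1 q.1 - p.2 * (q.2)^*) * s p.1 q.1.

Lemma qform_pick_matrix (H : finType) (p : H -> X * C) c :
  qform (fun i j => pick_matrix (p i) (p j)) c =
  M * fform l (fun i => (p i).1) c -
  fform s (fun i => (p i).1) (fun i => ((p i).2)^* * c i).
Proof.
rewrite -qformZ /fform -(qform_rescale _ (fun i => (p i).2)) -qformB.
by apply: eq_qform => // i j; rewrite /pick_matrix; ring.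
Qed.

Definition pick_graph (G : set (X * C)) := forall (H : finType) (p : H -> X * C),
  (forall h, G (p h)) -> psd (fun i j => pick_matrix (p i) (p j)).

Lemma pick_graph_functional G x a b : pick_graph G -> G (x, a) -> G (x, b) -> a = b.
Proof.
move=> G_pick Ga Gb.
have G_pair (i : bool) : G (if i then (x, a) else (x, b)) by case: i.
have := psd_pair true false 1 (-1) (@G_pick bool _ G_pair).
rewrite /pick_matrix /= rmorphN conjC1.
set m := (X in 0 <= X -> _); have -> : m = - (normsq (a - b) * s x x).
  by rewrite /m rmorphB /=; ring.
rewrite oppr_ge0 pmulr_lle0 // => /normsq_le0/eqP; rewrite subr_eq0.
by move/eqP.
Qed.

Section OnePoint.
Variables (G : set (X * C)) (x0 : X).
Hypothesis G_pick : pick_graph G.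
Let GT := {p : X * C | G p}.
Let pt (o : option GT) : X := oapp (fun p => (sval p).1) x0 o.
Let r := sqrtC (s x0 x0).

Let r_sqr : s x0 x0 = r * r. Proof. by rewrite -expr2 sqrtCK. Qed.
Let r_neq0 : r != 0. Proof. by rewrite sqrtC_eq0 gt_eqF. Qed.
Let r_real : r^* = r. Proof. by rewrite geC0_conj // sqrtC_ge0 ltW. Qed.

(* The Pick matrix of [G] and [(x0, t)] is [extension_form] minus a rank one
   form, and only the latter depends on [t]; completing the latter is extending a
   contractive functional by one dimension. *)
Let extension_form (o o' : option GT) : C :=
  M / s x0 x0 * (g (pt o) (pt o') * (s (pt o) x0 * (s (pt o') x0)^*)) +
  mobius_base B x0 (pt o) (pt o') *
    (if o is Some p then if o' is Some q then pick_matrix (sval p) (sval q) else 0 else 0).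

Let extension_functional (p : GT) : C := (sval p).2 * s (sval p).1 x0 / r.

Let extension_functional_conj p :
  (extension_functional p)^* = ((sval p).2)^* * s x0 (sval p).1 / r.
Proof.
by rewrite rmorphM rmorphM /= [(r^-1)^*]fmorphV /= r_real -(pick_kernel_herm B_ker (sval p).1 x0).
Qed.

Let extension_form_kernel : is_kernel extension_form.
Proof.
have G_ker : is_kernel (fun p q : GT => pick_matrix (sval p) (sval q)).
  by move=> n p; apply: (G_pick (p := fun i => sval (p i))) => i; exact: svalP.
have base_ker := mobius_base_kernel B_ker B_lt1 x0.
have M_s_ge0 : 0 <= M / s x0 x0 by rewrite divr_ge0 // ltW.
apply: kernelD; last first.
  apply: kernelM (kernel_option0 G_ker).
  by move=> n o; exact: (kernel_psd (fun i => pt (o i)) base_ker).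
apply: kernelZ M_s_ge0 _; apply: kernelM (kernel_rank1 (fun o => s (pt o) x0)).
by move=> n o; exact: (kernel_psd (fun i => pt (o i)) g_ker).
Qed.

Let extension_formE p q : extension_form (Some p) (Some q) -
  extension_functional p * (extension_functional q)^* = pick_matrix (sval p) (sval q).
Proof.
rewrite extension_functional_conj /extension_form /extension_functional /pick_matrix /=.
set x := (sval p).1; set y := (sval q).1; rewrite -(pick_kernel_herm B_ker y x0).
have sE : s x x0 * s x0 y = (s x y - s x y * mobius_base B x0 x y) * (r * r).
  rewrite {1}(pick_kernel_mobius B_ker B_lt1 x0 x y) addrK -r_sqr.
  by field; rewrite gt_eqF.
have -> : (sval p).2 * s x x0 / r * (((sval q).2)^* * s x0 y / r) =
    (sval p).2 * ((sval q).2)^* * (s x x0 * s x0 y) / (r * r) by field.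
by rewrite sE r_sqr; field.
Qed.

Lemma pick_graph_extend_point : exists t, pick_graph (G `|` [set (x0, t)]).
Proof.
have functional_le : rkhs_bound (fun p q => extension_form (Some p) (Some q))
    extension_functional 1.
  apply/rkhs_bound1P => n p; apply: eq_psd (G_pick (p := fun i => sval (p i)) _) => [i j|i].
    by rewrite extension_formE.
  exact: svalP.
have [t /rkhs_bound1P t_ker] := rkhs_bound_extend_point extension_form_kernel functional_le.
exists (t / r) => H p Gp.
have /choice[o oP] h : exists o : option GT, p h = oapp sval (x0, t / r) o.
  by have [Gh|->] := Gp h; [exists (Some (exist _ _ Gh))|exists None].
apply: eq_psd (kernel_psd o t_ker) => i j; rewrite !oP.
case: (o i) (o j) => [q|] [q'|] /=; first exact: extension_formE.
- rewrite /extension_form /extension_functional /pick_matrix /= (mobius_base_r B_ker B_lt1).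
  have -> : (t / r)^* = t^* / r by rewrite rmorphM fmorphV /= r_real.
  by rewrite -(pick_kernel_herm B_ker x0 x0) r_sqr; field.
- rewrite extension_functional_conj /extension_form /pick_matrix /= (mobius_base_l B_ker B_lt1).
  by rewrite -(pick_kernel_herm B_ker (sval q').1 x0) r_sqr; field.
- rewrite /extension_form /pick_matrix /= (mobius_base_l B_ker B_lt1).
  have -> : (t / r)^* = t^* / r by rewrite rmorphM fmorphV /= r_real.
  by rewrite -(pick_kernel_herm B_ker x0 x0) r_sqr; field.
Qed.

End OnePoint.

Theorem pick_extension (lam : nat -> X) (v : nat -> C) :
  (forall N (c : 'I_N -> C), fform s (fun i : 'I_N => lam i) (fun i => (v i)^* * c i) <=
     M * fform l (fun i : 'I_N => lam i) c) ->
  exists2 phi : X -> C, forall i, phi (lam i) = v i &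
    forall u, lform s (lmul phi u) (lmul phi u) <= M * lform l u u.
Proof.
move=> v_le; pose G0 : set (X * C) := [set p | exists i, p = (lam i, v i)].
have [H p /finite_range_nat[N [m pE]]|G [G0_sub G_pick G_max]] :=
    @finite_character_maximal _ (fun H p => psd (fun i j => pick_matrix (p i) (p j))) G0.
  have N_psd : psd (fun i j : 'I_N => pick_matrix (lam i, v i) (lam j, v j)).
    move=> c; rewrite (qform_pick_matrix (fun i : 'I_N => (lam i, v i))) subr_ge0.
    exact: v_le.
  by apply: eq_psd (psd_comp m N_psd) => i j; rewrite !pE.
have /choice[phi G_phi] x : exists t, G (x, t).
  by have [t /G_max Gt] := pick_graph_extend_point x G_pick; exists t.
exists phi => [i|u].
  by apply: pick_graph_functional G_pick (G_phi _) _; apply: G0_sub; exists i.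
rewrite -(lfamily_tnth u) lmul_family !lform_family -subr_ge0.
rewrite -(qform_pick_matrix (fun i => (_, phi _))); apply: G_pick => i.
exact: G_phi.
Qed.

End PickExtension.

(** * Interpolating sequences *)

Lemma glue_blocks (T : Type) (P : T -> Prop) (y0 : T) (stop : nat -> nat -> nat)
    (block : nat -> nat -> nat -> T) :
  P y0 -> (forall n k i, P (block n k i)) ->
  exists W : nat -> T, (forall i, P (W i)) /\
    forall k, exists n, forall i, (n <= i < stop n k)%N -> W i = block n k i.
Proof.
move=> P_y0 P_block; pose start k := iteri k (fun k n => maxn n (stop n k)) 0%N.
have start_mono : {homo start : m n / (m <= n)%N}.
  by apply: homo_leq; [exact: leqnn|exact: leq_trans|move=> k; exact: leq_maxl].
have /choice[W W_spec] i : exists y, P y /\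
    forall k, (start k <= i < start k.+1)%N -> y = block (start k) k i.
  have [[k k_spec]|no_k] := pselect (exists k, (start k <= i < start k.+1)%N); last first.
    by exists y0; split=> // k k_spec; case: no_k; exists k.
  exists (block (start k) k i); split=> // k' k'_spec.
  have le_index a b : (start a <= i < start a.+1)%N -> (start b <= i < start b.+1)%N -> (a <= b)%N.
    move=> /andP[a_le _] /andP[_ lt_b]; rewrite leqNgt; apply/negP => /start_mono ba.
    by have := leq_trans lt_b (leq_trans ba a_le); rewrite ltnn.
  suff -> : k' = k by [].
  by apply/eqP; rewrite eqn_leq; apply/andP; split; apply: le_index.
exists W; split=> [i|k]; first exact: (W_spec i).1.
exists (start k) => i /andP[start_le lt_stop]; apply: (W_spec i).2.
by rewrite start_le /= leq_max lt_stop orbT.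
Qed.

Section SignAverages.
Variables (R : realType) (I : finType).
Local Notation C := R[i].

Lemma sum_signs (i j : I) :
  \sum_(e : {ffun I -> bool}) (-1) ^+ e i * (-1) ^+ e j =
  (j == i)%:R * #|{ffun I -> bool}|%:R :> C.
Proof.
have [->|ij] := eqVneq j i.
  by under eq_bigr do rewrite -expr2 sqrr_sign; rewrite sumr_const mul1r.
pose flip (e : {ffun I -> bool}) := [ffun k => e k (+) (k == i)].
have flipK : involutive flip.
  by move=> e; apply/ffunP => k; rewrite !ffunE -addbA addbb addbF.
rewrite mul0r; set S := LHS; suff S_opp : S = - S.
  have : S *+ 2 == 0 by rewrite mulr2n {1}S_opp addNr.
  by rewrite mulrn_eq0 => /eqP.
rewrite {1}/S (reindex_inj (inv_inj flipK)) -sumrN; apply: eq_bigr => e _.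
by rewrite !ffunE eqxx (negPf ij) addbF signr_addb mulrN1 mulNr.
Qed.

Lemma sum_signs_qform (K : I -> I -> C) c :
  \sum_(e : {ffun I -> bool}) qform K (fun i => (-1) ^+ e i * c i) =
  #|{ffun I -> bool}|%:R * \sum_i normsq (c i) * K i i.
Proof.
rewrite /qform exchange_big mulr_sumr; apply: eq_bigr => i _.
rewrite exchange_big [normsq _]mulrC -(sum_deltaM i (fun j => (c i)^* * c j * K i j)) mulr_sumr.
apply: eq_bigr => j _; rewrite [RHS]mulrA [_%:R * _%:R]mulrC -sum_signs mulr_suml.
apply: eq_bigr => e _.
by rewrite rmorphM rmorph_sign; ring.
Qed.

Let signs_gt0 : 0 < #|{ffun I -> bool}|%:R :> C.
Proof. by rewrite ltr0n; apply/card_gt0P; exists [ffun=> true]. Qed.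

Lemma sign_mean_le (K : I -> I -> C) c m :
  (forall e : I -> bool, qform K (fun i => (-1) ^+ e i * c i) <= m) ->
  \sum_i normsq (c i) * K i i <= m.
Proof.
move=> le_m; rewrite -(ler_pM2l signs_gt0) -sum_signs_qform.
apply: (@le_trans _ _ (\sum_(e : {ffun I -> bool}) m)); first exact: ler_sum.
by rewrite sumr_const mulr_natl.
Qed.

Lemma sign_mean_ge (K : I -> I -> C) c m :
  (forall e : I -> bool, m <= qform K (fun i => (-1) ^+ e i * c i)) ->
  m <= \sum_i normsq (c i) * K i i.
Proof.
move=> ge_m; rewrite -(ler_pM2l signs_gt0) -sum_signs_qform.
apply: (@le_trans _ _ (\sum_(e : {ffun I -> bool}) m)); last exact: ler_sum.
by rewrite sumr_const mulr_natl.
Qed.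

End SignAverages.

Section TargetBounds.
Variables (R : realType) (X : Type).
Local Notation C := R[i].
Variables (k l : X -> X -> C) (lam : nat -> X).
Hypotheses (k_ker : is_kernel k) (l_ker : is_kernel l).
Local Notation target_bound := (target_bound k l lam).
Implicit Types (M : R) (w W : nat -> C).

Lemma target_bound_le M M' w : M <= M' -> target_bound M w -> target_bound M' w.
Proof.
move=> MM' w_le N c; apply: le_trans (w_le N c) _.
by rewrite ler_wpM2r ?lecR ?fform_ge0.
Qed.

Lemma not_target_bound_prefix M w : ~ target_bound M w ->
  exists N, forall W, (forall i, (i < N)%N -> W i = w i) -> ~ target_bound M W.
Proof.
move=> /existsNP[N /existsNP[c w_gt]]; exists N => W Ww W_le; apply: w_gt.
have := W_le N c; congr (_ <= _); apply: eq_fform => i.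
by rewrite Ww.
Qed.

Lemma target_boundD M M' w w' : target_bound M w -> target_bound M' w' ->
  target_bound (2 * M + 2 * M') (fun i => w i + w' i).
Proof.
move=> w_le w'_le N c; have -> : (2 * M + 2 * M')%:C = 2 * M%:C + 2 * M'%:C.
  by rewrite rmorphD !rmorphM !rmorph_nat.
rewrite mulrDl -!mulrA.
apply: le_trans (lerD (ler_wpM2l _ (w_le N c)) (ler_wpM2l _ (w'_le N c))) => //.
apply: le_trans (psd_qformD_le _ _ (kernel_psd (fun i : 'I_N => lam i) k_ker)).
rewrite le_eqVlt; apply/predU1P; left; apply: eq_qform => // i.
by rewrite mulrDl rmorphD mulrDl.
Qed.

Lemma target_boundZ M a b w : normsq a <= b%:C -> target_bound M w ->
  target_bound (b * M) (fun i => a * w i).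
Proof.
move=> a_le w_le N c; rewrite rmorphM -mulrA.
have -> : fform k (fun i : 'I_N => lam i)
      (fun i => (a * w i * (knorm l (lam i) / knorm k (lam i))%:C)^* * c i) =
    normsq a * fform k (fun i : 'I_N => lam i)
      (fun i => (w i * (knorm l (lam i) / knorm k (lam i))%:C)^* * c i).
  have -> : normsq a = normsq a^* by rewrite conjCK mulrC.
  rewrite -fform_scale; apply: eq_fform => i.
  by rewrite -[a * _ * _]mulrA rmorphM /= -mulrA.
by apply: ler_pM (w_le N c); rewrite ?mul_conjC_ge0 ?fform_ge0.
Qed.

Hypothesis interp : interpolating k l lam.

Lemma interpolating_target_bound w : (forall i, `|w i| <= 1) -> exists M, target_bound M w.
Proof.
move=> w_le1; have [|phi [/is_multiplierP phi_mult phi_lam]] := interp (w := w).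
  by exists 1 => i; rewrite -lecR cabsE rmorph1.
have [M M_ge0 M_le] := phi_mult k_ker l_ker; exists M => N c.
have := M_le (lfamily (fun i : 'I_N => lam i) c); rewrite lmul_family !lform_family.
by congr (_ <= _); apply: eq_fform => i; rewrite phi_lam.
Qed.

Lemma finite_support_target_bound n : exists M, forall w, (forall i, `|w i| <= 1) ->
  (forall i, (n <= i)%N -> w i = 0) -> target_bound M w.
Proof.
elim: n => [|n [M M_bound]].
  exists 0 => w _ w0 N c; rewrite mul0r /fform /qform big1 // => i _.
  by rewrite w0 // mul0r conjC0 mul0r conjC0 big1 // => j _; rewrite !mul0r.
have [M' M'_bound] : exists M, target_bound M (fun i => (i == n)%:R).
  by apply: interpolating_target_bound => i; case: (i == n); rewrite ?normr1 ?normr0.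
exists (2 * M + 2 * (1 * M')) => w w_le1 w0.
have -> : w = (fun i => (if (i < n)%N then w i else 0) + w n * (i == n)%:R).
  apply: funext => i; have [->|i_neq] := eqVneq i n; first by rewrite ltnn add0r mulr1.
  by rewrite mulr0 addr0; case: ltnP => // n_le; rewrite w0 // ltn_neqAle eq_sym i_neq.
apply: target_boundD; last first.
  by apply: target_boundZ M'_bound; rewrite -normCK rmorph1 expr_le1.
apply: M_bound => i; first by case: ifP; rewrite ?normr0.
by rewrite ltnNge => ->.
Qed.

Lemma bad_block n M : (forall M', exists2 w, forall i, `|w i| <= 1 & ~ target_bound M' w) ->
  exists w N, (forall i, `|w i| <= 1) /\
    forall W, (forall i, `|W i| <= 1) -> (forall i, (n <= i < N)%N -> W i = w i) ->
    ~ target_bound M W.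
Proof.
move=> bad; have [K K_bound] := finite_support_target_bound n.
have [w w_le1 /not_target_bound_prefix[N N_bad]] := bad (2 * M + 2 * (4 * K)).
exists w, N; split=> // W W_le1 Ww W_bound.
pose d i : C := if (i < n)%N then (w i - W i) / 2 else 0.
apply: (N_bad (fun i => W i + 2 * d i)) => [i iN|].
  rewrite /d; case: ltnP => n_le; last by rewrite mulr0 addr0 Ww ?n_le.
  by rewrite mulrC divfK ?pnatr_eq0 // addrC subrK.
apply: target_boundD W_bound _; apply: target_boundZ.
  by rewrite conjC_nat -natrM rmorph_nat.
apply: K_bound => i; last by rewrite /d ltnNge => ->.
rewrite /d; case: ifP => _; rewrite ?normr0 // normrM normfV normr_nat.
rewrite ler_pdivrMr ?ltr0n // mul1r; apply: le_trans (ler_normB _ _) _.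
by rewrite [X in _ <= X]mulr2n lerD.
Qed.

(* Gliding hump: bad blocks assemble into a bad target. *)
Lemma interpolating_uniform_target_bound :
  exists2 M, 0 < M & forall w, (forall i, `|w i| <= 1) -> target_bound M w.
Proof.
suff [M M_bound] : exists M, forall w, (forall i, `|w i| <= 1) -> target_bound M w.
  exists (Num.max 1 M); first by rewrite lt_max ltr01.
  by move=> w /M_bound; apply: target_bound_le; rewrite le_max lexx orbT.
apply: contrapT => unbounded.
have bad M : exists2 w, forall i, `|w i| <= 1 & ~ target_bound M w.
  apply: contrapT => not_bad; apply: unbounded; exists M => w w_le1.
  by apply: contrapT => w_bad; apply: not_bad; exists w.
have /choice[next next_bad] (p : nat * nat) := bad_block p.1 p.2%:R bad.
have {next_bad}/choice[stop stop_bad] p := next_bad p.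
have [|n m i|W [W_le1 W_block]] := @glue_blocks _ (fun z : C => `|z| <= 1) 0
    (fun n m => stop (n, m)) (fun n m => next (n, m)).
- by rewrite normr0.
- exact: (stop_bad (n, m)).1.
have [M M_bound] := interpolating_target_bound W_le1.
have [n Wn] := W_block (Num.bound `|M|).
apply: (stop_bad (n, Num.bound `|M|)).2 W_le1 Wn _.
apply: target_bound_le M_bound; apply: le_trans (ler_norm M) _.
by rewrite ltW // archi_boundP.
Qed.

Hypotheses (k_gt0 : forall z, 0 < k z z) (l_gt0 : forall z, 0 < l z z).

Let ratio (i : nat) : C := (knorm l (lam i) / knorm k (lam i))%:C.

Let ratio_neq0 i : ratio i != 0.
Proof. by rewrite gt_eqF // ltr0c divr_gt0 // knorm_gt0. Qed.

Let ratio_real i : (ratio i)^* = ratio i. Proof. exact: conjC_real. Qed.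

Lemma uniform_sign_bound M N (e : 'I_N -> bool) c :
  (forall w, (forall i, `|w i| <= 1) -> target_bound M w) ->
  fform k (fun i : 'I_N => lam i) (fun i => (-1) ^+ e i * (ratio i * c i)) <=
  M%:C * fform l (fun i : 'I_N => lam i) c.
Proof.
move=> M_bound; pose w i : C := oapp (fun j : 'I_N => (-1) ^+ e j) 0 (insub i).
have w_le1 i : `|w i| <= 1.
  by rewrite /w; case: insub => [j|] /=; rewrite ?normr0 // normrX normrN1 expr1n.
have := M_bound w w_le1 N c; congr (_ <= _); apply: eq_fform => i.
by rewrite /w valK /= rmorphM rmorph_sign /= -/(ratio i) ratio_real mulrA.
Qed.

Lemma interpolating_lower_riesz_bound : exists2 a, 0 < a & lower_riesz_bound l lam a.
Proof.
have [M M_gt0 M_bound] := interpolating_uniform_target_bound.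
exists M^-1 => [|N c]; first by rewrite invr_gt0.
rewrite fmorphV ler_pdivrMl ?ltr0c //.
have -> : \sum_i normsq (c i) * l (lam i) (lam i) =
    \sum_(i < N) normsq (ratio i * c i) * k (lam i) (lam i).
  apply: eq_bigr => i _; rewrite -(norm_ratio_sqr k_ker l_ker (k_gt0 (lam i))) -/(ratio i).
  by rewrite rmorphM /=; ring.
apply: (@sign_mean_le _ _ (fun i j : 'I_N => k (lam i) (lam j))) => e.
exact: uniform_sign_bound.
Qed.

Lemma interpolating_bessel_bound : exists2 b, 0 < b & bessel_bound k lam b.
Proof.
have [M M_gt0 M_bound] := interpolating_uniform_target_bound; exists M => // N a.
pose c (i : 'I_N) := a i / ratio i.
have -> : \sum_i normsq (a i) * k (lam i) (lam i) = \sum_i normsq (c i) * l (lam i) (lam i).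
  apply: eq_bigr => i _; rewrite -(norm_ratio_sqr k_ker l_ker (k_gt0 (lam i))) -/(ratio i).
  rewrite /c rmorphM fmorphV /= ratio_real.
  by move: (ratio i) (ratio_neq0 i) => r r_neq0; field.
rewrite mulrC -ler_pdivrMr ?ltr0c //.
apply: (@sign_mean_ge _ _ (fun i j : 'I_N => l (lam i) (lam j))) => e.
rewrite ler_pdivrMr ?ltr0c // mulrC.
apply: le_trans (uniform_sign_bound e (fun i => (-1) ^+ e i * c i) M_bound).
rewrite le_eqVlt; apply/predU1P; left; apply: eq_fform => i.
by rewrite [ratio i * _]mulrCA signrMK mulrC divfK.
Qed.

End TargetBounds.

Lemma interpolating_carleson (R : realType) (X : Type) (k l : X -> X -> R[i]) lam :
  is_kernel k -> is_kernel l -> (forall z, 0 < k z z) -> (forall z, 0 < l z z) ->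
  interpolating k l lam -> carleson k lam.
Proof.
move=> k_ker l_ker k_gt0 l_gt0 interp.
have [b b_gt0] := interpolating_bessel_bound k_ker l_ker interp k_gt0 l_gt0.
exact: bessel_carleson.
Qed.

Lemma interpolating_weakly_separated (R : realType) (X : Type) (k l : X -> X -> R[i]) lam n :
  is_kernel k -> is_kernel l -> (forall z, 0 < k z z) -> (forall z, 0 < l z z) ->
  interpolating k l lam -> weakly_separated l lam n.
Proof.
move=> k_ker l_ker k_gt0 l_gt0 interp.
have [a a_gt0 a_le] := interpolating_lower_riesz_bound k_ker l_ker interp k_gt0.
apply/weakly_separatedP => //; exists a => //.
exact: lower_riesz_separated (ltW a_gt0) a_le.
Qed.

Lemma carleson_separated_target_bound (R : realType) (X : Type) (B g : X -> X -> R[i]) lam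
    (s := pick_kernel B) (l := fun z w => g z w * s z w) :
  is_kernel B -> (forall z, B z z < 1) -> is_kernel g -> (forall z, 0 < l z z) ->
  injective lam -> carleson s lam ->
  (forall n, (2 <= n)%N -> weakly_separated l lam n) ->
  forall w W, (forall i, cabs (w i) <= W) -> exists2 M, 0 <= M & target_bound s l lam M w.
Proof.
move=> B_ker B_lt1 g_ker l_gt0 lam_inj s_carleson l_sep w W w_le.
have s_ker : is_kernel s := pick_kernel_kernel B_ker B_lt1.
have s_gt0 z : 0 < s z z := pick_kernel_gt0 B_lt1 z.
have l_ker : is_kernel l := kernelM g_ker s_ker.
have [b b_gt0 b_le] := carleson_bessel s_ker s_gt0 s_carleson.
have [b' overlap_le] := carleson_overlap_sum B_ker B_lt1 s_carleson.
have [e e_gt0 e_sep] := strong_separation B_ker B_lt1 g_ker lam_inj l_gt0 overlap_le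
  (fun n n_ge2 => (weakly_separatedP lam l_ker l_gt0 n).1 (l_sep n n_ge2)).
have a_le := strongly_separated_riesz B_ker B_lt1 g_ker b_gt0 e_gt0 b_le e_sep.
have a_gt0 : 0 < e / b by exact: divr_gt0.
exists (b * W ^+ 2 / (e / b)).
  by rewrite divr_ge0 ?(ltW a_gt0) // mulr_ge0 ?sqr_ge0 // ltW.
exact: bessel_riesz_target_bound (ltW b_gt0) b_le a_le w_le.
Qed.

Theorem theorem1p4 (R : realType) (X : Type) (x0 : X)
    (s g : X -> X -> R[i]) (lam : nat -> X) :
  normalized_complete_pick s ->
  is_kernel g ->
  (forall z : X, exists w : X, g w z * s w z != 0) ->
  injective lam ->
  (interpolating s (fun z w => g z w * s z w) lam <->
   carleson s lam /\
   (forall n : nat, (2 <= n)%N ->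
      weakly_separated (fun z w => g z w * s z w) lam n)).
Proof.
move=> /normalized_complete_pickP[B [B_ker B_lt1 ->]] g_ker l_neq0 lam_inj.
set k := pick_kernel B in l_neq0 *; pose l z w := g z w * k z w.
have k_ker : is_kernel k := pick_kernel_kernel B_ker B_lt1.
have k_gt0 z : 0 < k z z := pick_kernel_gt0 B_lt1 z.
have l_ker : is_kernel l := kernelM g_ker k_ker.
have l_gt0 z : 0 < l z z := kernel_diag_gt0 l_ker (l_neq0 z).
split=> [interp|[k_carleson l_sep] w [W w_le]].
  split=> [|n _]; first exact: (interpolating_carleson k_ker l_ker).
  exact: (interpolating_weakly_separated n k_ker l_ker).
have [M M_ge0 w_bound] :=
  carleson_separated_target_bound B_ker B_lt1 g_ker l_gt0 lam_inj k_carleson l_sep w_le.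
have [|phi phi_lam phi_le] := @pick_extension _ _ _ _ M%:C B_ker B_lt1 g_ker _ lam
  (fun i => w i * (knorm l (lam i) / knorm k (lam i))%:C) w_bound.
  by rewrite ler0c.
by exists phi; split=> //; apply/is_multiplierP => //; exists M.
Qed.
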